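(* Suppose that, for some even number $p_0>2$ sufficiently large (depending on the choice of taming, i.e. on the scheme), the coefficients and the initial value of the SDE $dX_t=b(t,X_t)\,dt+\sigma(t,X_t)\,dW_t$, $t\in[0,T]$, satisfy, for all $t,s\in[0,T]$ and $x,y\in\mathbb R^d$, with a constant $C>0$ independent of $t,s,x,y$: (i) $\langle x-y,b(t,x)-b(t,y)\rangle+\frac{p_0-1}{2}\|\sigma(t,x)-\sigma(t,y)\|^2\le C|x-y|^2$; (ii) $|b(t,0)|\vee\|\sigma(t,0)\|\vee\mathbb E|X_0|^{p_0}<\infty$; (iii) $|b(t,x)-b(t,y)|\le C\left(1+|x|^{\kappa-1}+|y|^{\kappa-1}\right)|x-y|$ and $\|\sigma(t,x)-\sigma(t,y)\|\le C\left(1+|x|^{(\kappa-1)/2}+|y|^{(\kappa-1)/2}\right)|x-y|$, for some $\kappa\ge1$; (iv) $|b(t,x)-b(s,x)|\le C\left(1+|x|^{\kappa}\right)|t-s|$ and $\|\sigma(t,x)-\sigma(s,x)\|\le C\left(1+|x|^{(\kappa+1)/2}\right)|t-s|$. Then, for $r<\dfrac{1}{2(\kappa-1)}$ (no upper bound on $r$ if $\kappa=1$), the projected scheme $$\bar X_{k+1}=\Pi\left(\bar X_k+b(t_k,\bar X_k)h+\sigma(t_k,\bar X_k)\Delta W_{k+1}\right)$$ converges to the solution $X$ of the SDE in $L^2$ with rate $1/2$, i.e. $\left(\mathbb E|\bar X_k-X_{t_k}|^2\right)^{1/2}=O(h^{1/2})$.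
   Context: $T>0$ is fixed; $(\Omega,\mathcal F,\mathbb P)$ is a complete probability space with a right-continuous filtration $(\mathcal F_t)_{t\in[0,T]}$; $W$ is an $m$-dimensional $(\mathcal F_t)$-adapted Wiener process; $b:[0,T]\times\mathbb R^d\to\mathbb R^d$ and $\sigma:[0,T]\times\mathbb R^d\to\mathbb R^{d\times m}$ are locally Lipschitz continuous; $X$ is the solution of the SDE with initial value $X_0$. The step size is $0<h\le1$, $t_k=kh$ are the points of the uniform grid on $[0,T]$, and $\Delta W_{k+1}=W_{t_{k+1}}-W_{t_k}$. $|\cdot|$ is the Euclidean norm, $\|\cdot\|$ the Hilbert–Schmidt norm, $a\vee b=\max(a,b)$, $a\wedge b=\min(a,b)$. For a parameter $r>0$, $\Pi:\mathbb R^d\to\mathbb R^d$ is a map (depending on $h$ and $r$) such that $|\Pi x|=|x|\wedge h^{-r}$ for all $x\in\mathbb R^d$; for example $\Pi x=\min\{1,h^{-r}|x|^{-1}\}x$. The scheme is started from $\bar X_0=X_0$ if $|X_0|\le h^{-r}$, and from $\Pi X_0$ otherwise, so that $|\bar X_k|\le h^{-r}$ for all $k\ge0$.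
   Formalization: Besides |Πx| = |x| ∧ h^{-r}, the map Π is assumed Borel and to fix every x with |x| ≤ h^{-r}; with the norm identity alone the claim fails (Πx = −x, b = σ = 0, X_0 a nonzero constant). *)

(* Defs.v *)
From HB Require Import structures.
From mathcomp Require Import all_boot all_order all_algebra.
From mathcomp Require Import all_classical all_reals all_analysis.

Set Implicit Arguments.
Unset Strict Implicit.
Unset Printing Implicit Defensive.

Import Order.TTheory GRing.Theory Num.Theory.
Import numFieldNormedType.Exports.

Local Open Scope classical_set_scope.
Local Open Scope ring_scope.

(* Vectors of R^d are column vectors. The library norm `|A| of a matrix is the
   max norm, hence the following Hilbert-Schmidt norm; on column vectors it is
   the Euclidean norm. *)
Definition hsnorm (R : realType) (m n : nat) (A : 'M[R]_(m, n)) : R :=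
  Num.sqrt (\sum_(i < m) \sum_(j < n) A i j ^+ 2).

Definition dotp (R : realType) (d : nat) (x y : 'cV[R]_d) : R :=
  \sum_(i < d) x i 0 * y i 0.

(* [G] is a sigma-algebra on [Omega]; the target carries its Borel sets. *)
Definition measurable_wrt (Omega : Type) (E : topologicalType)
    (G : set (set Omega)) (Y : Omega -> E) : Prop :=
  forall B : set E, <<s open >> B -> G (Y @^-1` B).

(* Lipschitz in (t, x) on the bounded subsets of [0, T] x R^d; as these are
   relatively compact, this is Lipschitz continuity near every point. *)
Definition locally_lipschitz (R : realType) (T : R) (d m n : nat)
    (f : R -> 'cV[R]_d -> 'M[R]_(m, n)) : Prop :=
  forall N : R, exists L : R, forall (t s : R) (x y : 'cV[R]_d),
    0 <= t <= T -> 0 <= s <= T -> hsnorm x <= N -> hsnorm y <= N ->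
    hsnorm (f t x - f s y) <= L * (`|t - s| + hsnorm (x - y)).

Record right_continuous_filtration (R : realType) (T : R)
    (disp : measure_display) (Omega : measurableType disp)
    (F : R -> set (set Omega)) : Prop := RightContinuousFiltration {
  filtration_sigma_algebra :
    forall t : R, 0 <= t <= T -> sigma_algebra [set: Omega] (F t) ;
  filtration_measurable :
    forall t : R, 0 <= t <= T -> F t `<=` measurable ;
  filtration_nondecreasing :
    forall s t : R, 0 <= s -> s <= t -> t <= T -> F s `<=` F t ;
  filtration_right_continuous :
    forall t : R, 0 <= t < T -> F t = \bigcap_(s in [set s | t < s <= T]) F s }.

Definition adapted (R : realType) (T : R) (Omega : Type) (E : topologicalType)
    (F : R -> set (set Omega)) (Y : R -> Omega -> E) : Prop :=
  forall t : R, 0 <= t <= T -> measurable_wrt (F t) (Y t).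

Definition ae_continuous_paths (R : realType) (T : R)
    (disp : measure_display) (Omega : measurableType disp)
    (P : probability Omega R) (E : topologicalType) (Y : R -> Omega -> E) :
    Prop :=
  {ae P, forall w, {within `[0, T], continuous (fun t => Y t w)}}.

Record wiener_process (R : realType) (T : R)
    (disp : measure_display) (Omega : measurableType disp)
    (P : probability Omega R) (F : R -> set (set Omega)) (m : nat)
    (W : R -> Omega -> 'cV[R]_m) : Prop := WienerProcess {
  wiener_adapted : adapted T F W ;
  wiener_start : {ae P, forall w, W 0 w = 0} ;
  wiener_continuous : ae_continuous_paths T P W ;
  wiener_independent : forall s t : R, 0 <= s -> s < t -> t <= T ->
    forall (G : set Omega) (B : set 'cV[R]_m), F s G -> <<s open >> B ->
    P (G `&` [set w | B (W t w - W s w)]) =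
    (P G * P [set w | B (W t w - W s w)%R])%E ;
  (* the law of W t - W s is N(0, (t - s) I); [normal_prob] takes the mean and
     the standard deviation *)
  wiener_gaussian : forall s t : R, 0 <= s -> s < t -> t <= T ->
    forall A : 'I_m -> set R, (forall i, measurable (A i)) ->
    P [set w | forall i, A i (W t w i 0 - W s w i 0)] =
    (\prod_(i < m) normal_prob 0%R (Num.sqrt (t - s)%R) (A i))%E }.

Definition cvg_to_0_in_probability (R : realType)
    (disp : measure_display) (Omega : measurableType disp)
    (P : probability Omega R) (Y : nat -> Omega -> \bar R) : Prop :=
  forall eps : R, 0 < eps ->
    (forall n, measurable [set w | (eps%:E <= Y n w)%E]) /\
    P [set w | (eps%:E <= Y n w)%E] @[n --> \oo] --> 0%E.

(* The process equal to [step_val i] on ]step_time i, step_time i.+1] for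
   i < step_size. *)
Record step_process (R : realType) (Omega : Type) (d m : nat) := StepProcess {
  step_size : nat ;
  step_time : nat -> R ;
  step_val : nat -> Omega -> 'M[R]_(d, m) }.

Record simple_process (R : realType) (Omega : Type)
    (F : R -> set (set Omega)) (t : R) (d m : nat)
    (S : step_process R Omega d m) : Prop := SimpleProcess {
  simple_start : step_time S 0%N = 0 ;
  simple_end : step_time S (step_size S) = t ;
  simple_increasing : forall i, (i < step_size S)%N ->
    step_time S i < step_time S i.+1 ;
  simple_measurable : forall i, (i < step_size S)%N ->
    measurable_wrt (F (step_time S i)) (step_val S i) ;
  simple_bounded : forall i, (i < step_size S)%N ->
    exists M : R, forall w, hsnorm (step_val S i w) <= M }.

Definition step_eval (R : realType) (Omega : Type) (d m : nat)
    (S : step_process R Omega d m) (u : R) (w : Omega) : 'M[R]_(d, m) :=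
  \sum_(i < step_size S | step_time S i < u <= step_time S i.+1)
    step_val S i w.

Definition step_integral (R : realType) (Omega : Type) (d m : nat)
    (W : R -> Omega -> 'cV[R]_m) (S : step_process R Omega d m) (w : Omega) :
    'cV[R]_d :=
  \sum_(i < step_size S)
    step_val S i w *m (W (step_time S i.+1) w - W (step_time S i) w).

(* [I] is (a version of) the Ito integral of [H] with respect to [W] over
   [0, t]: the limit in probability of the integrals of simple processes that
   approximate [H] in L^2([0, t]), in probability. *)
Definition is_ito_integral (R : realType)
    (disp : measure_display) (Omega : measurableType disp)
    (P : probability Omega R) (F : R -> set (set Omega)) (d m : nat)
    (W : R -> Omega -> 'cV[R]_m) (H : R -> Omega -> 'M[R]_(d, m)) (t : R)
    (I : Omega -> 'cV[R]_d) : Prop :=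
  exists S : nat -> step_process R Omega d m,
    [/\ forall n, simple_process F t (S n),
        cvg_to_0_in_probability P (fun n w =>
          \int[lebesgue_measure]_(u in `[0%R, t])
            ((hsnorm (step_eval (S n) u w - H u w) ^+ 2)%R)%:E)%E &
        cvg_to_0_in_probability P (fun n w =>
          (hsnorm (step_integral W (S n) w - I w))%:E)].

(* dX_t = b(t, X_t) dt + sigma(t, X_t) dW_t on [0, T], with initial value
   [X 0]. The drift integral is taken entrywise. *)
Record sde_solution (R : realType) (T : R)
    (disp : measure_display) (Omega : measurableType disp)
    (P : probability Omega R) (F : R -> set (set Omega)) (d m : nat)
    (b : R -> 'cV[R]_d -> 'cV[R]_d) (sigma : R -> 'cV[R]_d -> 'M[R]_(d, m))
    (W : R -> Omega -> 'cV[R]_m) (X : R -> Omega -> 'cV[R]_d) : Prop :=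
  SdeSolution {
  solution_adapted : adapted T F X ;
  solution_continuous : ae_continuous_paths T P X ;
  solution_equation : forall t : R, 0 <= t <= T ->
    exists I : Omega -> 'cV[R]_d,
      is_ito_integral P F W (fun u w => sigma u (X u w)) t I /\
      {ae P, forall w, X t w = X 0 w
        + (\col_i \int[lebesgue_measure]_(u in `[0, t]) b u (X u w) i 0)
        + I w} }.

(* A Borel retraction onto the closed ball of radius [rho] that sends the
   outside of the ball to the sphere. The norm identity alone would allow
   x |-> - x on the ball, for which the scheme below does not converge; the
   main example is x |-> min(1, rho / |x|) x. *)
Record ball_projection (R : realType) (d : nat) (rho : R)
    (Pi : 'cV[R]_d -> 'cV[R]_d) : Prop := BallProjection {
  projection_measurable : measurable_wrt <<s open >> Pi ;
  projection_norm : forall x, hsnorm (Pi x) = Num.min (hsnorm x) rho ;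
  projection_id : forall x, hsnorm x <= rho -> Pi x = x }.

Fixpoint projected_scheme (R : realType) (Omega : Type) (d m : nat)
    (b : R -> 'cV[R]_d -> 'cV[R]_d) (sigma : R -> 'cV[R]_d -> 'M[R]_(d, m))
    (W : R -> Omega -> 'cV[R]_m) (X0 : Omega -> 'cV[R]_d)
    (r h : R) (Pi : 'cV[R]_d -> 'cV[R]_d) (k : nat) (w : Omega) : 'cV[R]_d :=
  if k is k'.+1 then
    let x := projected_scheme b sigma W X0 r h Pi k' w in
    let t := k'%:R * h in
    let t' := k'.+1%:R * h in
    Pi (x + h *: b t x + sigma t x *m (W t' w - W t w))
  else if hsnorm (X0 w) <= h `^ (- r) then X0 w else Pi (X0 w).

(* Main.v *)
Require Import Defs.
From HB Require Import structures.
From mathcomp Require Import all_boot all_order all_algebra.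
From mathcomp Require Import all_classical all_reals all_analysis.
From mathcomp Require Import measurable_realfun ring lra.

(** The solution X is never shown to have moments. With h/2^n as fine step,
    the Euler sums Y_n = X_0 + sum (b(s, X_s) delta + sigma(s, X_s) dW) along
    the solution converge to X in probability: the drift part is a Riemann sum,
    and the Ito part is compared with simple processes by Lenglart's
    inequality. On the events G(N) = {|X| <= N at the dyadic times up to now},
    which are adapted, conditioning one Wiener increment at a time bounds
    E|X_s - X_t|^2 by C_N |s - t| and E|X - Y_n|^2 by C_N h/2^n; the passage to
    the limit is Fatou's lemma in probability.

    The scheme is interpolated inside each coarse step by
    V = x + eta b(t_k, x) + sigma(t_k, x) (W_{t_k + eta} - W_{t_k}). Large p_0
    and r (kappa - 1) <= 1/2 give moments of V uniform in h, hence consistency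
    errors of order h. For V - Y_n on G(N), monotonicity is applied to
    V - X, and all terms carrying a constant C_N have a factor that vanishes as
    n tends to infinity; the projections cost O(h^2) each, since |V| > h^(-r)
    is rare. Gronwall, then n -> oo, then N -> oo, give
    E|X-bar_k - X_{t_k}|^2 <= K h. *)

Set Implicit Arguments.
Unset Strict Implicit.
Unset Printing Implicit Defensive.

Import Order.TTheory GRing.Theory Num.Theory.
Import numFieldNormedType.Exports.

Local Open Scope classical_set_scope.
Local Open Scope ring_scope.

(** * The Hilbert-Schmidt norm and power inequalities *)

(** No stochastic calculus is applied to the solution. Second moments are computed only for
    recursions [e + del beta + alpha dW] whose coefficients are known at the start of the step,
    where conditioning leaves an affine map of a Gaussian vector. Hence X is never compared with the
    scheme directly: Euler sums stand in for it. Their coefficients are evaluated at X, so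
    monotonicity, which concerns V - X, does not match the error V - Y_n; the mismatch X - Y_n has
    to be small on its own, which is the role of the localised estimates. The lower bound on p_0
    depends on r alone, not on d, m or kappa. This is why Gaussian moments are split in two: the
    part that monotonicity must absorb carries a constant depending only on the exponent q, while
    the part carrying m is controlled on the ball of radius h^(-r). The bound r (kappa - 1) <= 1/2
    also limits kappa in terms of r. The map Pi is not assumed Lipschitz, so a projection enters
    only through the smallness of |Pi x - x| in terms of moments of x. *)

Section HilbertSchmidt.
Variables (R : realType) (m n : nat).
Implicit Types A B : 'M[R]_(m, n).

Definition hsdot A B : R := \sum_(i < m) \sum_(j < n) A i j * B i j.

Lemma hsnorm_ge0 A : 0 <= hsnorm A.
Proof. exact: sqrtr_ge0. Qed.

Lemma sqr_hsnorm A : hsnorm A ^+ 2 = \sum_(i < m) \sum_(j < n) A i j ^+ 2.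
Proof.
rewrite sqr_sqrtr//; apply: sumr_ge0 => i _; apply: sumr_ge0 => j _.
exact: sqr_ge0.
Qed.

Lemma hsdotxx A : hsdot A A = hsnorm A ^+ 2.
Proof. by rewrite sqr_hsnorm; apply: eq_bigr => i _; apply: eq_bigr. Qed.

Lemma hsnorm0 : hsnorm (0 : 'M[R]_(m, n)) = 0.
Proof.
rewrite /hsnorm big1 ?sqrtr0// => i _; rewrite big1// => j _.
by rewrite mxE expr0n.
Qed.

Lemma hsdotDl A A' B : hsdot (A + A') B = hsdot A B + hsdot A' B.
Proof.
rewrite /hsdot -big_split; apply: eq_bigr => i _.
by rewrite -big_split; apply: eq_bigr => j _; rewrite mxE mulrDl.
Qed.

Lemma hsdotC A B : hsdot A B = hsdot B A.
Proof. by apply: eq_bigr => i _; apply: eq_bigr => j _; rewrite mulrC. Qed.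

Lemma hsdotDr A B B' : hsdot A (B + B') = hsdot A B + hsdot A B'.
Proof. by rewrite hsdotC hsdotDl !(hsdotC _ A). Qed.

Lemma hsdotZl a A B : hsdot (a *: A) B = a * hsdot A B.
Proof.
rewrite /hsdot mulr_sumr; apply: eq_bigr => i _.
by rewrite mulr_sumr; apply: eq_bigr => j _; rewrite mxE mulrA.
Qed.

Lemma hsdotZr a A B : hsdot A (a *: B) = a * hsdot A B.
Proof. by rewrite hsdotC hsdotZl hsdotC. Qed.

Lemma hsdotNr A B : hsdot A (- B) = - hsdot A B.
Proof. by rewrite -scaleN1r hsdotZr mulN1r. Qed.

Lemma sqr_hsnormD A B :
  hsnorm (A + B) ^+ 2 = hsnorm A ^+ 2 + 2 * hsdot A B + hsnorm B ^+ 2.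
Proof. rewrite -!hsdotxx !(hsdotDl, hsdotDr) (hsdotC B A); ring. Qed.

Lemma hsnormZ a A : hsnorm (a *: A) = `|a| * hsnorm A.
Proof.
apply/eqP; rewrite -(eqrXn2 (n := 2)) ?hsnorm_ge0 ?mulr_ge0 ?hsnorm_ge0//.
by rewrite exprMn real_normK ?num_real// -!hsdotxx hsdotZl hsdotZr mulrA expr2.
Qed.

Lemma hsnormN A : hsnorm (- A) = hsnorm A.
Proof. by rewrite -scaleN1r hsnormZ normrN1 mul1r. Qed.

Lemma hsnormBC A B : hsnorm (A - B) = hsnorm (B - A).
Proof. by rewrite -hsnormN opprB. Qed.

(** Cauchy-Schwarz, from the nonnegativity of the polynomial [a |-> hsnorm (A + a *: B) ^+ 2]. *)
Lemma hsdot_le A B : `|hsdot A B| <= hsnorm A * hsnorm B.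
Proof.
have key (a : R) : 0 <= hsnorm A ^+ 2 + 2 * a * hsdot A B + a ^+ 2 * hsnorm B ^+ 2.
  have := sqr_ge0 (hsnorm (A + a *: B)).
  by rewrite sqr_hsnormD hsdotZr hsnormZ exprMn real_normK ?num_real// !mulrA.
have A0 := hsnorm_ge0 A; have B0 := hsnorm_ge0 B.
rewrite -(@ler_pXn2r _ 2) ?nnegrE ?mulr_ge0// real_normK ?num_real// exprMn.
have [E|nE] := eqVneq (hsnorm B) 0.
  (* The polynomial has become affine in [a]; unless [hsdot A B = 0], its value at this point is
     -1. *)
  have := key (- (hsnorm A ^+ 2 + 1) / (2 * hsdot A B)).
  rewrite E expr0n/= !mulr0 addr0; have [->|nD] := eqVneq (hsdot A B) 0.
    by rewrite expr0n.
  have -> : 2 * (- (hsnorm A ^+ 2 + 1) / (2 * hsdot A B)) * hsdot A B =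
    - (hsnorm A ^+ 2 + 1) by field.
  by move=> ?; exfalso; lra.
have := key (- hsdot A B / hsnorm B ^+ 2).
have -> : hsnorm A ^+ 2 + 2 * (- hsdot A B / hsnorm B ^+ 2) * hsdot A B +
   (- hsdot A B / hsnorm B ^+ 2) ^+ 2 * hsnorm B ^+ 2 =
   hsnorm A ^+ 2 - hsdot A B ^+ 2 / hsnorm B ^+ 2 by field.
rewrite subr_ge0 ler_pdivrMr// exprn_gt0// lt_def nE; exact: B0.
Qed.

Lemma hsdot_ler A B : hsdot A B <= hsnorm A * hsnorm B.
Proof. exact: le_trans (ler_norm _) (hsdot_le A B). Qed.

Lemma hsnormD A B : hsnorm (A + B) <= hsnorm A + hsnorm B.
Proof.
rewrite -(@ler_pXn2r _ 2) ?nnegrE ?addr_ge0 ?hsnorm_ge0//.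
rewrite sqr_hsnormD; have := hsdot_ler A B; nra.
Qed.

Lemma sqr_hsnormD_le A B :
  hsnorm (A + B) ^+ 2 <= 2 * (hsnorm A ^+ 2 + hsnorm B ^+ 2).
Proof.
have := hsnormD A B; have := hsnorm_ge0 (A + B).
have := sqr_ge0 (hsnorm A - hsnorm B); nra.
Qed.

(** Young's inequality with a free weight. With [e] a time step, the first factor is a Gronwall
    factor, and a second term of higher order in the step loses a single power of it. *)
Lemma sqr_hsnormD_eps (e : R) A B : 0 < e ->
  hsnorm (A + B) ^+ 2 <= (1 + e) * hsnorm A ^+ 2 + (1 + e^-1) * hsnorm B ^+ 2.
Proof.
move=> e0; rewrite sqr_hsnormD.
have := hsdot_ler A B.
have : 0 <= e^-1 * (e * hsnorm A - hsnorm B) ^+ 2.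
  by rewrite mulr_ge0 ?invr_ge0 ?(ltW e0)// sqr_ge0.
have -> : e^-1 * (e * hsnorm A - hsnorm B) ^+ 2 =
  e * hsnorm A ^+ 2 - 2 * (hsnorm A * hsnorm B) + e^-1 * hsnorm B ^+ 2.
  by field; rewrite gt_eqF.
lra.
Qed.

Lemma hsnorm_entry A i j : `|A i j| <= hsnorm A.
Proof.
rewrite -(@ler_pXn2r _ 2) ?nnegrE ?hsnorm_ge0// real_normK ?num_real//.
rewrite sqr_hsnorm (bigD1 i)//= (bigD1 j)//= -addrA lerDl addr_ge0//.
  by apply: sumr_ge0 => ? _; exact: sqr_ge0.
by apply: sumr_ge0 => ? _; apply: sumr_ge0 => ? _; exact: sqr_ge0.
Qed.

(** Passage from the entrywise topology of matrices to [hsnorm]; the value of the constant is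
    immaterial. *)
Lemma hsnorm_le_entries (e : R) A : 0 <= e ->
  (forall i j, `|A i j| <= e) -> hsnorm A <= (m * n)%:R * e.
Proof.
move=> e0 Ae; rewrite -(@ler_pXn2r _ 2) ?nnegrE ?hsnorm_ge0 ?mulr_ge0//.
rewrite sqr_hsnorm.
apply: (@le_trans _ _ (\sum_(i < m) \sum_(j < n) e ^+ 2)).
  apply: ler_sum => i _; apply: ler_sum => j _.
  by rewrite -(real_normK (num_real _)) lerXn2r ?nnegrE.
have -> : \sum_(i < m) \sum_(j < n) e ^+ 2 = (m * n)%:R * e ^+ 2.
  by rewrite !sumr_const !card_ord -mulrnA mulnC -(mulr_natl (e ^+ 2)).
rewrite exprMn ler_wpM2r ?sqr_ge0//.
have [->|N0] := eqVneq (m * n)%N 0%N; first by rewrite expr0n.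
by rewrite expr2 ler_peMr// ler1n lt0n.
Qed.

End HilbertSchmidt.

Lemma dotpE (R : realType) d (x y : 'cV[R]_d) : dotp x y = hsdot x y.
Proof. by apply: eq_bigr => i _; rewrite big_ord1. Qed.

Lemma hsnorm_mulmx (R : realType) m n (A : 'M[R]_(m, n)) (z : 'cV[R]_n) :
  hsnorm (A *m z) <= hsnorm A * hsnorm z.
Proof.
rewrite -(@ler_pXn2r _ 2) ?nnegrE ?mulr_ge0 ?hsnorm_ge0//.
rewrite exprMn [X in X <= _]sqr_hsnorm [X in _ <= X * _]sqr_hsnorm.
rewrite mulr_suml; apply: ler_sum => i _; rewrite big_ord1 mxE.
have := hsdot_le (\col_j A i j) z.
have -> : hsdot (\col_j A i j) z = \sum_j A i j * z j 0.
  by rewrite -dotpE; apply: eq_bigr => j _; rewrite mxE.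
set S := \sum_j _ => H; rewrite -(real_normK (num_real S)).
have -> : \sum_(j < n) A i j ^+ 2 = hsnorm (\col_j A i j) ^+ 2.
  by rewrite sqr_hsnorm; apply: eq_bigr => j _; rewrite big_ord1 mxE.
by rewrite -exprMn lerXn2r ?nnegrE ?mulr_ge0 ?hsnorm_ge0.
Qed.

Section PowerBounds.
Variable R : realType.
Implicit Types x y a c : R.

Lemma ler_expr_1D x (j q : nat) : 0 <= x -> (j <= q)%N -> x ^+ j <= 1 + x ^+ q.
Proof.
move=> x0 jq; have [x1|x1] := lerP x 1.
  by rewrite (le_trans (exprn_ile1 _ x0 x1))// lerDl exprn_ge0.
by rewrite (le_trans (ler_weXn2l (ltW x1) jq))// lerDr.
Qed.

Lemma exprD_le2 x y q : 0 <= x -> 0 <= y ->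
  (x + y) ^+ q <= 2 ^+ q * (x ^+ q + y ^+ q).
Proof.
wlog xy : x y / x <= y.
  move=> H x0 y0; have [|/ltW] := lerP x y; first by move=> /H; apply.
  by move=> /H/(_ y0 x0); rewrite addrC [y ^+ _ + _]addrC.
move=> x0 y0; apply: (@le_trans _ _ ((2 * y) ^+ q)).
  by rewrite lerXn2r ?nnegrE ?addr_ge0 ?mulr_ge0//; lra.
by rewrite exprMn ler_wpM2l ?exprn_ge0// lerDr exprn_ge0.
Qed.

(** Brings the power of a factor [1 + k x] back to the same form, so that higher moments still
    satisfy a linear Gronwall recursion. *)
Lemma onepD_exp_le x (k : R) q : 0 <= x -> x <= 1 -> 0 <= k ->
  (1 + k * x) ^+ q <= 1 + (1 + k) ^+ q * q%:R * x.
Proof.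
move=> x0 x1 k0; elim: q => [|q IH]; first by rewrite expr0 mulr0 mul0r addr0.
have E : (1 + k * x) ^+ q <= (1 + k) ^+ q.
  by rewrite lerXn2r ?nnegrE ?addr_ge0 ?mulr_ge0// lerD2l ler_piMr.
have G : 1 <= (1 + k) ^+ q by rewrite exprn_ege1// lerDl.
rewrite exprSr mulrDr mulr1 (le_trans (lerD IH (ler_wpM2r _ E))) ?mulr_ge0//.
have H : 0 <= k * (q%:R * x) * (1 + k) ^+ q.
  by rewrite !mulr_ge0// (le_trans _ G).
rewrite exprSr -natr1; nra.
Qed.

(* The recursion comes from a simultaneous induction on the parts of
   [(a + c) ^+ q] that are even and odd in [c]. *)
Fixpoint sym_const (q : nat) : R :=
  if q is q'.+1 then 4 + 5 * sym_const q' else 4.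

Lemma sym_const_ge0 q : 0 <= sym_const q.
Proof. by elim: q => [|q IH] /=; lra. Qed.

(** In the application [A = 1 + |y|^2], [v = |z|^2] and [c = 2 <y, z>]; the condition on [c] is then
    Cauchy-Schwarz. Averaging over the sign of [c] cancels its odd powers, so the excess over
    [A ^+ q.+1] is of order [v], hence of the order of the time step, and not of order [sqrt v]. The
    second statement of the induction bounds [c] times the odd part, which feeds the even part at
    the next exponent. *)
Lemma sym_power_le (A v c : R) q : 0 <= A -> 0 <= v -> c ^+ 2 <= 4 * A * v ->
  ((A + v + c) ^+ q.+1 + (A + v - c) ^+ q.+1) / 2
    <= A ^+ q.+1 + sym_const q * v * (A + v) ^+ q.
Proof.
move=> A0 v0 cAv; set a := A + v.
suff /(_ q)[] : forall q, ((a + c) ^+ q.+1 + (a - c) ^+ q.+1) / 2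
    <= A ^+ q.+1 + sym_const q * v * a ^+ q /\
   c * (((a + c) ^+ q.+1 - (a - c) ^+ q.+1) / 2) <= sym_const q * v * a ^+ q.+1 by [].
have a0 : 0 <= a by rewrite addr_ge0.
have cv : c ^+ 2 <= 4 * v * a by rewrite /a; nra.
elim=> [|{}q [IHs IHd]].
  split; first by rewrite !expr1 expr0 /a /=; nra.
  by rewrite !expr1 /=; nra.
set s := (_ + _) / 2 in IHs; set d := (_ - _) / 2 in IHd.
have Aa : A ^+ q.+1 <= a ^+ q.+1.
  by rewrite lerXn2r ?nnegrE// /a lerDl.
have aq0 : 0 <= a ^+ q by rewrite exprn_ge0.
have aq10 : 0 <= a ^+ q.+1 by rewrite exprn_ge0.
have L0 := sym_const_ge0 q; set L := sym_const q in IHs IHd L0 *.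
have -> : ((a + c) ^+ q.+2 + (a - c) ^+ q.+2) / 2 = a * s + c * d.
  by rewrite /s /d !(exprS _ q.+1); field.
have -> : c * (((a + c) ^+ q.+2 - (a - c) ^+ q.+2) / 2) =
    c ^+ 2 * s + a * (c * d) by rewrite /s /d !(exprS _ q.+1); field.
have Lv0 : 0 <= L * v by rewrite mulr_ge0.
have sa : s <= (1 + L) * a ^+ q.+1.
  apply: le_trans IHs _; rewrite mulrDl mul1r lerD// -mulrA ler_wpM2l//.
  by rewrite exprS ler_wpM2r// /a lerDr.
have vA : v * A ^+ q.+1 <= v * a ^+ q.+1 by rewrite ler_wpM2l.
have va0 : 0 <= v * a ^+ q.+1 by rewrite mulr_ge0.
split.
  apply: (le_trans (lerD (ler_wpM2l a0 IHs) IHd)).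
  have -> : a * (A ^+ q.+1 + L * v * a ^+ q) + L * v * a ^+ q.+1 =
    A ^+ q.+2 + v * A ^+ q.+1 + 2 * (L * (v * a ^+ q.+1)).
    by rewrite [A ^+ q.+2]exprS [in a ^+ q.+1]exprS /a; ring.
  have Lva : 0 <= L * (v * a ^+ q.+1) by rewrite mulr_ge0.
  rewrite /= -/L; nra.
have ca : c ^+ 2 * s <= 4 * v * a * ((1 + L) * a ^+ q.+1).
  apply: (le_trans (ler_wpM2l (sqr_ge0 c) sa)); apply: ler_wpM2r => //.
  by rewrite mulr_ge0// addr_ge0.
apply: (le_trans (lerD ca (ler_wpM2l a0 IHd))).
by rewrite /= -/L [a ^+ q.+2]exprS le_eqVlt; apply/orP; left; apply/eqP; ring.
Qed.

Lemma le_expR_pow (x : R) (q : nat) : 0 <= x -> x ^+ q <= q`!%:R * expR x.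
Proof.
move=> x0; case: q => [|q].
  by rewrite expr0 fact0 mul1r -expR0 ler_expR.
rewrite mulrC -ler_pdivrMr ?ltr0n ?fact_gt0//.
by rewrite (le_trans _ (expR_ge1Dxn q x0))// lerDr.
Qed.

End PowerBounds.

(** * Borel measurability of matrix-valued maps *)

Section MatrixMeasurability.
Variable R : realType.

Definition borel_mx a b := g_sigma_algebraType (@open 'M[R]_(a, b)).

(** Entrywise measurability, so that closure under matrix operations reduces to real functions;
    [mx_measurable_preimage] recovers all Borel sets of matrices. *)
Definition mx_measurable d (S : measurableType d) a b (Y : S -> 'M[R]_(a, b)) :=
  forall i j, measurable_fun setT (fun w => Y w i j).

Section Closure.
Context d (S : measurableType d).

Lemma mx_measurable_cst a b (A : 'M[R]_(a, b)) : mx_measurable ((fun=> A) : S -> 'M[R]_(a, b)).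
Proof. by move=> i j; exact: measurable_cst. Qed.

Lemma mx_measurableD a b (Y Z : S -> 'M[R]_(a, b)) :
  mx_measurable Y -> mx_measurable Z -> mx_measurable (fun w => Y w + Z w).
Proof.
move=> mY mZ i j; under eq_fun do rewrite mxE.
exact: measurable_funD.
Qed.

Lemma mx_measurableB a b (Y Z : S -> 'M[R]_(a, b)) :
  mx_measurable Y -> mx_measurable Z -> mx_measurable (fun w => Y w - Z w).
Proof.
move=> mY mZ i j; under eq_fun do rewrite !mxE.
exact: measurable_funB.
Qed.

Lemma mx_measurableZ a b (k : R) (Y : S -> 'M[R]_(a, b)) :
  mx_measurable Y -> mx_measurable (fun w => k *: Y w).
Proof.
move=> mY i j; under eq_fun do rewrite mxE.
by apply: measurable_funM => //; exact: measurable_cst.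
Qed.

Lemma mx_measurableZf a b (k : S -> R) (Y : S -> 'M[R]_(a, b)) :
  measurable_fun setT k -> mx_measurable Y -> mx_measurable (fun w => k w *: Y w).
Proof.
move=> mk mY i j; under eq_fun do rewrite mxE.
exact: measurable_funM.
Qed.

Lemma mx_measurable_sum a b (I : Type) (r : seq I) (P : pred I)
    (Y : I -> S -> 'M[R]_(a, b)) :
  (forall i, P i -> mx_measurable (Y i)) ->
  mx_measurable (fun w => \sum_(i <- r | P i) Y i w).
Proof.
move=> mY; elim: r => [|i r IH].
  have -> : (fun w => \sum_(i <- [::] | P i) Y i w) = (fun=> 0).
    by apply/funext => w; rewrite big_nil.
  exact: mx_measurable_cst.
have -> : (fun w => \sum_(i <- i :: r | P i) Y i w) =
    (fun w => (if P i then Y i w else 0) + \sum_(i <- r | P i) Y i w).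
  by apply/funext => w; rewrite big_cons; case: ifP; rewrite ?add0r.
apply: mx_measurableD => //; case: (P i) (mY i) => [/(_ isT)//|_].
exact: mx_measurable_cst.
Qed.

Lemma mx_measurableM a b c (Y : S -> 'M[R]_(a, b)) (Z : S -> 'M[R]_(b, c)) :
  mx_measurable Y -> mx_measurable Z -> mx_measurable (fun w => Y w *m Z w).
Proof.
move=> mY mZ i j; under eq_fun do rewrite mxE.
by apply: measurable_sum => k; exact: measurable_funM.
Qed.

Lemma measurable_hsnorm2 a b (Y : S -> 'M[R]_(a, b)) :
  mx_measurable Y -> measurable_fun setT (fun w => hsnorm (Y w) ^+ 2).
Proof.
move=> mY.
have -> : (fun w => hsnorm (Y w) ^+ 2) =
    (fun w => \sum_(i < a) \sum_(j < b) Y w i j ^+ 2).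
  by apply/funext => w; rewrite sqr_hsnorm.
apply: measurable_sum => i; apply: measurable_sum => j.
exact: measurable_funX.
Qed.

Lemma measurable_hsnorm a b (Y : S -> 'M[R]_(a, b)) :
  mx_measurable Y -> measurable_fun setT (fun w => hsnorm (Y w)).
Proof.
move=> mY.
have -> : (fun w => hsnorm (Y w)) = (fun w => Num.sqrt (hsnorm (Y w) ^+ 2)).
  by apply/funext => w; rewrite sqrtr_sqr ger0_norm// hsnorm_ge0.
have mS : measurable_fun setT (@Num.sqrt R : R -> R).
  by apply: continuous_measurable_fun; exact: sqrt_continuous.
exact: (measurableT_comp mS (measurable_hsnorm2 mY)).
Qed.

Lemma measurable_hsnorm_le a b (Y : S -> 'M[R]_(a, b)) (c : R) :
  mx_measurable Y -> measurable [set w | hsnorm (Y w) <= c].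
Proof.
move=> mY; rewrite -[X in measurable X]setTI.
have -> : [set w | hsnorm (Y w) <= c] = (fun w => hsnorm (Y w)) @^-1` `]-oo, c].
  by apply/seteqP; split => w /=; rewrite in_itv.
exact: (measurable_hsnorm mY).
Qed.

Lemma measurable_forall_fin (I : finType) (P : I -> set S) :
  (forall i, measurable (P i)) -> measurable [set w | forall i, P i w].
Proof.
move=> mP; have -> : [set w | forall i, P i w] = \bigcap_(i in setT) P i.
  by apply/seteqP; split => w /= H i; [move=> _|]; apply: H.
by apply: fin_bigcap_measurable => //; exact: finite_finset.
Qed.

End Closure.

(** A countable base of the topology, with rational centres and radii [1 / (n + 1)]: it is what
    makes entrywise measurability sufficient for Borel measurability. *)
Definition rat_box a b (p : 'M[rat]_(a, b) * nat) : set 'M[R]_(a, b) :=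
  [set x | forall i j, `|x i j - ratr (p.1 i j)| < p.2.+1%:R^-1].

Lemma open_rat_boxes a b (U : set 'M[R]_(a, b)) : open U ->
  U = \bigcup_p (if `[< rat_box p `<=` U >] then rat_box p else set0).
Proof.
move=> oU; apply/seteqP; split => [x Ux|x [p _]]; last first.
  by case: asboolP => // pU /pU.
have : nbhs x U by apply: open_nbhs_nbhs.
move=> /nbhs_ballP[e /= e0 eU].
have [k ke] : exists k : nat, k.+1%:R^-1 < e / 2.
  exists (Num.truncn ((e / 2)^-1)).
  rewrite invf_plt ?posrE ?divr_gt0//; exact: Num.Theory.truncnS_gt.
have k0 : 0 < k.+1%:R^-1 :> R by rewrite invr_gt0.
have /choice[q qx] : forall ij : 'I_a * 'I_b, exists q : rat,
    `|x ij.1 ij.2 - ratr q| < k.+1%:R^-1.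
  move=> [i j] /=.
  have /rat_in_itvoo[q] : x i j - k.+1%:R^-1 < x i j + k.+1%:R^-1.
    by rewrite ltrBlDr -addrA ltrDl addr_gt0.
  rewrite in_itv/= => /andP[q1 q2]; exists q.
  by rewrite ltr_distlC q1.
exists (\matrix_(i, j) q (i, j), k) => //.
have -> : `[< rat_box (\matrix_(i, j) q (i, j), k) `<=` U >].
  apply/asboolP => y /= yq; apply: eU; split => // i j.
  rewrite /ball/=; have := yq i j; have := qx (i, j); rewrite mxE/= => h1 h2.
  rewrite (_ : x i j - y i j = (x i j - ratr (q (i, j))) - (y i j - ratr (q (i, j)))).
    by rewrite (le_lt_trans (ler_normB _ _))// [e]splitr ltrD// (lt_trans _ ke).
  ring.
by move=> i j /=; rewrite mxE; exact: (qx (i, j)).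
Qed.

Lemma measurable_rat_box d (S : measurableType d) a b (Y : S -> 'M[R]_(a, b)) p :
  mx_measurable Y -> measurable (Y @^-1` rat_box p).
Proof.
move=> mY; have -> : Y @^-1` rat_box p = [set w | forall i, [set w | forall j,
   [set w | `|Y w i j - ratr (p.1 i j)| < p.2.+1%:R^-1] w] w] by [].
apply: measurable_forall_fin => i; apply: measurable_forall_fin => j.
rewrite -[X in measurable X]setTI.
have -> : [set w | `|Y w i j - ratr (p.1 i j)| < p.2.+1%:R^-1] =
  (fun w => Y w i j) @^-1`
     `](ratr (p.1 i j) - p.2.+1%:R^-1), (ratr (p.1 i j) + p.2.+1%:R^-1)[.
  by apply/seteqP; split => w /=; rewrite in_itv/= ltr_distl.
exact: mY.
Qed.

Lemma mx_measurable_preimage d (S : measurableType d) a b (Y : S -> 'M[R]_(a, b)) :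
  mx_measurable Y -> forall B, <<s open >> B -> measurable (Y @^-1` B).
Proof.
move=> mY.
suff H : <<s open >> `<=` [set B | measurable (Y @^-1` B)] by exact: H.
apply: smallest_sub.
  split => /=.
  - by rewrite preimage_set0.
  - by move=> A mA; rewrite setTD preimage_setC; exact: measurableC.
  - by move=> F mF; rewrite preimage_bigcup; exact: bigcupT_measurable.
move=> U /open_rat_boxes -> /=; rewrite preimage_bigcup.
apply: countable_bigcupT_measurable => [|p]; first exact: countableP.
case: ifP => _.
  exact: measurable_rat_box.
by rewrite preimage_set0.
Qed.

Lemma continuous_borel_mx a b (f : 'M[R]_(a, b) -> R) :
  continuous f -> measurable_fun setT (f : borel_mx a b -> R).
Proof.
move=> /continuousP cf; apply: (measurability _ (RGenOpens.measurableE R)).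
move=> _ [_ [x [y ->] <-]]; rewrite setTI.
by apply: sub_sigma_algebra; exact/cf/interval_open.
Qed.

Lemma mx_measurable_borel a b : mx_measurable (id : borel_mx a b -> 'M[R]_(a, b)).
Proof. by move=> i j; apply: continuous_borel_mx; exact: coord_continuous. Qed.

Lemma measurable_wrt_mx (Omega : pointedType) (G : set (set Omega)) a b
    (Y : Omega -> 'M[R]_(a, b)) : sigma_algebra setT G ->
  measurable_wrt G Y <-> mx_measurable (Y : g_sigma_algebraType G -> _).
Proof.
move=> sG; split=> [mY i j _ B mB|mY B mB]; last first.
  by have := mx_measurable_preimage mY mB; rewrite measurable_g_measurableTypeE.
have H : G (Y @^-1` ((fun x => x i j) @^-1` B)).
  apply: mY; rewrite -[X in <<s _ >> X]setTI.
  exact: (@mx_measurable_borel a b i j).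
by rewrite setTI; exact: sub_sigma_algebra.
Qed.

Lemma mx_measurable_sub d (Omega : measurableType d) (G : set (set Omega)) a b
    (Y : Omega -> 'M[R]_(a, b)) : sigma_algebra setT G -> G `<=` measurable ->
  mx_measurable (Y : g_sigma_algebraType G -> _) -> mx_measurable Y.
Proof.
move=> sG Gm mY i j _ B mB; rewrite setTI; apply: Gm.
have := mY i j measurableT B mB.
by rewrite setTI measurable_g_measurableTypeE.
Qed.

Lemma mx_measurable_mono (Omega : pointedType) (G H : set (set Omega)) a b
    (Y : Omega -> 'M[R]_(a, b)) : G `<=` H ->
  mx_measurable (Y : g_sigma_algebraType G -> _) ->
  mx_measurable (Y : g_sigma_algebraType H -> _).
Proof.
move=> GH mY i j _ B mB; have := mY i j measurableT B mB.
by apply: sub_smallest2r => //; exact: smallest_sigma_algebra.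
Qed.

Lemma lipschitz_mx_measurable a b m n (f : 'M[R]_(a, b) -> 'M[R]_(m, n)) :
  (forall N, exists L, forall x y, hsnorm x <= N -> hsnorm y <= N ->
     hsnorm (f x - f y) <= L * hsnorm (x - y)) ->
  mx_measurable (f : borel_mx a b -> _).
Proof.
move=> lf i j; apply: continuous_borel_mx => x.
have [L Lf] := lf (hsnorm x + (a * b)%:R).
apply/(@cvgrPdist_lt _ _ _ _ (nbhs_filter x)) => e e0.
(* The bound 1 keeps [y] in the ball on which [L] is a Lipschitz constant; the other bound makes the
   variation of [f] less than [e]. The term [|L| + 1] covers an [L] that is not positive. *)
set eps := Num.min 1 (e / ((a * b)%:R * (`|L| + 1) + 1)).
have eps0 : 0 < eps.
  by rewrite lt_min ltr01 divr_gt0// ltr_wpDl// mulr_ge0// addr_ge0.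
apply/nbhs_ballP; exists eps => //= y [_ xy'].
have dxy : hsnorm (x - y) <= (a * b)%:R * eps.
  apply: hsnorm_le_entries => [|p q]; first exact: ltW.
  by rewrite !mxE; apply: ltW; exact: xy'.
have hy : hsnorm y <= hsnorm x + (a * b)%:R.
  have -> : y = x + (y - x) by rewrite addrC subrK.
  apply: (le_trans (hsnormD _ _)); rewrite lerD2l hsnormBC.
  by apply: (le_trans dxy); rewrite ler_piMr// ge_min lexx.
have hx : hsnorm x <= hsnorm x + (a * b)%:R by rewrite lerDl.
have := Lf x y hx hy => fxy.
have := hsnorm_entry (f x - f y) i j; rewrite !mxE => fij.
apply: (le_lt_trans fij); apply: (le_lt_trans fxy).
apply: (le_lt_trans (ler_wpM2r (hsnorm_ge0 _) (ler_norm L))).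
apply: (le_lt_trans (ler_wpM2l (normr_ge0 L) dxy)).
have epse : eps <= e / ((a * b)%:R * (`|L| + 1) + 1) by rewrite ge_min lexx orbT.
have D0 : 0 < (a * b)%:R * (`|L| + 1) + 1 :> R.
  by rewrite ltr_wpDl// mulr_ge0// addr_ge0.
rewrite mulrA; apply: (le_lt_trans (ler_wpM2l _ epse)).
  by rewrite mulr_ge0.
rewrite mulrCA gtr_pMr// ltr_pdivrMr// mul1r.
have : 0 <= (a * b)%:R :> R by [].
nra.
Qed.

End MatrixMeasurability.

(** * Gaussian moments *)

Section BoundedExpectation.
Context d (S : measurableType d) (R : realType) (P : probability S R).
Implicit Types f g : S -> R.

(** A finite bound on an extended integral: for nonnegative measurable functions it contains
    integrability, which therefore never appears as a separate condition. *)
Definition Ele f (B : R) := (\int[P]_w (f w)%:E <= B%:E)%E.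

Lemma Ele_mono f g B : measurable_fun setT f -> measurable_fun setT g ->
  (forall w, 0 <= f w) -> (forall w, f w <= g w) -> Ele g B -> Ele f B.
Proof.
move=> mf mg f0 fg; apply: le_trans; apply: ge0_le_integral => //=.
- by move=> w _; rewrite lee_fin.
- exact/measurable_EFinP.
- exact/measurable_EFinP.
- by move=> w _; rewrite lee_fin.
Qed.

Lemma Ele_le f B C : B <= C -> Ele f B -> Ele f C.
Proof. by move=> BC fB; apply: (le_trans fB); rewrite lee_fin. Qed.

Lemma EleD f g B C : measurable_fun setT f -> measurable_fun setT g ->
  (forall w, 0 <= f w) -> (forall w, 0 <= g w) ->
  Ele f B -> Ele g C -> Ele (fun w => f w + g w) (B + C).
Proof.
move=> mf mg f0 g0 fB gC; rewrite /Ele.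
under eq_integral do rewrite EFinD.
rewrite ge0_integralD//=; first by rewrite EFinD leeD.
- by move=> w _; rewrite lee_fin.
- exact/measurable_EFinP.
- by move=> w _; rewrite lee_fin.
- exact/measurable_EFinP.
Qed.

Lemma EleZ (k : R) f B : 0 <= k -> measurable_fun setT f -> (forall w, 0 <= f w) ->
  Ele f B -> Ele (fun w => k * f w) (k * B).
Proof.
move=> k0 mf f0 fB; rewrite /Ele.
under eq_integral do rewrite EFinM.
rewrite ge0_integralZl_EFin//=; first by rewrite EFinM lee_wpmul2l// lee_fin.
- by move=> w _; rewrite lee_fin.
- exact/measurable_EFinP.
Qed.

Lemma Ele_cst (k : R) : Ele (fun=> k) k.
Proof. by rewrite /Ele integral_cst//= probability_setT mule1. Qed.

Lemma Ele_sum n (f : 'I_n -> S -> R) (B : 'I_n -> R) :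
  (forall i, measurable_fun setT (f i)) -> (forall i w, 0 <= f i w) ->
  (forall i, Ele (f i) (B i)) ->
  Ele (fun w => \sum_(i < n) f i w) (\sum_(i < n) B i).
Proof.
move=> mf f0 fB; rewrite /Ele.
under eq_integral do rewrite -sumEFin.
rewrite ge0_integral_sum//=; first by rewrite -sumEFin; apply: lee_sum => i _; exact: fB.
- by move=> i; exact/measurable_EFinP.
- by move=> i w _; rewrite lee_fin.
Qed.

End BoundedExpectation.

(** * Symmetry and even moments of the normal law *)

Section NormalLaw.
Variable R : realType.

(** The change of variables produces the Radon-Nikodym derivative; it equals [normal_pdf] almost
    everywhere because both have the same integral over every measurable set. *)
Lemma ge0_integral_normal_prob (s : R) (f : R -> \bar R) :
  measurable_fun setT f -> (forall x, 0 <= f x)%E ->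
  (\int[normal_prob 0%R s]_x f x =
   \int[lebesgue_measure]_x (f x * (normal_pdf 0 s x)%:E))%E.
Proof.
move=> mf f0.
have dom := normal_prob_dominates 0 s.
rewrite -(Radon_Nikodym_SigmaFinite.change_of_variables dom)//.
have mh := measurable_int _ (Radon_Nikodym_SigmaFinite.f_integrable dom).
have mpdf : measurable_fun setT (fun x : R => (normal_pdf 0 s x)%:E).
  by apply/measurable_EFinP; exact: measurable_normal_pdf.
apply: ae_eq_integral => //.
- exact: emeasurable_funM.
- exact: emeasurable_funM.
- apply: ae_eqe_mul2l; apply: integral_ae_eq => //.
    exact: Radon_Nikodym_SigmaFinite.f_integrable.
  by move=> A _ mA; rewrite -Radon_Nikodym_SigmaFinite.f_integral.
Qed.

Lemma normal_pdf0N (s x : R) : s != 0 -> normal_pdf 0 s (- x) = normal_pdf 0 s x.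
Proof. by move=> s0; rewrite !normal_pdfE// /normal_fun !subr0 sqrrN. Qed.

Lemma normal_prob0N (s : R) (A : set R) : s != 0 -> measurable A ->
  normal_prob 0 s (-%R @^-1` A) = normal_prob 0 s A.
Proof.
move=> s0 mA; rewrite /normal_prob.
under eq_integral do rewrite -normal_pdf0N//.
rewrite -(@ge0_integral_pushforward _ _ (measurableTypeR R) (measurableTypeR R)
   R -%R _ lebesgue_measure A (fun x => (normal_pdf 0 s x)%:E))//.
- by apply: eq_measure_integral => B mB _; exact: lebesgue_measureN.
- by apply/measurable_funTS/measurable_EFinP; exact: measurable_normal_pdf.
- by move=> x _; rewrite lee_fin normal_pdf_ge0.
Qed.

(** The 2 is the ratio of the peaks of the densities of standard deviations [s] and [2 s]; the
    factorial bounds [y^q exp (- y)]; the 3 rounds up 8/3. *)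
Definition gauss_const (q : nat) : R := 2 * (q`!%:R * 3 ^+ q).

Lemma gauss_const_ge0 q : 0 <= gauss_const q.
Proof. by rewrite !mulr_ge0. Qed.

(** The power is absorbed by doubling the standard deviation: what remains is a multiple of a
    density, whose integral is known. *)
Lemma normal_pdf_moment_le (s x : R) q : 0 < s ->
  x ^+ (2 * q) * normal_pdf 0 s x <=
  gauss_const q * s ^+ (2 * q) * normal_pdf 0 (2 * s) x.
Proof.
move=> s0.
have sN0 : s != 0 by rewrite gt_eqF.
have s2N0 : 2 * s != 0 by rewrite mulf_neq0.
rewrite !normal_pdfE// /normal_fun !subr0.
have -> : normal_peak (2 * s) = normal_peak s / 2.
  rewrite /normal_peak -invfM exprMn -mulrA -mulrnAr sqrtrM ?exprn_ge0//.
  by rewrite sqrtr_sqr ger0_norm// mulrC.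
(* The difference of the two exponents, [x^2 / (2 s^2) - x^2 / (8 s^2)]. *)
set y := 3 * x ^+ 2 / (8 * s ^+ 2).
have y0 : 0 <= y by rewrite /y divr_ge0// mulr_ge0// sqr_ge0.
have -> : - x ^+ 2 / (s ^+ 2 *+ 2) = - x ^+ 2 / ((2 * s) ^+ 2 *+ 2) - y.
  by rewrite /y; field.
have -> : x ^+ (2 * q) = (8 / 3 * s ^+ 2) ^+ q * y ^+ q.
  by rewrite -exprMn exprM; congr (_ ^+ _); rewrite /y; field.
rewrite expRD; set E := expR (- x ^+ 2 / _).
have ey : y ^+ q * expR (- y) <= q`!%:R.
  rewrite expRN -ler_pdivlMr ?invr_gt0 ?expR_gt0// invrK.
  exact: le_expR_pow.
have h83 : (8 / 3 * s ^+ 2) ^+ q <= 3 ^+ q * s ^+ (2 * q).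
  have ss : 0 <= s ^+ 2 by exact: sqr_ge0.
  by rewrite exprM -exprMn lerXn2r// ?nnegrE; lra.
have pE : 0 <= normal_peak s * E by rewrite mulr_ge0 ?normal_peak_ge0 ?expR_ge0.
have -> : (8 / 3 * s ^+ 2) ^+ q * y ^+ q * (normal_peak s * (E * expR (- y))) =
  ((8 / 3 * s ^+ 2) ^+ q * (y ^+ q * expR (- y))) * (normal_peak s * E) by ring.
have -> : gauss_const q * s ^+ (2 * q) * (normal_peak s / 2 * E) =
  (3 ^+ q * s ^+ (2 * q) * q`!%:R) * (normal_peak s * E).
  by rewrite /gauss_const; field.
apply: ler_wpM2r => //; apply: ler_pM => //.
  by rewrite exprn_ge0// mulr_ge0 ?sqr_ge0.
by rewrite mulr_ge0 ?expR_ge0 ?exprn_ge0.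
Qed.

Lemma normal_even_moment (s : R) q : 0 < s ->
  (\int[normal_prob 0%R s]_x (x ^+ (2 * q))%:E
     <= (gauss_const q * s ^+ (2 * q))%:E)%E.
Proof.
move=> s0; rewrite ge0_integral_normal_prob; last 2 first.
  by apply/measurable_EFinP; exact: measurable_funX.
  by move=> x; rewrite lee_fin exprM exprn_ge0// sqr_ge0.
apply: (@le_trans _ _ (\int[lebesgue_measure]_x
    ((gauss_const q * s ^+ (2 * q))%:E * (normal_pdf 0 (2 * s) x)%:E))%E).
  apply: ge0_le_integral => //=.
  - by move=> x _; rewrite -EFinM lee_fin mulr_ge0 ?normal_pdf_ge0// exprM exprn_ge0// sqr_ge0.
  - apply/measurable_EFinP; apply: measurable_funM; first exact: measurable_funX.
    exact: measurable_normal_pdf.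
  - apply/measurable_EFinP; apply: measurable_funM; first exact: measurable_cst.
    exact: measurable_normal_pdf.
  by move=> x _; rewrite -!EFinM lee_fin; exact: normal_pdf_moment_le.
rewrite ge0_integralZl_EFin//=.
- by rewrite integral_normal_pdf mule1.
- by move=> x _; rewrite lee_fin normal_pdf_ge0.
- by apply/measurable_EFinP; exact: measurable_normal_pdf.
- by rewrite mulr_ge0 ?gauss_const_ge0// exprn_ge0// ltW.
Qed.

End NormalLaw.

Lemma expr_sum_le (R : realType) m (a : 'I_m -> R) q : (forall i, 0 <= a i) ->
  (\sum_(i < m) a i) ^+ q.+1 <= (2 ^+ q.+1) ^+ m * \sum_(i < m) a i ^+ q.+1.
Proof.
elim: m a => [|m IH] a a0; first by rewrite !big_ord0 expr0n/= mulr0.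
rewrite !big_ord_recl (le_trans (exprD_le2 _ _ _))//.
  by apply: sumr_ge0.
rewrite [in leRHS]exprS -mulrA ler_wpM2l ?exprn_ge0// mulrDr lerD//.
  by rewrite ler_peMl ?exprn_ge0// exprn_ege1// exprn_ege1// ler1n.
by apply: IH.
Qed.

Lemma ge0_integral_normal_law d (S : measurableType d) (R : realType)
    (P : probability S R) (f : S -> R) (s : R) (g : R -> \bar R) :
  measurable_fun setT f -> measurable_fun setT g -> (forall x, 0 <= g x)%E ->
  (forall A, measurable A -> P (f @^-1` A) = normal_prob 0 s A) ->
  (\int[P]_w g (f w) = \int[normal_prob 0%R s]_x g x)%E.
Proof.
move=> mf mg g0 H.
transitivity (\int[pushforward P (f : S -> measurableTypeR R)]_x g x)%E.
  by rewrite ge0_integral_pushforward//= ?preimage_setT.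
apply: eq_measure_integral => A mA _; exact: H.
Qed.

(** * Gaussian vectors through their reflections *)

Section GaussianVector.
Context d (S : measurableType d) (R : realType) (P : probability S R).
Variables (m : nat) (Z : S -> 'cV[R]_m) (s : R).
Hypothesis s0 : 0 < s.
Hypothesis mZ : mx_measurable Z.
Hypothesis lawZ : forall A : 'I_m -> set R, (forall i, measurable (A i)) ->
  P [set w | forall i, A i (Z w i 0)] = (\prod_(i < m) normal_prob 0%R s (A i))%E.

(* The Gaussian law enters only through its invariance under these
   reflections and a crude bound on its even moments: odd terms cancel in
   [f z + f (sign_flip e z)]. *)
Definition sign_flip (e : 'I_m -> bool) (z : 'cV[R]_m) : 'cV[R]_m :=
  \col_i ((-1) ^+ e i * z i 0).

Lemma mx_measurable_sign_flip e d' (S' : measurableType d') (Y : S' -> 'cV[R]_m) :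
  mx_measurable Y -> mx_measurable (fun w => sign_flip e (Y w)).
Proof.
move=> mY i j; under eq_fun do rewrite mxE.
by apply: measurable_funM => //; exact: measurable_cst.
Qed.

Let rect : set (set (borel_mx R m 1)) := [set B | exists2 A : 'I_m -> set R,
  (forall i, measurable (A i)) & B = [set z : 'cV[R]_m | forall i, A i (z i 0)]].

Let measurable_rect B : rect B -> measurable B.
Proof.
move=> [A mA ->]; apply: (@measurable_forall_fin _ (borel_mx R m 1) _
  (fun i => [set z : borel_mx R m 1 | A i ((z : 'cV[R]_m) i 0)])) => i.
by rewrite -[X in measurable X]setTI; exact: (@mx_measurable_borel R m 1 i 0).
Qed.

(** Every rational box is a rectangle, and every open set is a countable union of rational boxes. *)
Let borel_rect : @measurable _ (borel_mx R m 1) = <<s rect >>.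
Proof.
apply/seteqP; split; last first.
  apply: smallest_sub; first exact: sigma_algebra_measurable.
  exact: measurable_rect.
apply: smallest_sub; first exact: smallest_sigma_algebra.
move=> U /open_rat_boxes ->.
have srect : sigma_algebra setT <<s rect >> by exact: smallest_sigma_algebra.
apply: (@countable_bigcupT_measurable _ (g_sigma_algebraType rect)) => [|p].
  exact: countableP.
case: ifP => _; last exact: measurable0.
apply: sub_sigma_algebra.
exists (fun i => `](ratr (p.1 i 0) - p.2.+1%:R^-1), (ratr (p.1 i 0) + p.2.+1%:R^-1)[%classic) => //.
apply/seteqP; split => z /= H i.
  by rewrite in_itv/= -ltr_distl; exact: H.
by move=> j; rewrite ord1; have := H i; rewrite in_itv/= -ltr_distl.
Qed.

Lemma borel_measurable_map d' (S' : measurableType d') (Y : S' -> 'cV[R]_m) :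
  mx_measurable Y -> measurable_fun setT (Y : S' -> borel_mx R m 1).
Proof. by move=> mY _ B mB; rewrite setTI; exact: (mx_measurable_preimage mY mB). Qed.

(** By the symmetry of each coordinate, the laws of [Z] and of its reflection agree on measurable
    rectangles, a pi-system that generates the Borel sets. *)
Lemma gauss_sign_flip e (f : 'cV[R]_m -> \bar R) :
  measurable_fun setT (f : borel_mx R m 1 -> \bar R) -> (forall z, 0 <= f z)%E ->
  (\int[P]_w f (Z w) = \int[P]_w f (sign_flip e (Z w)))%E.
Proof.
move=> mf f0.
have mZb := borel_measurable_map mZ.
have mFb := borel_measurable_map (mx_measurable_sign_flip e mZ).
transitivity (\int[pushforward P (Z : S -> borel_mx R m 1)]_z f z)%E.
  by rewrite ge0_integral_pushforward//= ?preimage_setT//.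
transitivity (\int[pushforward P ((fun w => sign_flip e (Z w)) : S -> borel_mx R m 1)]_z f z)%E;
  last by rewrite ge0_integral_pushforward//= ?preimage_setT//.
apply: eq_measure_integral => A mA _.
apply: (@measure_unique _ R (borel_mx R m 1) rect (fun=> setT)) => //.
- move=> _ _ [A1 mA1 ->] [A2 mA2 ->]; exists (fun i => A1 i `&` A2 i).
    by move=> i; exact: measurableI.
  apply/seteqP; split => z /=; first by move=> [H1 H2] i; split; [exact: H1|exact: H2].
  by move=> H; split => i; have [] := H i.
- by move=> _; exists (fun=> setT) => //; apply/seteqP.
- by rewrite bigcup_const.
- move=> _ [B mB ->] /=.
  rewrite /pushforward.
  pose B' i := if e i then -%R @^-1` B i else B i.
  have mB' i : measurable (B' i).
    rewrite /B'; case: ifP => // _; rewrite -[X in measurable X]setTI.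
    exact: oppr_measurable.
  transitivity (P [set w | forall i, B i (Z w i 0)]); first by [].
  transitivity (P [set w | forall i, B' i (Z w i 0)]).
    rewrite !lawZ//; apply: eq_bigr => i _; rewrite /B'; case: ifP => // _.
    by rewrite normal_prob0N// gt_eqF.
  congr (P _); apply/seteqP; split => w /= H i; have := H i.
    by rewrite /B' mxE; case: (e i); rewrite /= ?expr1 ?mulN1r ?expr0 ?mul1r.
  by rewrite /B' mxE; case: (e i); rewrite /= ?expr1 ?mulN1r ?expr0 ?mul1r.
- move=> k; rewrite /pushforward; apply: (le_lt_trans (probability_le1 _ _)).
    by rewrite preimage_setT.
  exact: ltry.
Qed.

Lemma gauss_coord_moment i q :
  Ele P (fun w => Z w i 0 ^+ (2 * q)) (gauss_const R q * s ^+ (2 * q)).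
Proof.
rewrite /Ele; apply: le_trans (normal_even_moment q s0).
have mZi := mZ i 0.
have mX : measurable_fun setT (fun x : R => (x ^+ (2 * q))%:E).
  by apply/measurable_EFinP; exact: measurable_funX.
have X0 x : (0 <= (x ^+ (2 * q))%:E :> \bar R)%E.
  by rewrite lee_fin exprM exprn_ge0// sqr_ge0.
rewrite (@ge0_integral_normal_law _ _ _ P (fun w => Z w i 0) s
  (fun x => (x ^+ (2 * q))%:E))// => A mA.
(* The law of one coordinate is read off a rectangle whose other sides are the whole line. *)
transitivity (P [set w | forall j, (if j == i then A else setT) (Z w j 0)]).
  congr (P _); apply/seteqP; split => w /=.
    by move=> Aw j; case: eqP => // ->.
  by move=> /(_ i); rewrite eqxx.
rewrite (@lawZ (fun j => if j == i then A else setT)) => [|j]; last by case: ifP.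
rewrite (bigD1 i)//= eqxx big1 ?mule1// => j /negbTE ->.
by rewrite /normal_prob integral_normal_pdf.
Qed.

Lemma measurable_borelf (f : 'cV[R]_m -> R) :
  measurable_fun setT (f : borel_mx R m 1 -> R) ->
  measurable_fun setT (fun w => f (Z w)).
Proof. by move=> mf; apply: (measurableT_comp mf); exact: borel_measurable_map. Qed.

Lemma gauss_norm_moment q : Ele P (fun w => (hsnorm (Z w) ^+ 2) ^+ q.+1)
  ((2 ^+ q.+1) ^+ m * (m%:R * (gauss_const R q.+1 * (s ^+ 2) ^+ q.+1))).
Proof.
have mZq i : measurable_fun setT (fun w => (Z w i 0 ^+ 2) ^+ q.+1).
  by do 2 apply: measurable_funX; exact: mZ.
apply: (@Ele_mono _ _ _ _ _ (fun w =>
   (2 ^+ q.+1) ^+ m * (\sum_(i < m) (Z w i 0 ^+ 2) ^+ q.+1))).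
- by apply: measurable_funX; exact: measurable_hsnorm2.
- by apply: measurable_funM; [exact: measurable_cst|exact: measurable_sum].
- by move=> w; rewrite exprn_ge0// sqr_ge0.
- move=> w; rewrite sqr_hsnorm; under eq_bigr do rewrite big_ord1.
  by apply: expr_sum_le => i; exact: sqr_ge0.
apply: EleZ; first by rewrite !exprn_ge0.
  exact: measurable_sum.
  by move=> w; apply: sumr_ge0 => i _; rewrite exprn_ge0// sqr_ge0.
have -> : m%:R * (gauss_const R q.+1 * (s ^+ 2) ^+ q.+1) =
    \sum_(i < m) (gauss_const R q.+1 * (s ^+ 2) ^+ q.+1).
  by rewrite sumr_const card_ord mulr_natl.
apply: Ele_sum => // [i w|i]; first by rewrite exprn_ge0// sqr_ge0.
have := gauss_coord_moment i q.+1; rewrite exprM /Ele.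
by under eq_integral do rewrite exprM.
Qed.

(** [f] has the same expectation at [Z] and at its reflection, so it suffices to bound the mean of
    the two values pointwise; odd terms have then disappeared. *)
Lemma gauss_sym_le e (f : 'cV[R]_m -> R) (g : S -> R) B :
  measurable_fun setT (f : borel_mx R m 1 -> R) -> (forall z, 0 <= f z) ->
  measurable_fun setT g ->
  (forall w, f (Z w) + f (sign_flip e (Z w)) <= 2 * g w) ->
  Ele P g B -> Ele P (fun w => f (Z w)) B.
Proof.
move=> mf f0 mg fg gB.
have g0 w : 0 <= g w by have := fg w; have := f0 (Z w); have := f0 (sign_flip e (Z w)); lra.
have mfZ := measurable_borelf mf.
have mfF : measurable_fun setT (fun w => f (sign_flip e (Z w))).
  apply: (measurableT_comp mf); apply: borel_measurable_map.
  exact: mx_measurable_sign_flip.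
have H : Ele P (fun w => f (Z w) + f (sign_flip e (Z w))) (2 * B).
  apply: (@Ele_mono _ _ _ _ _ (fun w => 2 * g w)) => //.
  - exact: measurable_funD.
  - by apply: measurable_funM => //; exact: measurable_cst.
  - by move=> w; rewrite addr_ge0.
  - exact: EleZ.
move: H; rewrite /Ele; under eq_integral do rewrite EFinD.
rewrite ge0_integralD//=; last 4 first.
- by move=> w _; rewrite lee_fin.
- exact/measurable_EFinP.
- by move=> w _; rewrite lee_fin.
- exact/measurable_EFinP.
rewrite -(@gauss_sign_flip e (fun z => (f z)%:E))//; last exact/measurable_EFinP.
case: (integral _ _ _) => [x| |]// H; last exact: leNye.
have : ((x + x)%:E <= (2 * B)%:E)%E by exact: H.
by rewrite !lee_fin => ?; lra.
Qed.

(* The sharp constant is 1; [6 = gauss_const R 1] comes from the crude moment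
   bound and is absorbed by taking [p0] large. *)
Lemma gauss_affine_sqr n (u : 'cV[R]_n) (A : 'M[R]_(n, m)) :
  Ele P (fun w => hsnorm (u + A *m Z w) ^+ 2)
    (hsnorm u ^+ 2 + 6 * s ^+ 2 * hsnorm A ^+ 2).
Proof.
(* The columns of [A] are added one at a time: reflecting coordinate [k] alone cancels the cross
   term between the partial sum and the new column. *)
pose v k (z : 'cV[R]_m) := u + \sum_(i < m | (i < k)%N) z i 0 *: col i A.
have mv k d' (S' : measurableType d') (Y : S' -> 'cV[R]_m) : mx_measurable Y ->
    mx_measurable (fun w => v k (Y w)).
  move=> mY; apply: mx_measurableD; first exact: mx_measurable_cst.
  apply: mx_measurable_sum => i _; apply: mx_measurableZf; first exact: mY.
  exact: mx_measurable_cst.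
have key k : (k <= m)%N -> Ele P (fun w => hsnorm (v k (Z w)) ^+ 2)
    (hsnorm u ^+ 2 + \sum_(i < m | (i < k)%N) hsnorm (col i A) ^+ 2 * (6 * s ^+ 2)).
  elim: k => [|k IH] km.
    rewrite big_pred0_eq addr0 /v.
    rewrite /Ele; under eq_integral do rewrite big_pred0_eq addr0.
    exact: Ele_cst.
  pose ik := Ordinal km.
  have vS z : v k.+1 z = v k z + z ik 0 *: col ik A.
    rewrite /v -addrA; congr (_ + _).
    rewrite (bigD1 ik)//= addrC; congr (_ + _); apply: eq_bigl => i.
    by rewrite ltnS andbC [in RHS]ltn_neqAle -(inj_eq val_inj).
  have vflip z : v k.+1 (sign_flip (fun i => i == ik) z) = v k z - z ik 0 *: col ik A.
    rewrite vS mxE eqxx mulN1r scaleNr; congr (_ - _).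
    rewrite /v; congr (_ + _); apply: eq_bigr => i ik'.
    rewrite mxE; case: eqP => [E|_]; last by rewrite expr0 mul1r.
    by move: ik'; rewrite E ltnn.
  have vb : measurable_fun setT ((fun z => hsnorm (v k.+1 z) ^+ 2) : borel_mx R m 1 -> R).
    by apply: measurable_hsnorm2; apply: mv; exact: mx_measurable_borel.
  rewrite [X in _ + X](bigD1 ik)//= [X in _ + X]addrC addrA.
  rewrite (eq_bigl (fun i : 'I_m => (i < k)%N)); last first.
    by move=> i; rewrite ltnS andbC [in RHS]ltn_neqAle -(inj_eq val_inj).
  have mv' := mv k _ _ _ mZ.
  have mc : mx_measurable (fun w => Z w ik 0 *: col ik A).
    by apply: mx_measurableZf; [exact: mZ|exact: mx_measurable_cst].
  have E1 : Ele P (fun w => hsnorm (v k (Z w)) ^+ 2 + hsnorm (Z w ik 0 *: col ik A) ^+ 2)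
    (hsnorm u ^+ 2 + \sum_(i < m | (i < k)%N) hsnorm (col i A) ^+ 2 * (6 * s ^+ 2)
      + hsnorm (col ik A) ^+ 2 * (6 * s ^+ 2)).
    apply: EleD; try by move=> w; exact: sqr_ge0.
    - exact: measurable_hsnorm2.
    - exact: measurable_hsnorm2.
    - by apply: IH; exact: ltnW.
    - have -> : (fun w => hsnorm (Z w ik 0 *: col ik A) ^+ 2) =
        (fun w => hsnorm (col ik A) ^+ 2 * Z w ik 0 ^+ 2).
        by apply/funext => w; rewrite hsnormZ exprMn real_normK ?num_real// mulrC.
      apply: EleZ; [exact: sqr_ge0| |by move=> w; exact: sqr_ge0|].
        by apply: measurable_funX; exact: mZ.
      have -> : 6 * s ^+ 2 = gauss_const R 1 * s ^+ (2 * 1).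
        by rewrite /gauss_const (_ : 1`! = 1%N)// muln1; ring.
      exact: (gauss_coord_moment ik 1).
  move: E1; rewrite -addrA; apply: (@gauss_sym_le (fun i => i == ik) _ _ _ vb) => //.
  - by move=> z; exact: sqr_ge0.
  - by apply: measurable_funD; exact: measurable_hsnorm2.
  - move=> w; rewrite vflip vS !sqr_hsnormD hsdotNr hsnormN; lra.
have vm z : v m z = u + A *m z.
  rewrite /v; congr (_ + _); apply/matrixP => i j; rewrite ord1 mxE summxE.
  by apply: eq_big => [k|k _]; [rewrite ltn_ord|rewrite !mxE mulrC].
have := key m (leqnn m).
rewrite /Ele; under eq_integral do rewrite vm.
move=> /le_trans; apply; rewrite lee_fin lerD2l -mulr_suml [leLHS]mulrC.
apply: ler_wpM2l; first by rewrite mulr_ge0 ?sqr_ge0.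
rewrite [leRHS]sqr_hsnorm exchange_big/=.
rewrite (eq_bigl xpredT) => [|k]; last by rewrite ltn_ord.
apply: ler_sum => k _; rewrite sqr_hsnorm; apply: ler_sum => i _.
by rewrite big_ord1 mxE.
Qed.

(** The whole vector is reflected, and [sym_power_le] leaves two terms. The one linear in
    [s^2 |A|^2] uses [gauss_affine_sqr], so its constant is free of [m] and can be absorbed by
    monotonicity. The top power uses [hsnorm_mulmx] and a moment of [|Z|], whose constant depends on
    [m]. *)
Lemma gauss_affine_power n (y : 'cV[R]_n) (A : 'M[R]_(n, m)) q :
  Ele P (fun w => (1 + hsnorm (y + A *m Z w) ^+ 2) ^+ q.+1)
    ((1 + hsnorm y ^+ 2) ^+ q.+1 + sym_const R q * (2 ^+ q *
       ((1 + hsnorm y ^+ 2) ^+ q * (6 * (s ^+ 2 * hsnorm A ^+ 2)) +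
        (2 ^+ q.+1) ^+ m * (m%:R * gauss_const R q.+1)
          * (s ^+ 2 * hsnorm A ^+ 2) ^+ q.+1))).
Proof.
have mAZ d' (S' : measurableType d') (Y : S' -> 'cV[R]_m) : mx_measurable Y ->
    mx_measurable (fun w => A *m Y w).
  by move=> mY; apply: mx_measurableM => //; exact: mx_measurable_cst.
have mf : measurable_fun setT
    ((fun z => (1 + hsnorm (y + A *m z) ^+ 2) ^+ q.+1) : borel_mx R m 1 -> R).
  apply: measurable_funX; apply: measurable_funD; first exact: measurable_cst.
  apply: measurable_hsnorm2; apply: mx_measurableD; first exact: mx_measurable_cst.
  by apply: mAZ; exact: mx_measurable_borel.
have mv := measurable_hsnorm2 (mAZ _ _ _ mZ).
have A0 : 0 <= 1 + hsnorm y ^+ 2 by rewrite addr_ge0 ?sqr_ge0.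
pose g w := (1 + hsnorm y ^+ 2) ^+ q.+1 + sym_const R q * (2 ^+ q *
   ((1 + hsnorm y ^+ 2) ^+ q * hsnorm (A *m Z w) ^+ 2 +
    (hsnorm (A *m Z w) ^+ 2) ^+ q.+1)).
have mg1 : measurable_fun setT (fun w => (1 + hsnorm y ^+ 2) ^+ q * hsnorm (A *m Z w) ^+ 2).
  by apply: measurable_funM => //; exact: measurable_cst.
have mg2 : measurable_fun setT (fun w => (hsnorm (A *m Z w) ^+ 2) ^+ q.+1).
  exact: measurable_funX.
have mg3 := measurable_funD mg1 mg2.
have mg4 : measurable_fun setT (fun w => 2 ^+ q *
   ((1 + hsnorm y ^+ 2) ^+ q * hsnorm (A *m Z w) ^+ 2 +
    (hsnorm (A *m Z w) ^+ 2) ^+ q.+1)).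
  by apply: measurable_funM => //; exact: measurable_cst.
have mg5 : measurable_fun setT (fun w => sym_const R q * (2 ^+ q *
   ((1 + hsnorm y ^+ 2) ^+ q * hsnorm (A *m Z w) ^+ 2 +
    (hsnorm (A *m Z w) ^+ 2) ^+ q.+1))).
  by apply: measurable_funM => //; exact: measurable_cst.
have L0 := sym_const_ge0 R q.
have g10 w : 0 <= (1 + hsnorm y ^+ 2) ^+ q * hsnorm (A *m Z w) ^+ 2.
  by apply: mulr_ge0; [exact: exprn_ge0|exact: sqr_ge0].
have g20 w : 0 <= (hsnorm (A *m Z w) ^+ 2) ^+ q.+1 by rewrite exprn_ge0 ?sqr_ge0.
have g30 w := addr_ge0 (g10 w) (g20 w).
have g40 w : 0 <= 2 ^+ q * ((1 + hsnorm y ^+ 2) ^+ q * hsnorm (A *m Z w) ^+ 2 +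
    (hsnorm (A *m Z w) ^+ 2) ^+ q.+1) by rewrite mulr_ge0.
apply: (@gauss_sym_le (fun=> true) (fun z => (1 + hsnorm (y + A *m z) ^+ 2) ^+ q.+1) g) => //.
- by move=> z; rewrite exprn_ge0// addr_ge0 ?sqr_ge0.
- by apply: measurable_funD => //; exact: measurable_cst.
- move=> w; set z := Z w; have -> : sign_flip (fun=> true) z = - z.
    by apply/colP => i; rewrite !mxE expr1 mulN1r.
  rewrite mulmxN !sqr_hsnormD hsdotNr hsnormN.
  set v := hsnorm (A *m z) ^+ 2; set c := 2 * hsdot y (A *m z).
  have cv : c ^+ 2 <= 4 * (1 + hsnorm y ^+ 2) * v.
    rewrite /c /v exprMn -natrX/= -mulrA ler_wpM2l//.
    have := hsdot_le y (A *m z) => H.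
    rewrite -(real_normK (num_real (hsdot _ _))) mulrDl mul1r -exprMn.
    rewrite (@le_trans _ _ ((hsnorm y * hsnorm (A *m z)) ^+ 2))//.
      by rewrite lerXn2r ?nnegrE ?mulr_ge0 ?hsnorm_ge0.
    by rewrite lerDr sqr_ge0.
  have v0 : 0 <= v by exact: sqr_ge0.
  have := sym_power_le q A0 v0 cv.
  have -> : 1 + hsnorm y ^+ 2 + v + c = 1 + (hsnorm y ^+ 2 + c + v) by ring.
  have -> : 1 + hsnorm y ^+ 2 + v - c = 1 + (hsnorm y ^+ 2 + 2 * - hsdot y (A *m z) + v).
    by rewrite /c; ring.
  have := ler_wpM2l (mulr_ge0 L0 v0) (exprD_le2 q A0 v0).
  rewrite /g -/v; have -> : sym_const R q * v *
     (2 ^+ q * ((1 + hsnorm y ^+ 2) ^+ q + v ^+ q)) =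
     sym_const R q * (2 ^+ q * ((1 + hsnorm y ^+ 2) ^+ q * v + v ^+ q.+1)).
    by rewrite [v ^+ q.+1]exprS; ring.
  lra.
- apply: EleD => //.
    by move=> w; exact: exprn_ge0.
    by move=> w; rewrite mulr_ge0.
    exact: Ele_cst.
  apply: EleZ => //; apply: EleZ => //; apply: EleD => //.
    apply: EleZ => //; [exact: exprn_ge0|by move=> w; exact: sqr_ge0|].
    have := gauss_affine_sqr 0 A; rewrite hsnorm0 expr0n add0r mulrA /Ele.
    by under eq_integral do rewrite add0r.
  apply: (@Ele_mono _ _ _ _ _ (fun w => (hsnorm A ^+ 2) ^+ q.+1 * (hsnorm (Z w) ^+ 2) ^+ q.+1)) => //.
  + apply: measurable_funM; first exact: measurable_cst.
    by apply: measurable_funX; exact: measurable_hsnorm2.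
  + move=> w; rewrite -!exprMn lerXn2r ?nnegrE ?exprn_ge0 ?mulr_ge0 ?hsnorm_ge0//.
    by rewrite lerXn2r ?nnegrE ?mulr_ge0 ?hsnorm_ge0// hsnorm_mulmx.
  + have mN : measurable_fun setT (fun w => (hsnorm (Z w) ^+ 2) ^+ q.+1).
      by apply: measurable_funX; exact: measurable_hsnorm2.
    have N0 w : 0 <= (hsnorm (Z w) ^+ 2) ^+ q.+1 by rewrite exprn_ge0// sqr_ge0.
    have := EleZ (exprn_ge0 q.+1 (sqr_ge0 (hsnorm A))) mN N0 (gauss_norm_moment q).
    apply: Ele_le; rewrite [(s ^+ 2 * _) ^+ q.+1]exprMn.
    by rewrite le_eqVlt; apply/orP; left; apply/eqP; ring.
Qed.

End GaussianVector.

(** * One step of a Wiener process *)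

Section Freezing.
Context d (S : measurableType d) (R : realType) (P : probability S R).
Variables (G : set (set S)) (m : nat) (Z : S -> 'cV[R]_m).
Hypothesis sG : sigma_algebra setT G.
Hypothesis Gm : G `<=` measurable.
Hypothesis mZ : mx_measurable Z.
Hypothesis indep : forall A B, G A -> <<s open >> B ->
  P (A `&` Z @^-1` B) = (P A * P (Z @^-1` B))%E.

Let GT := g_sigma_algebraType G.
Let ZT := borel_mx R m 1.

Let mid : measurable_fun setT (id : S -> GT).
Proof.
move=> _ B mB; rewrite setTI preimage_id; apply: Gm.
by move: mB; rewrite measurable_g_measurableTypeE.
Qed.

Let mZT : measurable_fun setT (Z : S -> ZT).
Proof. exact: borel_measurable_map. Qed.

Let mpair : measurable_fun setT ((fun w => (w, Z w)) : S -> (GT * ZT)%type).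
Proof. exact: measurable_fun_pair. Qed.

Let mid_mixin := isMeasurableFun.Build _ _ _ _ _ mid.
Let fid : {mfun S >-> GT} := HB.pack (id : S -> GT) mid_mixin.
Let mZT_mixin := isMeasurableFun.Build _ _ _ _ _ mZT.
Let fZ : {mfun S >-> ZT} := HB.pack (Z : S -> ZT) mZT_mixin.
Let mpair_mixin := isMeasurableFun.Build _ _ _ _ _ mpair.
Let fpair : {mfun S >-> (GT * ZT)%type} :=
  HB.pack ((fun w => (w, Z w)) : S -> (GT * ZT)%type) mpair_mixin.

(** Freezing: an argument measurable for [G] is held fixed while the independent variable is
    integrated. Independence says that the joint law of the identity, with values in the space
    carrying [G], and of [Z] is a product measure; Tonelli's theorem does the rest. Only an upper
    bound [bnd] of the inner integral is asked for. *)
Lemma freeze_le (g : S -> 'cV[R]_m -> R) (bnd : S -> R) (K : R) :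
  measurable_fun setT ((fun p => g p.1 p.2) : (GT * ZT)%type -> R) ->
  (forall w z, 0 <= g w z) -> measurable_fun setT bnd ->
  (forall w, Ele P (fun w' => g w (Z w')) (bnd w)) ->
  Ele P bnd K -> Ele P (fun w => g w (Z w)) K.
Proof.
move=> mg g0 mb gb; apply: le_trans.
have mgE : measurable_fun setT ((fun p => (g p.1 p.2)%:E) : (GT * ZT)%type -> \bar R).
  exact/measurable_EFinP.
have gE0 (p : GT * ZT) : (0 <= (g p.1 p.2)%:E)%E by rewrite lee_fin.
have -> : (\int[P]_w (g w (Z w))%:E =
    \int[distribution P fpair]_p (g p.1 p.2)%:E)%E.
  by rewrite ge0_integral_distribution.
have -> : (\int[distribution P fpair]_p (g p.1 p.2)%:E =
    \int[distribution P fid \x distribution P fZ]_p (g p.1 p.2)%:E)%E.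
  apply: eq_measure_integral => A mA _; apply/esym.
  apply: product_measure_unique => // B C mB mC.
  have GB : G B by move: mB; rewrite measurable_g_measurableTypeE.
  exact: (indep GB mC).
rewrite fubini_tonelli1// ge0_integral_distribution//; last 2 first.
- exact: (@measurable_fun_fubini_tonelli_F _ _ _ _ _ _ _ mgE gE0).
- by move=> w; apply: integral_ge0.
have mF : measurable_fun setT (fun w => \int[distribution P fZ]_z (g w z)%:E)%E.
  have := @measurable_fun_fubini_tonelli_F _ _ _ _ _ (distribution P fZ) _ mgE gE0.
  by move=> /measurableT_comp/(_ mid).
apply: ge0_le_integral => //.
- by move=> w _; apply: integral_ge0.
- exact/measurable_EFinP.
- move=> w _ /=; rewrite /fubini_F /=.
  rewrite ge0_integral_distribution//; [exact: gb| |by move=> z; rewrite lee_fin].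
  by have := @measurable_fun_pair2 _ _ _ GT ZT _ _ (w : GT) mgE.
Qed.

End Freezing.

(** * Filtrations and moments over one Wiener increment *)

Section Filtered.
Context (R : realType) (T : R) (disp : measure_display)
  (Omega : measurableType disp) (P : probability Omega R)
  (F : R -> set (set Omega)) (m : nat) (W : R -> Omega -> 'cV[R]_m).
Hypothesis rcF : right_continuous_filtration T F.
Hypothesis wW : wiener_process T P F W.

Definition Fmx (t : R) a b (Y : Omega -> 'M[R]_(a, b)) :=
  mx_measurable (Y : g_sigma_algebraType (F t) -> 'M[R]_(a, b)).

Lemma Fmx_mono s t a b (Y : Omega -> 'M[R]_(a, b)) :
  0 <= s -> s <= t -> t <= T -> Fmx s Y -> Fmx t Y.
Proof.
move=> s0 st tT; apply: mx_measurable_mono.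
exact: (filtration_nondecreasing rcF).
Qed.

Lemma Fmx_measurable t a b (Y : Omega -> 'M[R]_(a, b)) :
  0 <= t -> t <= T -> Fmx t Y -> mx_measurable Y.
Proof.
move=> t0 tT; have tI : 0 <= t <= T by rewrite t0.
apply: mx_measurable_sub; first exact: (filtration_sigma_algebra rcF tI).
exact: (filtration_measurable rcF tI).
Qed.

Lemma Fmx_adapted t a b (Y : R -> Omega -> 'M[R]_(a, b)) :
  0 <= t -> t <= T -> adapted T F Y -> Fmx t (Y t).
Proof.
move=> t0 tT /(_ t); rewrite t0 => /(_ tT) mY.
by apply/measurable_wrt_mx => //; apply: (filtration_sigma_algebra rcF); rewrite t0.
Qed.

Lemma increment_measurable s t : 0 <= s -> s <= t -> t <= T ->
  Fmx t (fun w => W t w - W s w).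
Proof.
move=> s0 st tT; have t0 := le_trans s0 st; have sT := le_trans st tT.
apply: mx_measurableB; first exact: (Fmx_adapted t0 tT (wiener_adapted wW)).
exact: (Fmx_mono s0 st tT (Fmx_adapted s0 sT (wiener_adapted wW))).
Qed.

Lemma Fset_indic_measurable t G : 0 <= t -> t <= T -> F t G ->
  measurable_fun setT (\1_G : g_sigma_algebraType (F t) -> R).
Proof.
move=> t0 tT FG; apply: measurable_indic.
by apply: sub_sigma_algebra.
Qed.

Lemma Fset_measurable t G : 0 <= t -> t <= T -> F t G -> measurable G.
Proof. by move=> t0 tT; apply: (filtration_measurable rcF); rewrite t0. Qed.

Section OneStep.
Variables (s t : R).
Hypotheses (s0 : 0 <= s) (st : s < t) (tT : t <= T).

Let sT : s <= T. Proof. exact: le_trans (ltW st) tT. Qed.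
Let sI : 0 <= s <= T. Proof. by rewrite s0 sT. Qed.
Let Z w := W t w - W s w.

Let mZ : mx_measurable Z.
Proof.
apply: (@Fmx_measurable t) => //; first exact: le_trans s0 (ltW st).
exact: (increment_measurable s0 (ltW st) tT).
Qed.

Let ts0 : 0 < Num.sqrt (t - s).
Proof. by rewrite sqrtr_gt0 subr_gt0. Qed.

Let lawZ (A : 'I_m -> set R) : (forall i, measurable (A i)) ->
  P [set w | forall i, A i (Z w i 0)] =
  (\prod_(i < m) normal_prob 0%R (Num.sqrt (t - s)%R) (A i))%E.
Proof.
move=> mA; rewrite -(wiener_gaussian wW s0 st tT mA); congr (P _).
by apply/seteqP; split => w /= H i; have := H i; rewrite /Z !mxE.
Qed.

Let sqr_ts : Num.sqrt (t - s) ^+ 2 = t - s.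
Proof. by rewrite sqr_sqrtr// subr_ge0 ltW. Qed.

Lemma increment_freeze (g : Omega -> 'cV[R]_m -> R) (bnd : Omega -> R) (K : R) :
  measurable_fun setT ((fun p => g p.1 p.2) :
    (g_sigma_algebraType (F s) * borel_mx R m 1)%type -> R) ->
  (forall w z, 0 <= g w z) -> measurable_fun setT bnd ->
  (forall w, Ele P (fun w' => g w (W t w' - W s w')) (bnd w)) ->
  Ele P bnd K -> Ele P (fun w => g w (W t w - W s w)) K.
Proof.
apply: freeze_le => //.
- exact: (filtration_sigma_algebra rcF sI).
- exact: (filtration_measurable rcF sI).
- by move=> A B FA mB; exact: (wiener_independent wW s0 st tT).
Qed.

Let mfst a b (Y : Omega -> 'M[R]_(a, b)) : Fmx s Y ->
  mx_measurable ((fun p => Y p.1) :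
    (g_sigma_algebraType (F s) * borel_mx R m 1)%type -> 'M[R]_(a, b)).
Proof.
by move=> mY i j; apply: (measurableT_comp (mY i j)).
Qed.

Let msnd : mx_measurable ((fun p => p.2) :
    (g_sigma_algebraType (F s) * borel_mx R m 1)%type -> 'cV[R]_m).
Proof.
by move=> i j; apply: (measurableT_comp (@mx_measurable_borel R m 1 i j)).
Qed.

(** The indicator of an event of [F s] is frozen together with the coefficients. This permits
    localisation by adapted events without stopping the processes. *)
Lemma step_second_moment n (G : set Omega) (u : Omega -> 'cV[R]_n)
    (A : Omega -> 'M[R]_(n, m)) K :
  F s G -> Fmx s u -> Fmx s A ->
  Ele P (fun w => \1_G w * (hsnorm (u w) ^+ 2 + 6 * (t - s) * hsnorm (A w) ^+ 2)) K ->
  Ele P (fun w => \1_G w * hsnorm (u w + A w *m (W t w - W s w)) ^+ 2) K.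
Proof.
move=> FG mu mA.
have mGO : measurable_fun setT (\1_G : Omega -> R).
  exact/measurable_indic/(Fset_measurable s0 sT FG).
apply: (increment_freeze (g := fun w z => \1_G w * hsnorm (u w + A w *m z) ^+ 2)).
- apply: measurable_funM.
    by apply: (measurableT_comp (Fset_indic_measurable s0 sT FG)).
  apply: measurable_hsnorm2; apply: mx_measurableD; first exact: mfst.
  by apply: mx_measurableM; [exact: mfst|exact: msnd].
- by move=> w z; rewrite mulr_ge0 ?sqr_ge0// indicE.
- apply: measurable_funM => //; apply: measurable_funD.
    by apply: measurable_hsnorm2; exact: (Fmx_measurable s0 sT mu).
  apply: measurable_funM; first exact: measurable_cst.
  by apply: measurable_hsnorm2; exact: (Fmx_measurable s0 sT mA).
- move=> w; apply: EleZ; first by rewrite indicE.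
  + apply: measurable_hsnorm2; apply: mx_measurableD; first exact: mx_measurable_cst.
    by apply: mx_measurableM => //; exact: mx_measurable_cst.
  + by move=> w'; exact: sqr_ge0.
  + by rewrite -sqr_ts; exact: (gauss_affine_sqr ts0 mZ lawZ).
Qed.

Lemma step_power_moment n (y : Omega -> 'cV[R]_n) (A : Omega -> 'M[R]_(n, m)) q K :
  Fmx s y -> Fmx s A ->
  Ele P (fun w => (1 + hsnorm (y w) ^+ 2) ^+ q.+1 + sym_const R q * (2 ^+ q *
       ((1 + hsnorm (y w) ^+ 2) ^+ q * (6 * ((t - s) * hsnorm (A w) ^+ 2)) +
        (2 ^+ q.+1) ^+ m * (m%:R * gauss_const R q.+1)
          * ((t - s) * hsnorm (A w) ^+ 2) ^+ q.+1))) K ->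
  Ele P (fun w => (1 + hsnorm (y w + A w *m (W t w - W s w)) ^+ 2) ^+ q.+1) K.
Proof.
move=> my mA.
have my' := measurable_hsnorm2 (Fmx_measurable s0 sT my).
have mA' := measurable_hsnorm2 (Fmx_measurable s0 sT mA).
have my1 k : measurable_fun setT (fun w => (1 + hsnorm (y w) ^+ 2) ^+ k).
  by apply: measurable_funX; apply: measurable_funD => //; exact: measurable_cst.
have mA1 : measurable_fun setT (fun w => (t - s) * hsnorm (A w) ^+ 2).
  by apply: measurable_funM => //; exact: measurable_cst.
apply: (increment_freeze (g := fun w z => (1 + hsnorm (y w + A w *m z) ^+ 2) ^+ q.+1)).
- apply: measurable_funX; apply: measurable_funD; first exact: measurable_cst.
  apply: measurable_hsnorm2; apply: mx_measurableD; first exact: mfst.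
  by apply: mx_measurableM; [exact: mfst|exact: msnd].
- by move=> w z; rewrite exprn_ge0// addr_ge0 ?sqr_ge0.
- apply: measurable_funD => //; apply: measurable_funM; first exact: measurable_cst.
  apply: measurable_funM; first exact: measurable_cst.
  apply: measurable_funD; apply: measurable_funM => //; try exact: measurable_cst.
  + by apply: measurable_funM => //; exact: measurable_cst.
  + exact: measurable_funX.
- by move=> w; rewrite -sqr_ts; exact: (gauss_affine_power ts0 mZ lawZ).
Qed.

Lemma step_fourth_moment n (A : Omega -> 'M[R]_(n, m)) K :
  Fmx s A ->
  Ele P (fun w => (2 ^+ 2) ^+ m * (m%:R * gauss_const R 2) *
     ((t - s) * hsnorm (A w) ^+ 2) ^+ 2) K ->
  Ele P (fun w => hsnorm (A w *m (W t w - W s w)) ^+ 4) K.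
Proof.
move=> mA.
have mA' := measurable_hsnorm2 (Fmx_measurable s0 sT mA).
have mA1 : measurable_fun setT (fun w => (t - s) * hsnorm (A w) ^+ 2).
  by apply: measurable_funM => //; exact: measurable_cst.
apply: (increment_freeze (g := fun w z => hsnorm (A w *m z) ^+ 4)).
- apply: measurable_funX; apply: measurable_hsnorm.
  by apply: mx_measurableM; [exact: mfst|exact: msnd].
- by move=> w z; rewrite exprn_ge0// hsnorm_ge0.
- apply: measurable_funM; first exact: measurable_cst.
  exact: measurable_funX.
- move=> w.
  have mN : measurable_fun setT (fun w => (hsnorm (Z w) ^+ 2) ^+ 2).
    by apply: measurable_funX; exact: measurable_hsnorm2.
  apply: (@Ele_mono _ _ _ _ _ (fun w' => (hsnorm (A w) ^+ 2) ^+ 2 * (hsnorm (Z w') ^+ 2) ^+ 2)).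
  + apply: measurable_funX; apply: measurable_hsnorm.
    by apply: mx_measurableM => //; exact: mx_measurable_cst.
  + by apply: measurable_funM => //; exact: measurable_cst.
  + by move=> w'; rewrite exprn_ge0// hsnorm_ge0.
  + move=> w'; rewrite -!exprM -exprMn lerXn2r ?nnegrE ?mulr_ge0 ?hsnorm_ge0//.
    exact: hsnorm_mulmx.
  + have N0 w' : 0 <= (hsnorm (Z w') ^+ 2) ^+ 2 by rewrite exprn_ge0// sqr_ge0.
    have := EleZ (exprn_ge0 2 (sqr_ge0 (hsnorm (A w)))) mN N0
      (gauss_norm_moment ts0 mZ lawZ 1).
    apply: Ele_le; rewrite sqr_ts le_eqVlt; apply/orP; left; apply/eqP; ring.
Qed.

End OneStep.
End Filtered.

(** * Growth of the coefficients *)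

(* Powers of [jap x] replace the weights 1 + |x|^a of (iii) and (iv), so that
   only natural exponents occur. *)
Definition jap (R : realType) d (x : 'cV[R]_d) : R := 1 + hsnorm x ^+ 2.

Section JapaneseBracket.
Variables (R : realType) (d : nat).
Implicit Types x y : 'cV[R]_d.

Lemma jap_ge1 x : 1 <= jap x.
Proof. by rewrite /jap lerDl sqr_ge0. Qed.

Lemma jap_gt0 x : 0 < jap x.
Proof. exact: lt_le_trans ltr01 (jap_ge1 x). Qed.

Lemma jap_ge0 x : 0 <= jap x.
Proof. exact/ltW/jap_gt0. Qed.

Lemma japX_ge0 x k : 0 <= jap x ^+ k.
Proof. exact/exprn_ge0/jap_ge0. Qed.

Lemma japX_ge1 x k : 1 <= jap x ^+ k.
Proof. exact/exprn_ege1/jap_ge1. Qed.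

Lemma hsnorm_le_jap x : hsnorm x <= jap x.
Proof. by rewrite /jap; have := sqr_ge0 (hsnorm x - 1); nra. Qed.

Lemma sqr_hsnorm_le_jap x : hsnorm x ^+ 2 <= jap x.
Proof. by rewrite /jap lerDr. Qed.

Lemma japX_le x i j : (i <= j)%N -> jap x ^+ i <= jap x ^+ j.
Proof. by move=> ij; exact/ler_weXn2l/ij/jap_ge1. Qed.

Lemma powR_le_jap x (a : R) l : 0 <= a -> a <= l%:R -> hsnorm x `^ a <= jap x ^+ l.
Proof.
move=> a0 al; apply: (@le_trans _ _ (jap x `^ a)).
  by apply: ge0_ler_powR => //; rewrite ?nnegrE ?hsnorm_ge0 ?jap_ge0// hsnorm_le_jap.
by rewrite -powR_mulrn ?jap_ge0// ler_powR// jap_ge1.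
Qed.

End JapaneseBracket.

(** The value is 1 at exponent 0, that is, when [kappa = 1]. *)
Lemma powR0_le1 (R : realType) (a : R) : 0 `^ a <= 1.
Proof. by rewrite /powR eqxx; case: (a == 0); rewrite ?ler01 ?lexx. Qed.

Section Coefficients.
Context (R : realType) (d m : nat) (T C M kappa pp : R) (l : nat)
  (b : R -> 'cV[R]_d -> 'cV[R]_d) (sigma : R -> 'cV[R]_d -> 'M[R]_(d, m)).

(** Here [pp] stands for [p0 - 1], [l] for an integer above [kappa - 1], and [M] for a common bound
    of both coefficients at the origin. *)
Record sde_coefficients : Prop := SdeCoefficients {
  coef_C : 0 < C ;
  coef_M : 0 <= M ;
  coef_kappa : 1 <= kappa ;
  coef_l : kappa - 1 <= l%:R ;
  coef_mono : forall (t : R) (x y : 'cV[R]_d), 0 <= t <= T ->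
    dotp (x - y) (b t x - b t y) + pp / 2 * hsnorm (sigma t x - sigma t y) ^+ 2
    <= C * hsnorm (x - y) ^+ 2 ;
  coef_b0 : forall t, 0 <= t <= T -> hsnorm (b t 0) <= M ;
  coef_s0 : forall t, 0 <= t <= T -> hsnorm (sigma t 0) <= M ;
  coef_bx : forall (t : R) (x y : 'cV[R]_d), 0 <= t <= T ->
    hsnorm (b t x - b t y)
    <= C * (1 + hsnorm x `^ (kappa - 1) + hsnorm y `^ (kappa - 1))
         * hsnorm (x - y) ;
  coef_sx : forall (t : R) (x y : 'cV[R]_d), 0 <= t <= T ->
    hsnorm (sigma t x - sigma t y)
    <= C * (1 + hsnorm x `^ ((kappa - 1) / 2) + hsnorm y `^ ((kappa - 1) / 2))
         * hsnorm (x - y) ;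
  coef_bt : forall (t s : R) (x : 'cV[R]_d), 0 <= t <= T -> 0 <= s <= T ->
    hsnorm (b t x - b s x) <= C * (1 + hsnorm x `^ kappa) * `|t - s| ;
  coef_st : forall (t s : R) (x : 'cV[R]_d), 0 <= t <= T -> 0 <= s <= T ->
    hsnorm (sigma t x - sigma s x)
    <= C * (1 + hsnorm x `^ ((kappa + 1) / 2)) * `|t - s| }.

Hypothesis H : sde_coefficients.

Lemma b_growth t x : 0 <= t <= T ->
  hsnorm (b t x) <= M + C * (2 + hsnorm x `^ (kappa - 1)) * hsnorm x.
Proof.
move=> tT; have -> : b t x = b t 0 + (b t x - b t 0) by rewrite addrC subrK.
apply: (le_trans (hsnormD _ _)); apply: lerD; first exact: (coef_b0 H).
apply: (le_trans (coef_bx H x 0 tT)); rewrite subr0 hsnorm0.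
apply: ler_wpM2r; first exact: hsnorm_ge0.
apply: ler_wpM2l; first exact/ltW/(coef_C H).
have := powR0_le1 (kappa - 1); lra.
Qed.

Lemma s_growth t x : 0 <= t <= T ->
  hsnorm (sigma t x) <= M + C * (2 + hsnorm x `^ ((kappa - 1) / 2)) * hsnorm x.
Proof.
move=> tT; have -> : sigma t x = sigma t 0 + (sigma t x - sigma t 0) by rewrite addrC subrK.
apply: (le_trans (hsnormD _ _)); apply: lerD; first exact: (coef_s0 H).
apply: (le_trans (coef_sx H x 0 tT)); rewrite subr0 hsnorm0.
apply: ler_wpM2r; first exact: hsnorm_ge0.
apply: ler_wpM2l; first exact/ltW/(coef_C H).
have := powR0_le1 ((kappa - 1) / 2); lra.
Qed.

Let k10 : 0 <= kappa - 1.
Proof. by rewrite subr_ge0; exact: (coef_kappa H). Qed.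

Let k1l : (kappa - 1) / 2 <= l%:R.
Proof. by have := coef_l H; have := k10; lra. Qed.

Definition growth_const : R := M + 3 * C.

Lemma growth_const_ge0 : 0 <= growth_const.
Proof. by rewrite addr_ge0 ?(coef_M H)// mulr_ge0// ltW// (coef_C H). Qed.

Let growth_aux (x : 'cV[R]_d) (g : R) : g <= jap x ^+ l ->
  M + C * (2 + g) * hsnorm x <= growth_const * jap x ^+ l.+1.
Proof.
move=> gl; have J := japX_ge1 x l; have J1 := japX_ge1 x l.+1.
rewrite /growth_const mulrDl; apply: lerD.
  by rewrite ler_peMr// (coef_M H).
rewrite [3 * C]mulrC -!mulrA; apply: ler_wpM2l; first exact/ltW/(coef_C H).
apply: (@le_trans _ _ (3 * jap x ^+ l * hsnorm x)).
  by apply: ler_wpM2r; [exact: hsnorm_ge0|lra].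
rewrite exprSr mulrA; apply: ler_wpM2l; first by rewrite mulr_ge0// japX_ge0.
exact: hsnorm_le_jap.
Qed.

Lemma b_growth_jap t x : 0 <= t <= T ->
  hsnorm (b t x) <= growth_const * jap x ^+ l.+1.
Proof.
move=> tT; apply: (le_trans (b_growth x tT)); apply: growth_aux.
by apply: powR_le_jap => //; exact: (coef_l H).
Qed.

Lemma s_growth_jap t x : 0 <= t <= T ->
  hsnorm (sigma t x) <= growth_const * jap x ^+ l.+1.
Proof.
move=> tT; apply: (le_trans (s_growth x tT)); apply: growth_aux.
by apply: powR_le_jap => //; rewrite divr_ge0.
Qed.

Let lip_aux (x y : 'cV[R]_d) (g g' : R) : g <= jap x ^+ l -> g' <= jap y ^+ l ->
  C * (1 + g + g') * hsnorm (x - y)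
    <= 2 * C * (jap x ^+ l + jap y ^+ l) * hsnorm (x - y).
Proof.
move=> gl gl'; apply: ler_wpM2r; first exact: hsnorm_ge0.
rewrite [2 * C]mulrC -mulrA; apply: ler_wpM2l; first exact/ltW/(coef_C H).
have := japX_ge1 x l; have := japX_ge1 y l; lra.
Qed.

Lemma b_lip_jap t x y : 0 <= t <= T ->
  hsnorm (b t x - b t y) <= 2 * C * (jap x ^+ l + jap y ^+ l) * hsnorm (x - y).
Proof.
move=> tT; apply: (le_trans (coef_bx H x y tT)).
by apply: lip_aux; apply: powR_le_jap => //; exact: (coef_l H).
Qed.

Lemma s_lip_jap t x y : 0 <= t <= T ->
  hsnorm (sigma t x - sigma t y)
    <= 2 * C * (jap x ^+ l + jap y ^+ l) * hsnorm (x - y).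
Proof.
move=> tT; apply: (le_trans (coef_sx H x y tT)).
by apply: lip_aux; apply: powR_le_jap => //; rewrite divr_ge0.
Qed.

Let time_aux (x : 'cV[R]_d) (a s t : R) : 0 <= a -> a <= l.+1%:R ->
  C * (1 + hsnorm x `^ a) * `|t - s| <= 2 * C * jap x ^+ l.+1 * `|t - s|.
Proof.
move=> a0 al; apply: ler_wpM2r => //.
rewrite [2 * C]mulrC -mulrA; apply: ler_wpM2l; first exact/ltW/(coef_C H).
have := japX_ge1 x l.+1; have := powR_le_jap x a0 al; lra.
Qed.

Lemma b_time_jap t s x : 0 <= t <= T -> 0 <= s <= T ->
  hsnorm (b t x - b s x) <= 2 * C * jap x ^+ l.+1 * `|t - s|.
Proof.
move=> tT sT; apply: (le_trans (coef_bt H x tT sT)).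
have := coef_kappa H; have := coef_l H; have := ler0n R l => ? ? ?.
by apply: time_aux; rewrite -?[l.+1%:R]natr1; lra.
Qed.

Lemma s_time_jap t s x : 0 <= t <= T -> 0 <= s <= T ->
  hsnorm (sigma t x - sigma s x) <= 2 * C * jap x ^+ l.+1 * `|t - s|.
Proof.
move=> tT sT; apply: (le_trans (coef_st H x tT sT)).
have := coef_kappa H; have := coef_l H; have := ler0n R l => ? ? ?.
by apply: time_aux; rewrite -?[l.+1%:R]natr1; lra.
Qed.

(** * Growth of the coefficients on the ball of radius [h^(-r)] *)

Section TamedStep.
Variables (q : nat) (r : R).
Hypothesis q1 : (0 < q)%N.
Hypothesis rk : r * (kappa - 1) <= 1 / 2.

(** The power is at most [h^(- r (kappa - 1))], hence at most [h^(- 1/2)]: this is where the upper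
    bound on [r] acts. *)
Lemma tamed_power h (x : 'cV[R]_d) : 0 < h <= 1 -> hsnorm x <= h `^ (- r) ->
  h * (hsnorm x `^ (kappa - 1)) ^+ 2 <= 1.
Proof.
move=> /andP[h0 h1] xh.
have h12 : hsnorm x `^ (kappa - 1) <= h `^ (- (1 / 2)).
  apply: (@le_trans _ _ ((h `^ (- r)) `^ (kappa - 1))).
    by apply: ge0_ler_powR => //; rewrite ?nnegrE ?hsnorm_ge0 ?powR_ge0.
  by rewrite -powRrM mulNr; apply: ger_powR; [rewrite h0 h1|rewrite lerN2].
have : (hsnorm x `^ (kappa - 1)) ^+ 2 <= h^-1.
  rewrite (le_trans (lerXn2r 2 _ _ h12)) ?nnegrE ?powR_ge0//.
  rewrite -powR_mulrn ?powR_ge0// -powRrM mulNr div1r mulVf// powR_inv1//.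
  exact: ltW.
by move=> /(ler_wpM2l (ltW h0)); rewrite mulfV// gt_eqF.
Qed.

Lemma tamed_drift t h eta x : 0 <= t <= T -> 0 < h <= 1 -> 0 <= eta <= h ->
  hsnorm x <= h `^ (- r) ->
  eta * hsnorm (b t x) ^+ 2 <= (2 * M ^+ 2 + 20 * C ^+ 2) * jap x.
Proof.
move=> tT h01 /andP[e0 eh] xh.
have := tamed_power h01 xh; have := b_growth x tT.
have := powR_ge0 (hsnorm x) (kappa - 1); set g := _ `^ _ => g0 bx hg.
have M0 := coef_M H; have C0 := ltW (coef_C H).
have b0 := hsnorm_ge0 (b t x); have x0 := hsnorm_ge0 x.
have eg : eta * g ^+ 2 <= 1.
  by apply: le_trans hg; rewrite ler_wpM2r// sqr_ge0.
have e1 : eta <= 1 by case/andP: h01 => _; exact: le_trans.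
have bx2 : hsnorm (b t x) ^+ 2 <= 2 * M ^+ 2 + 2 * (C ^+ 2 * (2 + g) ^+ 2 * hsnorm x ^+ 2).
  apply: (@le_trans _ _ ((M + C * (2 + g) * hsnorm x) ^+ 2)).
    by rewrite lerXn2r// nnegrE (le_trans b0).
  rewrite -!exprMn; set u := C * (2 + g) * hsnorm x.
  have := sqr_ge0 (M - u); lra.
(* From [(2 + g)^2 + (2 - g)^2 = 8 + 2 g^2], with both [eta] and [eta g^2] at most 1. *)
have eg2 : eta * (2 + g) ^+ 2 <= 10.
  have : 0 <= eta * (2 - g) ^+ 2 by rewrite mulr_ge0// sqr_ge0.
  nra.
apply: (le_trans (ler_wpM2l e0 bx2)).
have -> : eta * (2 * M ^+ 2 + 2 * (C ^+ 2 * (2 + g) ^+ 2 * hsnorm x ^+ 2)) =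
  eta * (2 * M ^+ 2) + 2 * C ^+ 2 * hsnorm x ^+ 2 * (eta * (2 + g) ^+ 2) by ring.
have CX : 0 <= 2 * C ^+ 2 * hsnorm x ^+ 2 by rewrite !mulr_ge0 ?sqr_ge0.
have M2 := sqr_ge0 M; have C2 := sqr_ge0 C; have X2 := sqr_ge0 (hsnorm x).
have := ler_wpM2l CX eg2; rewrite /jap.
have : eta * (2 * M ^+ 2) <= 2 * M ^+ 2 by rewrite ler_piMl// mulr_ge0.
nra.
Qed.

(** As [sigma] grows with half the exponent of [b], even its fourth power is controlled by
    [1 / eta]. Squaring therefore leaves a spare factor [eta], without which the top power of the
    Gaussian bound could not be summed over the steps. *)
Lemma tamed_diffusion t h eta x : 0 <= t <= T -> 0 < h <= 1 -> 0 <= eta <= h ->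
  hsnorm x <= h `^ (- r) ->
  (eta * hsnorm (sigma t x) ^+ 2) ^+ 2
    <= eta * ((2 * M ^+ 2 + 20 * C ^+ 2) ^+ 2 * 2 * jap x ^+ 2).
Proof.
move=> tT h01 /andP[e0 eh] xh.
have := tamed_power h01 xh; have := s_growth x tT.
have := powR_ge0 (hsnorm x) ((kappa - 1) / 2).
have -> : hsnorm x `^ (kappa - 1) = (hsnorm x `^ ((kappa - 1) / 2)) ^+ 2.
  by rewrite -powR_mulrn ?powR_ge0// -powRrM divfK.
set g := _ `^ _ => g0 bx hg.
have M0 := coef_M H; have C0 := ltW (coef_C H).
have b0 := hsnorm_ge0 (sigma t x); have x0 := hsnorm_ge0 x.
have eg : eta * (g ^+ 2) ^+ 2 <= 1.
  by apply: le_trans hg; rewrite ler_wpM2r// sqr_ge0.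
have e1 : eta <= 1 by case/andP: h01 => _; exact: le_trans.
have bx2 : hsnorm (sigma t x) ^+ 2 <= 2 * M ^+ 2 + 2 * (C ^+ 2 * (2 + g) ^+ 2 * hsnorm x ^+ 2).
  apply: (@le_trans _ _ ((M + C * (2 + g) * hsnorm x) ^+ 2)).
    by rewrite lerXn2r// nnegrE (le_trans b0).
  rewrite -!exprMn; set u := C * (2 + g) * hsnorm x.
  have := sqr_ge0 (M - u); lra.
set G := 4 + g ^+ 2.
have gG : (2 + g) ^+ 2 <= 2 * G by rewrite /G; have := sqr_ge0 (2 - g); nra.
have g20 := sqr_ge0 g.
have G4 : 4 <= G by rewrite /G lerDl.
have M2 := sqr_ge0 M; have C2 := sqr_ge0 C; have X2 := sqr_ge0 (hsnorm x).
set D := 2 * M ^+ 2 + 20 * C ^+ 2.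
have D0 : 0 <= D by rewrite /D; nra.
have sD : hsnorm (sigma t x) ^+ 2 <= D * (G / 4) * jap x.
  apply: (le_trans bx2); rewrite /jap /D.
  have h1 : C ^+ 2 * (2 + g) ^+ 2 * hsnorm x ^+ 2 <= C ^+ 2 * hsnorm x ^+ 2 * (2 * G).
    by rewrite mulrAC ler_wpM2l// mulr_ge0.
  have h2 : 0 <= C ^+ 2 * hsnorm x ^+ 2 * G by rewrite !mulr_ge0//; lra.
  have h3 : M ^+ 2 <= M ^+ 2 * (G / 4) by rewrite ler_peMr//; lra.
  have h4 : 0 <= M ^+ 2 * (G / 4) * hsnorm x ^+ 2 by rewrite !mulr_ge0//; lra.
  have h5 : 0 <= C ^+ 2 * G by rewrite mulr_ge0//; lra.
  have -> : (2 * M ^+ 2 + 20 * C ^+ 2) * (G / 4) * (1 + hsnorm x ^+ 2) =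
    2 * (M ^+ 2 * (G / 4)) + 2 * (M ^+ 2 * (G / 4) * hsnorm x ^+ 2)
    + 5 * (C ^+ 2 * G) + 5 * (C ^+ 2 * hsnorm x ^+ 2 * G) by field.
  lra.
have eG : eta * (G / 4) ^+ 2 <= 2.
  have : eta * (4 + g ^+ 2) ^+ 2 <= 32.
    have : 0 <= eta * (4 - g ^+ 2) ^+ 2 by rewrite mulr_ge0// sqr_ge0.
    nra.
  by rewrite /G; lra.
rewrite exprMn; have -> : eta ^+ 2 * (hsnorm (sigma t x) ^+ 2) ^+ 2 =
  eta * (eta * (hsnorm (sigma t x) ^+ 2) ^+ 2) by ring.
apply: ler_wpM2l => //.
apply: (@le_trans _ _ (eta * (D * (G / 4) * jap x) ^+ 2)).
  by apply: ler_wpM2l => //; rewrite lerXn2r ?nnegrE ?sqr_ge0// (le_trans (sqr_ge0 _) sD).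
have -> : eta * (D * (G / 4) * jap x) ^+ 2 = D ^+ 2 * jap x ^+ 2 * (eta * (G / 4) ^+ 2) by ring.
rewrite [leRHS]mulrAC; apply: ler_wpM2l => //.
by rewrite mulr_ge0 ?sqr_ge0.
Qed.

(** Coercivity is monotonicity at [y = 0]. Replacing [sigma t x] by its difference with [sigma t 0]
    doubles the coefficient of the squared norm, hence the requirement [2 * c <= pp]. *)
Lemma monotone_growth (c : R) t x : 0 <= t <= T -> 0 <= c -> 2 * c <= pp ->
  2 * dotp x (b t x) + c * hsnorm (sigma t x) ^+ 2
    <= (2 * C + 2 * M + 2 * c * M ^+ 2) * jap x.
Proof.
move=> tT c0 cp.
have M0 := coef_M H; have C0 := ltW (coef_C H); have x0 := hsnorm_ge0 x.
have := coef_mono H x 0 tT; rewrite !subr0 !dotpE => mono.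
have b0 : hsdot x (b t 0) <= hsnorm x * M.
  apply: (le_trans (hsdot_ler _ _)); apply: ler_wpM2l => //.
  exact: (coef_b0 H).
have -> : b t x = b t 0 + (b t x - b t 0) by rewrite addrC subrK.
have -> : sigma t x = (sigma t x - sigma t 0) + sigma t 0 by rewrite subrK.
have s2 := sqr_hsnormD_le (sigma t x - sigma t 0) (sigma t 0).
have s0 : hsnorm (sigma t 0) ^+ 2 <= M ^+ 2.
  by rewrite lerXn2r ?nnegrE ?hsnorm_ge0//; exact: (coef_s0 H).
have cs := ler_wpM2l c0 s2.
set D := hsnorm (sigma t x - sigma t 0) ^+ 2 in mono cs *.
have D0 : 0 <= D by exact: sqr_ge0.
have cpD := ler_wpM2r D0 cp.
have cM := ler_wpM2l c0 s0.
rewrite hsdotDr.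
have X1 : hsnorm x * M <= M * jap x by rewrite mulrC ler_wpM2l// hsnorm_le_jap.
have X2 : C * hsnorm x ^+ 2 <= C * jap x by rewrite ler_wpM2l// sqr_hsnorm_le_jap.
have X3 : c * M ^+ 2 <= c * M ^+ 2 * jap x.
  by rewrite ler_peMr ?jap_ge1// mulr_ge0// sqr_ge0.
lra.
Qed.

(* [D] is such that eta |b|^2 <= D jap x and eta |sigma|^4 <= 2 D^2 (jap x)^2 on
   the ball of radius h^(-r), for eta <= h; this uses r (kappa - 1) <= 1/2. *)
Definition tamed_const (c1 c2 : R) : R :=
  let D := 2 * M ^+ 2 + 20 * C ^+ 2 in
  let K := 2 * C + 2 * M + 2 * c1 * M ^+ 2 + D in
  (1 + K) ^+ q.+1 * q.+1%:R + c2 * ((D ^+ 2 * 2) * (1 + D ^+ 2 * 2) ^+ q.-1).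

(** With [A] the bracket after the drift step and [S = eta |sigma|^2], the first terms are
    [A^q (A + c1 S)]. Coercivity, together with the tamed drift for the square of the drift step,
    bounds [A + c1 S] by [(1 + K eta) jap x]. The remaining power of [S] is left to
    [tamed_diffusion]. *)
Lemma tamed_step (c1 c2 : R) t h eta x : 0 <= c1 -> 2 * c1 <= pp -> 0 <= c2 ->
  0 <= t <= T -> 0 < h <= 1 -> 0 <= eta <= h -> hsnorm x <= h `^ (- r) ->
  jap (x + eta *: b t x) ^+ q.+1
  + (jap (x + eta *: b t x) ^+ q * (c1 * (eta * hsnorm (sigma t x) ^+ 2))
    + c2 * (eta * hsnorm (sigma t x) ^+ 2) ^+ q.+1)
  <= (1 + tamed_const c1 c2 * eta) * jap x ^+ q.+1.
Proof.
move=> c10 c1p c20 tT h01 eh xh.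
have [e0 e1] : 0 <= eta /\ eta <= 1.
  by case/andP: h01 => ? ?; case/andP: eh => *; split; lra.
have := tamed_drift tT h01 eh xh; have := tamed_diffusion tT h01 eh xh.
rewrite /tamed_const; set D := 2 * M ^+ 2 + 20 * C ^+ 2 => sD bD.
have M0 := coef_M H; have C0 := ltW (coef_C H).
have D0 : 0 <= D by rewrite /D addr_ge0// mulr_ge0// sqr_ge0.
set K := 2 * C + 2 * M + 2 * c1 * M ^+ 2 + D.
have K0 : 0 <= K.
  have : 0 <= c1 * M ^+ 2 by rewrite mulr_ge0// sqr_ge0.
  by rewrite /K; lra.
set A := jap (x + eta *: b t x); set S := eta * hsnorm (sigma t x) ^+ 2 in sD *.
have S0 : 0 <= S by rewrite mulr_ge0// sqr_ge0.
have J0 := jap_ge0 x; have J1 := jap_ge1 x.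
have AK : A + c1 * S <= (1 + K * eta) * jap x.
  have := ler_wpM2l e0 (monotone_growth x tT c10 c1p).
  have := ler_wpM2l e0 bD.
  rewrite /A /S /jap sqr_hsnormD hsdotZr hsnormZ ger0_norm// exprMn dotpE /K /jap.
  set B2 := hsnorm (b t x) ^+ 2; set S2 := hsnorm (sigma t x) ^+ 2.
  set X2 := hsnorm x ^+ 2; set c := hsdot _ _ => *; lra.
have A0 : 0 <= A by exact: jap_ge0.
have cS : 0 <= c1 * S by rewrite mulr_ge0.
have A1 : A <= (1 + K * eta) * jap x by lra.
have KJ : 0 <= (1 + K * eta) * jap x by lra.
have part1 : A ^+ q.+1 + A ^+ q * (c1 * S)
    <= (1 + (1 + K) ^+ q.+1 * q.+1%:R * eta) * jap x ^+ q.+1.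
  have -> : A ^+ q.+1 + A ^+ q * (c1 * S) = A ^+ q * (A + c1 * S).
    by rewrite mulrDr exprSr.
  apply: (@le_trans _ _ (((1 + K * eta) * jap x) ^+ q.+1)).
    rewrite exprSr; apply: ler_pM => //; first exact: exprn_ge0.
    by rewrite addr_ge0.
    by rewrite lerXn2r ?nnegrE.
  rewrite exprMn ler_wpM2r ?exprn_ge0//.
  exact: onepD_exp_le.
set E := D ^+ 2 * 2 in sD *.
have E0 : 0 <= E by rewrite mulr_ge0// sqr_ge0.
have SE : S <= (1 + E) * jap x.
  have SE2 : S ^+ 2 <= E * jap x ^+ 2.
    apply: (le_trans sD); rewrite -[leRHS]mul1r ler_wpM2r//.
    by rewrite mulr_ge0// exprn_ge0.
  have EJ : 0 <= (1 + E) * jap x by apply: mulr_ge0 => //; exact: addr_ge0.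
  rewrite -(@ler_pXn2r _ 2) ?nnegrE//.
  apply: (le_trans SE2); rewrite exprMn ler_wpM2r ?sqr_ge0//.
  have := sqr_ge0 E; lra.
have part2 : S ^+ q.+1 <= eta * (E * (1 + E) ^+ q.-1) * jap x ^+ q.+1.
  (* Two factors [S] yield the factor [eta]; the other [q - 1] are only bounded by multiples of
     [jap x]. This uses [0 < q]. *)
  have -> : q.+1 = (2 + q.-1)%N by rewrite -{1}(prednK q1).
  rewrite !exprD.
  have -> : eta * (E * (1 + E) ^+ q.-1) * (jap x ^+ 2 * jap x ^+ q.-1) =
    (eta * (E * jap x ^+ 2)) * ((1 + E) * jap x) ^+ q.-1 by rewrite exprMn; ring.
  apply: ler_pM; [exact: exprn_ge0|exact: exprn_ge0|exact: sD|].
  by apply: lerXn2r; rewrite ?nnegrE; [exact: S0|exact: le_trans S0 SE|exact: SE].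
have := ler_wpM2l c20 part2.
rewrite addrA => part2'; apply: (le_trans (lerD part1 part2')).
rewrite le_eqVlt; apply/orP; left; apply/eqP; ring.
Qed.

End TamedStep.
End Coefficients.

(** * Moments of the projected scheme *)

Section SchemeMoments.
Context (R : realType) (T : R) (disp : measure_display)
  (Omega : measurableType disp) (P : probability Omega R)
  (F : R -> set (set Omega)) (d m : nat) (W : R -> Omega -> 'cV[R]_m).
Hypothesis rcF : right_continuous_filtration T F.
Hypothesis wW : wiener_process T P F W.
Context (b : R -> 'cV[R]_d -> 'cV[R]_d) (sigma : R -> 'cV[R]_d -> 'M[R]_(d, m))
  (C M kappa pp : R) (l : nat).
Hypothesis H : sde_coefficients T C M kappa pp l b sigma.

Lemma Fmx_comp t a c n p (f : 'M[R]_(a, c) -> 'M[R]_(n, p)) (Y : Omega -> 'M[R]_(a, c)) :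
  mx_measurable (f : borel_mx R a c -> 'M[R]_(n, p)) -> Fmx F t Y ->
  Fmx F t (fun w => f (Y w)).
Proof.
move=> mf mY i j; apply: (measurableT_comp (mf i j)) => _ B mB.
by rewrite setTI; exact: (mx_measurable_preimage mY mB).
Qed.

Let jap_lip (n p : nat) (f : 'cV[R]_d -> 'M[R]_(n, p)) :
  (forall x y, hsnorm (f x - f y) <= 2 * C * (jap x ^+ l + jap y ^+ l) * hsnorm (x - y)) ->
  mx_measurable (f : borel_mx R d 1 -> 'M[R]_(n, p)).
Proof.
move=> fxy; apply: lipschitz_mx_measurable => N.
have aux z : hsnorm z <= N -> jap z ^+ l <= (1 + N ^+ 2) ^+ l.
  move=> zN; apply: lerXn2r; rewrite ?nnegrE ?jap_ge0 ?addr_ge0 ?sqr_ge0//.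
  have N0 : 0 <= N by exact: le_trans (hsnorm_ge0 _) zN.
  by rewrite lerD2l; apply: lerXn2r; rewrite ?nnegrE ?hsnorm_ge0.
exists (2 * C * ((1 + N ^+ 2) ^+ l + (1 + N ^+ 2) ^+ l)) => x y xN yN.
apply: (le_trans (fxy x y)); apply: ler_wpM2r; first exact: hsnorm_ge0.
apply: ler_wpM2l; first by rewrite mulr_ge0// ltW// (coef_C H).
by apply: lerD; exact: aux.
Qed.

Lemma b_borel t : 0 <= t <= T -> mx_measurable (b t : borel_mx R d 1 -> 'cV[R]_d).
Proof. by move=> tT; apply: jap_lip => x y; exact: (b_lip_jap H x y tT). Qed.

Lemma sigma_borel t : 0 <= t <= T ->
  mx_measurable (sigma t : borel_mx R d 1 -> 'M[R]_(d, m)).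
Proof. by move=> tT; apply: jap_lip => x y; exact: (s_lip_jap H x y tT). Qed.

Section OneScheme.
Context (q : nat) (r h : R) (X0 : Omega -> 'cV[R]_d) (Pi : 'cV[R]_d -> 'cV[R]_d).
Hypothesis rk : r * (kappa - 1) <= 1 / 2.
Hypothesis ql : (4 * l.+1 <= q.+1)%N.
Hypothesis rq : 3 <= 2 * r * q%:R.
Hypothesis h01 : 0 < h <= 1.
Hypothesis PiP : ball_projection (h `^ (- r)) Pi.
Hypothesis mX0 : Fmx F 0 X0.
Hypothesis T0 : 0 <= T.

Let h0 : 0 < h. Proof. by case/andP: h01. Qed.
Let h1 : h <= 1. Proof. by case/andP: h01. Qed.

Definition scheme := projected_scheme b sigma W X0 r h Pi.

Definition pre_scheme k (eta : R) w :=
  scheme k w + eta *: b (k%:R * h) (scheme k w)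
  + sigma (k%:R * h) (scheme k w) *m (W (k%:R * h + eta) w - W (k%:R * h) w).

Lemma schemeS k w : scheme k.+1 w = Pi (pre_scheme k h w).
Proof.
rewrite /pre_scheme /scheme /= (_ : k.+1%:R * h = k%:R * h + h)//.
by rewrite -natr1 mulrDl mul1r.
Qed.

Lemma hsnorm_Pi x : hsnorm (Pi x) <= hsnorm x.
Proof. by rewrite (projection_norm PiP) ge_min lexx. Qed.

Lemma scheme0_le w : hsnorm (scheme 0 w) <= hsnorm (X0 w).
Proof. by rewrite /scheme /=; case: ifP => // _; exact: hsnorm_Pi. Qed.

Lemma scheme_le k w : hsnorm (scheme k w) <= h `^ (- r).
Proof.
case: k => [|k]; last by rewrite schemeS (projection_norm PiP) ge_min lexx orbT.
rewrite /scheme /=; case: ifP => // _.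
by rewrite (projection_norm PiP) ge_min lexx orbT.
Qed.

Let Pi_borel : mx_measurable (Pi : borel_mx R d 1 -> 'cV[R]_d).
Proof.
move=> i j _ B mB; have := @mx_measurable_borel R d 1 i j measurableT B mB.
rewrite !setTI => mB'; exact: (projection_measurable PiP mB').
Qed.

Lemma pre_scheme_Fmx k eta : 0 <= eta -> k%:R * h + eta <= T ->
  Fmx F (k%:R * h) (scheme k) -> Fmx F (k%:R * h + eta) (pre_scheme k eta).
Proof.
move=> e0 keT mk.
have k0 : 0 <= k%:R * h by rewrite mulr_ge0// ltW.
have kT : k%:R * h <= T by lra.
have ke : k%:R * h <= k%:R * h + eta by lra.
have kI : 0 <= k%:R * h <= T by rewrite k0 kT.
have mm := Fmx_mono rcF k0 ke keT.
apply: mx_measurableD.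
  apply: mx_measurableD; first exact: mm.
  by apply: mx_measurableZ; apply: mm; apply: Fmx_comp => //; exact: b_borel.
apply: mx_measurableM.
  by apply: mm; apply: Fmx_comp => //; exact: sigma_borel.
exact: (increment_measurable rcF wW).
Qed.

Lemma scheme_Fmx k : k%:R * h <= T -> Fmx F (k%:R * h) (scheme k).
Proof.
elim: k => [|k IH] kT.
  rewrite mul0r.
  have -> : scheme 0 = (fun w => (if hsnorm (X0 w) <= h `^ (- r) then 1 else 0) *: X0 w
     + (if hsnorm (X0 w) <= h `^ (- r) then 0 else 1) *: Pi (X0 w)).
    apply/funext => w; rewrite /scheme /=; case: ifP => _.
      by rewrite scale1r scale0r addr0.
    by rewrite scale1r scale0r add0r.
  have mb : measurable_fun setT
     ((fun w => hsnorm (X0 w) <= h `^ (- r)) : g_sigma_algebraType (F 0) -> bool).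
    apply: (measurable_fun_bool true); rewrite setTI.
    rewrite (_ : _ @^-1` _ = [set w | hsnorm (X0 w) <= h `^ (- r)]) //.
    exact: (measurable_hsnorm_le _ mX0).
  apply: mx_measurableD; apply: mx_measurableZf => //.
  - by apply: measurable_fun_ifT => //; exact: measurable_cst.
  - by apply: measurable_fun_ifT => //; exact: measurable_cst.
  - exact: Fmx_comp.
have e : k.+1%:R * h = k%:R * h + h by rewrite -natr1 mulrDl mul1r.
have kT' : k%:R * h + h <= T by rewrite -e.
rewrite e (_ : scheme k.+1 = fun w => Pi (pre_scheme k h w)); last first.
  by apply/funext => w; exact: schemeS.
apply: Fmx_comp => //; apply: pre_scheme_Fmx => //; first exact: ltW.
by apply: IH; have := ltW h0; lra.
Qed.

Lemma pre_scheme0 k w : pre_scheme k 0 w = scheme k w.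
Proof. by rewrite /pre_scheme scale0r !addr0 subrr mulmx0 addr0. Qed.

Let q0 : (0 < q)%N.
Proof. by rewrite -ltnS (leq_trans _ ql)// mulnS (leq_trans (ltn_addr _ _) (leqnn _)). Qed.

(** The coefficient of the linear term in [gauss_affine_power]. It depends on [q] only, so that
    [2 * power_c1 <= p0 - 1] can be imposed through [r]; [power_c2], which depends on [m], is
    subject to no such constraint. *)
Definition power_c1 : R := 6 * (sym_const R q * 2 ^+ q).
Definition power_c2 : R :=
  sym_const R q * 2 ^+ q * ((2 ^+ q.+1) ^+ m * (m%:R * gauss_const R q.+1)).
Definition moment_rate : R := tamed_const C M q power_c1 power_c2.

Hypothesis ppq : 2 * power_c1 <= pp.

Lemma power_c1_ge0 : 0 <= power_c1.
Proof. by rewrite mulr_ge0// mulr_ge0 ?exprn_ge0// sym_const_ge0. Qed.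

Lemma power_c2_ge0 : 0 <= power_c2.
Proof.
rewrite mulr_ge0//; first by rewrite mulr_ge0 ?exprn_ge0// sym_const_ge0.
by rewrite mulr_ge0 ?exprn_ge0// mulr_ge0// gauss_const_ge0.
Qed.

Lemma moment_rate_ge0 : 0 <= moment_rate.
Proof.
have c10 := power_c1_ge0; have M0 := coef_M H; have C0 := ltW (coef_C H).
rewrite /moment_rate /tamed_const; set D := 2 * M ^+ 2 + 20 * C ^+ 2.
have D0 : 0 <= D by rewrite addr_ge0// mulr_ge0// sqr_ge0.
have c1M : 0 <= power_c1 * M ^+ 2 by rewrite mulr_ge0// sqr_ge0.
have D2 : 0 <= D ^+ 2 * 2 by rewrite mulr_ge0// sqr_ge0.
apply: addr_ge0; first by rewrite mulr_ge0// exprn_ge0//; lra.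
rewrite mulr_ge0 ?power_c2_ge0// mulr_ge0// exprn_ge0// addr_ge0//.
Qed.

Let mjap t k (Y : Omega -> 'cV[R]_d) : 0 <= t -> t <= T -> Fmx F t Y ->
  measurable_fun setT (fun w => jap (Y w) ^+ k).
Proof.
move=> t0 tT mY; apply: measurable_funX; apply: measurable_funD; first exact: measurable_cst.
by apply: measurable_hsnorm2; exact: (Fmx_measurable rcF t0 tT mY).
Qed.

Lemma pre_scheme_moment k eta B : 0 <= eta <= h -> k%:R * h + eta <= T ->
  Ele P (fun w => jap (scheme k w) ^+ q.+1) B ->
  Ele P (fun w => jap (pre_scheme k eta w) ^+ q.+1) ((1 + moment_rate * eta) * B).
Proof.
move=> /andP[e0 eh] keT EB.
have k0 : 0 <= k%:R * h by rewrite mulr_ge0// ltW.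
have kT : k%:R * h <= T by lra.
have kI : 0 <= k%:R * h <= T by rewrite k0 kT.
have mk := scheme_Fmx kT.
(* The Gaussian estimates require a step of positive length. *)
move: e0; rewrite le_eqVlt => /predU1P[<-|e0].
  rewrite mulr0 addr0 mul1r /Ele.
  by under eq_integral do rewrite pre_scheme0.
have st : k%:R * h < k%:R * h + eta by lra.
have mb : Fmx F (k%:R * h) (fun w => scheme k w + eta *: b (k%:R * h) (scheme k w)).
  apply: mx_measurableD => //; apply: mx_measurableZ.
  by apply: Fmx_comp => //; exact: b_borel.
have ms : Fmx F (k%:R * h) (fun w => sigma (k%:R * h) (scheme k w)).
  by apply: Fmx_comp => //; exact: sigma_borel.
apply: (step_power_moment rcF wW k0 st keT (q := q) mb ms).
have -> : k%:R * h + eta - k%:R * h = eta by rewrite addrC addKr.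
have mS := measurable_hsnorm2 (Fmx_measurable rcF k0 kT ms).
have mB j := mjap j k0 kT mb.
have meS : measurable_fun setT
    (fun w => eta * hsnorm (sigma (k%:R * h) (scheme k w)) ^+ 2).
  by apply: measurable_funM => //; exact: measurable_cst.
have mJ := mjap q.+1 k0 kT mk.
apply: (@Ele_mono _ _ _ _ _ (fun w => (1 + moment_rate * eta) * jap (scheme k w) ^+ q.+1)).
- apply: measurable_funD; first exact: mB.
  apply: measurable_funM; first exact: measurable_cst.
  apply: measurable_funM; first exact: measurable_cst.
  apply: measurable_funD.
    apply: measurable_funM; first exact: mB.
    by apply: measurable_funM => //; exact: measurable_cst.
  by apply: measurable_funM; [exact: measurable_cst|exact: measurable_funX].
- by apply: measurable_funM => //; exact: measurable_cst.
- move=> w.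
  have S0 : 0 <= eta * hsnorm (sigma (k%:R * h) (scheme k w)) ^+ 2.
    by rewrite mulr_ge0 ?sqr_ge0// ltW.
  apply: addr_ge0; first exact: japX_ge0.
  apply: mulr_ge0; first exact: sym_const_ge0.
  apply: mulr_ge0; first exact: exprn_ge0.
  apply: addr_ge0; first by apply: mulr_ge0; [exact: japX_ge0|exact: mulr_ge0].
  apply: mulr_ge0; last exact: exprn_ge0.
  by rewrite mulr_ge0 ?exprn_ge0// mulr_ge0// gauss_const_ge0.
- move=> w.
  have eh' : 0 <= eta <= h by rewrite (ltW e0) eh.
  have := tamed_step H q0 rk power_c1_ge0 ppq power_c2_ge0 kI h01 eh' (scheme_le k w).
  apply: le_trans; rewrite le_eqVlt; apply/orP; left; apply/eqP.
  by rewrite /power_c1 /power_c2 /jap; ring.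
- apply: EleZ => //.
    by rewrite addr_ge0// mulr_ge0 ?moment_rate_ge0// ltW.
  by move=> w; exact: japX_ge0.
Qed.

Lemma scheme_moment_step k B : k.+1%:R * h <= T ->
  Ele P (fun w => jap (scheme k w) ^+ q.+1) B ->
  Ele P (fun w => jap (scheme k.+1 w) ^+ q.+1) ((1 + moment_rate * h) * B).
Proof.
move=> kT EB.
have e : k.+1%:R * h = k%:R * h + h by rewrite -natr1 mulrDl mul1r.
have kT' : k%:R * h + h <= T by rewrite -e.
have kT2 : k%:R * h <= T by have := ltW h0; lra.
have k0 : 0 <= k%:R * h by rewrite mulr_ge0// ltW.
have hh : 0 <= h <= h by rewrite lexx ltW.
apply: Ele_mono (pre_scheme_moment hh kT' EB).
- apply: (mjap _ _ kT (scheme_Fmx kT)); by rewrite mulr_ge0// ltW.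
- apply: (mjap _ _ kT' (pre_scheme_Fmx (ltW h0) kT' (scheme_Fmx kT2))).
  by rewrite addr_ge0// ltW.
- by move=> w; exact: japX_ge0.
- move=> w; apply: lerXn2r; rewrite ?nnegrE ?jap_ge0// schemeS lerD2l.
  by apply: lerXn2r; rewrite ?nnegrE ?hsnorm_ge0// hsnorm_Pi.
Qed.

Lemma scheme_moment k B : 0 <= B ->
  Ele P (fun w => jap (X0 w) ^+ q.+1) B -> k%:R * h <= T ->
  Ele P (fun w => jap (scheme k w) ^+ q.+1) (expR (moment_rate * T) * B).
Proof.
move=> B0 EB kT.
have mr0 := moment_rate_ge0.
suff EK : forall j, j%:R * h <= T ->
    Ele P (fun w => jap (scheme j w) ^+ q.+1) (expR (moment_rate * (j%:R * h)) * B).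
  apply: Ele_le (EK k kT); apply: ler_wpM2r => //.
  by rewrite ler_expR ler_wpM2l.
elim=> [|j IH] jT.
  rewrite mul0r mulr0 expR0 mul1r.
  apply: Ele_mono EB.
  - by apply: (mjap _ _ jT (scheme_Fmx jT)); rewrite mul0r.
  - exact: (mjap _ (lexx 0) T0 mX0).
  - by move=> w; exact: japX_ge0.
  - move=> w; apply: lerXn2r; rewrite ?nnegrE ?jap_ge0// lerD2l.
    by apply: lerXn2r; rewrite ?nnegrE ?hsnorm_ge0// scheme0_le.
have jT' : j%:R * h <= T.
  by apply: le_trans jT; rewrite ler_wpM2r ?(ltW h0)// ler_nat.
apply: Ele_le (scheme_moment_step jT (IH jT')).
rewrite mulrA; apply: ler_wpM2r => //.
have -> : moment_rate * (j.+1%:R * h) = moment_rate * h + moment_rate * (j%:R * h).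
  by rewrite -natr1; ring.
rewrite expRD; apply: ler_wpM2r; first exact: expR_ge0.
exact: expR_ge1Dx.
Qed.

(** A fourth moment is needed because the Lipschitz factors of the coefficients are unbounded and
    will be separated from the increment by Young's inequality. The order [h^2] is that of the
    Wiener part. *)
Lemma increment4_le k eta B : 0 <= B -> 0 <= eta <= h -> k%:R * h + eta <= T ->
  Ele P (fun w => jap (scheme k w) ^+ q.+1) B ->
  Ele P (fun w => hsnorm (pre_scheme k eta w - scheme k w) ^+ 4)
    (16 * (growth_const C M ^+ 4 * (1 + (2 ^+ 2) ^+ m * (m%:R * gauss_const R 2))) * h ^+ 2 * B).
Proof.
move=> B0 /andP[e0 eh] keT EB.
set G := growth_const C M; set g2 := (2 ^+ 2) ^+ m * (m%:R * gauss_const R 2).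
have G0 : 0 <= G by exact: growth_const_ge0 H.
have g20 : 0 <= g2 by rewrite mulr_ge0 ?exprn_ge0// mulr_ge0// gauss_const_ge0.
have k0 : 0 <= k%:R * h by rewrite mulr_ge0// ltW.
have kT : k%:R * h <= T by lra.
have kI : 0 <= k%:R * h <= T by rewrite k0 kT.
have mk := scheme_Fmx kT.
move: e0; rewrite le_eqVlt => /predU1P[<-|e0].
  apply: (@Ele_le _ _ _ _ _ 0).
    apply: mulr_ge0 => //; apply: mulr_ge0; last by rewrite exprn_ge0// ltW.
    apply: mulr_ge0 => //; apply: mulr_ge0; [exact: exprn_ge0|exact: addr_ge0].
  rewrite /Ele; under eq_integral do rewrite pre_scheme0 subrr hsnorm0 expr0n.
  exact: Ele_cst.
have st : k%:R * h < k%:R * h + eta by lra.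
have ke0 : 0 <= k%:R * h + eta by lra.
have mb : Fmx F (k%:R * h) (fun w => b (k%:R * h) (scheme k w)).
  by apply: Fmx_comp => //; exact: b_borel.
have ms : Fmx F (k%:R * h) (fun w => sigma (k%:R * h) (scheme k w)).
  by apply: Fmx_comp => //; exact: sigma_borel.
have mJ := mjap q.+1 k0 kT mk.
have J0 w : 0 <= jap (scheme k w) ^+ q.+1 by exact: japX_ge0.
pose dW w := W (k%:R * h + eta) w - W (k%:R * h) w.
have mdW : mx_measurable dW.
  exact: (Fmx_measurable rcF ke0 keT (increment_measurable rcF wW k0 (ltW st) keT)).
have msW : measurable_fun setT (fun w => hsnorm (sigma (k%:R * h) (scheme k w) *m dW w) ^+ 4).
  apply: measurable_funX; apply: measurable_hsnorm; apply: mx_measurableM => //.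
  exact: (Fmx_measurable rcF k0 kT ms).
have growth4 (z : R) w : 0 <= z -> z <= G * jap (scheme k w) ^+ l.+1 ->
    z ^+ 4 <= G ^+ 4 * jap (scheme k w) ^+ q.+1.
  move=> z0 zG; apply: (@le_trans _ _ ((G * jap (scheme k w) ^+ l.+1) ^+ 4)).
    by rewrite lerXn2r ?nnegrE// (le_trans z0).
  rewrite exprMn; apply: ler_wpM2l; first exact: exprn_ge0.
  by rewrite -exprM mulnC; exact: japX_le.
have h2 : eta ^+ 2 <= h ^+ 2 by apply: lerXn2r; rewrite ?nnegrE ?(ltW e0) ?(ltW h0).
have h4 : eta ^+ 4 <= h ^+ 2.
  have eta1 : eta <= 1 by exact: le_trans h1.
  rewrite (@le_trans _ _ (eta ^+ 2))//.
  have -> : eta ^+ 4 = eta ^+ 2 * eta ^+ 2 by ring.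
  by rewrite ler_piMr ?sqr_ge0// exprn_ile1// ltW.
have E1 : Ele P (fun w => hsnorm (sigma (k%:R * h) (scheme k w) *m dW w) ^+ 4)
   ((g2 * h ^+ 2 * G ^+ 4) * B).
  apply: (step_fourth_moment rcF wW k0 st keT ms).
  have -> : k%:R * h + eta - k%:R * h = eta by rewrite addrC addKr.
  apply: (@Ele_mono _ _ _ _ _ (fun w => (g2 * h ^+ 2 * G ^+ 4) * jap (scheme k w) ^+ q.+1)).
  - apply: measurable_funM; first exact: measurable_cst.
    apply: measurable_funX; apply: measurable_funM; first exact: measurable_cst.
    by apply: measurable_hsnorm2; exact: (Fmx_measurable rcF k0 kT ms).
  - by apply: measurable_funM => //; exact: measurable_cst.
  - by move=> w; apply: mulr_ge0 => //; exact: sqr_ge0.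
  - move=> w; rewrite -/g2.
    have -> : g2 * h ^+ 2 * G ^+ 4 * jap (scheme k w) ^+ q.+1 =
      g2 * (h ^+ 2 * (G ^+ 4 * jap (scheme k w) ^+ q.+1)) by ring.
    apply: ler_wpM2l => //; rewrite exprMn.
    apply: ler_pM; [exact: sqr_ge0|exact: sqr_ge0|exact: h2|].
    rewrite -exprM; apply: growth4; first exact: hsnorm_ge0.
    exact: (s_growth_jap H _ kI).
  - apply: EleZ => //; apply: mulr_ge0; last exact: exprn_ge0.
    by apply: mulr_ge0 => //; rewrite exprn_ge0// ltW.
have E2 : Ele P (fun w => 16 * (G ^+ 4 * h ^+ 2 * jap (scheme k w) ^+ q.+1
     + hsnorm (sigma (k%:R * h) (scheme k w) *m dW w) ^+ 4))
   (16 * (G ^+ 4 * h ^+ 2 * B + (g2 * h ^+ 2 * G ^+ 4) * B)).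
  have GH : 0 <= G ^+ 4 * h ^+ 2 by rewrite mulr_ge0 ?exprn_ge0// ltW.
  have mGJ : measurable_fun setT (fun w => G ^+ 4 * h ^+ 2 * jap (scheme k w) ^+ q.+1).
    by apply: measurable_funM => //; exact: measurable_cst.
  have s40 w : 0 <= hsnorm (sigma (k%:R * h) (scheme k w) *m dW w) ^+ 4.
    by rewrite exprn_ge0// hsnorm_ge0.
  have GJ0 w : 0 <= G ^+ 4 * h ^+ 2 * jap (scheme k w) ^+ q.+1 by rewrite mulr_ge0.
  apply: EleZ => //.
  - exact: measurable_funD.
  - by move=> w; rewrite addr_ge0.
  - by apply: EleD => //; exact: EleZ.
have mps := pre_scheme_Fmx (ltW e0) keT mk.
have -> : 16 * (G ^+ 4 * (1 + g2)) * h ^+ 2 * B =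
   16 * (G ^+ 4 * h ^+ 2 * B + (g2 * h ^+ 2 * G ^+ 4) * B) by ring.
apply: Ele_mono E2.
- apply: measurable_funX; apply: measurable_hsnorm; apply: mx_measurableB.
    exact: (Fmx_measurable rcF ke0 keT mps).
  exact: (Fmx_measurable rcF k0 kT mk).
- apply: measurable_funM; first exact: measurable_cst.
  apply: measurable_funD => //.
  by apply: measurable_funM => //; exact: measurable_cst.
- by move=> w; rewrite exprn_ge0// hsnorm_ge0.
- move=> w; rewrite /pre_scheme -/(dW w) -[X in X - _]addrA [X in hsnorm X]addrC addKr.
  set B1 := eta *: _; set B2 := _ *m _.
  apply: (@le_trans _ _ ((hsnorm B1 + hsnorm B2) ^+ 4)).
    by apply: lerXn2r; rewrite ?nnegrE ?addr_ge0 ?hsnorm_ge0// hsnormD.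
  apply: (le_trans (exprD_le2 4 (hsnorm_ge0 B1) (hsnorm_ge0 B2))).
  rewrite (_ : 2 ^+ 4 = 16); last by rewrite -natrX.
  apply: ler_wpM2l => //; apply: lerD => //.
  rewrite /B1 hsnormZ exprMn ger0_norm ?(ltW e0)//.
  rewrite [G ^+ 4 * h ^+ 2]mulrC -[leRHS]mulrA.
  apply: ler_pM; [by rewrite exprn_ge0// ltW|by rewrite exprn_ge0// hsnorm_ge0|exact: h4|].
  apply: growth4; first exact: hsnorm_ge0.
  exact: (b_growth_jap H _ kI).
Qed.

(** Outside the ball [1 <= |x| h^r], and this is raised to the power [2 q], where [3 <= 2 r q] turns
    the powers of [h^r] into [h^3]. Of these three powers, one is lost in Young's inequality with
    weight [h] and one in the summation over the steps. *)
Lemma projection_defect x : hsnorm (Pi x - x) ^+ 2 <= 4 * h ^+ 3 * jap x ^+ q.+1.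
Proof.
have [xh|xh] := leP (hsnorm x) (h `^ (- r)).
  rewrite (projection_id PiP xh) subrr hsnorm0 expr0n/=.
  by rewrite mulr_ge0 ?japX_ge0// mulr_ge0// exprn_ge0// ltW.
have x0 := hsnorm_ge0 x.
have d2 : hsnorm (Pi x - x) <= 2 * hsnorm x.
  apply: (le_trans (hsnormD _ _)); rewrite hsnormN.
  by have := hsnorm_Pi x; lra.
apply: (@le_trans _ _ ((2 * hsnorm x) ^+ 2)).
  by apply: lerXn2r; rewrite ?nnegrE ?hsnorm_ge0 ?mulr_ge0.
rewrite exprMn -natrX/= -mulrA; apply: ler_wpM2l => //.
have hr0 : 0 < h `^ r by exact: powR_gt0.
have xr1 : 1 <= hsnorm x * h `^ r.
  by move/ltW: xh; rewrite powRN -ler_pdivrMr ?mul1r.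
have hr3 : (h `^ r) ^+ (2 * q) <= h ^+ 3.
  rewrite -!powR_mulrn ?powR_ge0 ?(ltW h0)// -powRrM.
  by apply: ger_powR; [exact: h01|rewrite natrM mulrA [r * 2]mulrC].
have : 1 <= (hsnorm x * h `^ r) ^+ (2 * q) by exact: exprn_ege1.
rewrite exprMn => p1.
have : 1 <= hsnorm x ^+ (2 * q) * h ^+ 3.
  by apply: (le_trans p1); rewrite ler_wpM2l// exprn_ge0.
move=> p2; apply: (@le_trans _ _ (hsnorm x ^+ 2 * (hsnorm x ^+ (2 * q) * h ^+ 3))).
  by rewrite ler_peMr ?sqr_ge0.
rewrite mulrA mulrC; apply: ler_wpM2l; first by rewrite exprn_ge0// ltW.
rewrite -exprD -mulnS exprM; apply: lerXn2r; rewrite ?nnegrE ?sqr_ge0 ?jap_ge0//.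
exact: sqr_hsnorm_le_jap.
Qed.

Lemma scheme0_defect w : hsnorm (scheme 0 w - X0 w) ^+ 2 <= 4 * h ^+ 3 * jap (X0 w) ^+ q.+1.
Proof.
rewrite /scheme /=; case: ifP => _; last exact: projection_defect.
rewrite subrr hsnorm0 expr0n/=.
by rewrite mulr_ge0 ?japX_ge0// mulr_ge0// exprn_ge0// ltW.
Qed.

End OneScheme.
End SchemeMoments.

(** * Small events and refinements of partitions *)

Section SmallSets.
Context d (S : measurableType d) (R : realType) (P : probability S R).

Lemma Ele_markov (f : S -> R) (B e : R) : measurable_fun setT f ->
  (forall w, 0 <= f w) -> 0 < e -> Ele P f B ->
  (P [set w | (e <= f w)%R] <= (B / e)%:E)%E.
Proof.
move=> mf f0 e0 fB.
have mE : measurable [set w | e <= f w].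
  rewrite -[X in measurable X]setTI (_ : [set w | e <= f w] = f @^-1` `[e, +oo[).
    exact: mf.
  by apply/seteqP; split => w /=; rewrite in_itv/= andbT.
have H : (e%:E * P [set w | (e <= f w)%R] <= B%:E)%E.
  apply: le_trans fB.
  rewrite -[X in P X]setIT -integral_indic// -ge0_integralZl_EFin//=; last 2 first.
  - exact/measurable_EFinP/measurable_indic.
  - exact: ltW.
  apply: ge0_le_integral => //=.
  - by move=> w _; rewrite lee_fin mulr_ge0// ltW.
  - by apply/measurable_EFinP; apply: measurable_funM => //; exact: measurable_indic.
  - exact/measurable_EFinP.
  - move=> w _; rewrite lee_fin indicE; case: (boolP (w \in _)) => [|_]/=.
      by rewrite inE/= mulr1.
    by rewrite mulr0.
by rewrite EFinM lee_pdivlMr// muleC.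
Qed.

Lemma probability_setU_le A B a c : measurable A -> measurable B ->
  (P A <= a%:E)%E -> (P B <= c%:E)%E -> (P (A `|` B) <= (a + c)%:E)%E.
Proof.
move=> mA mB Aa Bc; rewrite EFinD; apply: le_trans (leeD Aa Bc).
exact: measureU2.
Qed.

Lemma decreasing_small (A : nat -> set S) (N : set S) (e : R) :
  (forall n, measurable (A n)) -> nonincreasing_seq A -> measurable N ->
  \bigcap_n A n `<=` N -> 0 < e ->
  exists n0, (P (A n0 `|` N) <= P N + e%:E)%E.
Proof.
move=> mA dA mN AN e0.
have mAN n : measurable (A n `\` N) by exact: measurableD.
have cv : P (A n `\` N) @[n --> \oo] --> 0%E.
  rewrite -(measure0 P) (_ : set0 = \bigcap_n (A n `\` N)).
    apply: nonincreasing_cvg_mu => //.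
    - exact: (le_lt_trans (probability_le1 P (mAN 0%N)) (ltry _)).
    - exact: bigcapT_measurable.
    - by move=> i j ij; apply/subsetPset; apply: setSD; exact/subsetPset/dA.
  apply/esym/seteqP; split => // w Aw.
  have /AN Nw : (\bigcap_n A n) w by move=> n _; have [] := Aw n I.
  by have [] := Aw 0%N I.
have /fine_cvgP[fin cvf] := cv.
have [n0 _ Hn] : \forall n \near \oo, fine (P (A n `\` N)) < e.
  have := @cvgr_lt R _ \oo _ _ _ cvf e; apply; exact: e0.
exists n0; have -> : A n0 `|` N = N `|` (A n0 `\` N) by rewrite setUDr setDv setD0 setUC.
apply: (le_trans (measureU2 _ _ _)) => //.
rewrite leeD2l// -[X in (X <= _)%E]fineK ?fin_num_measure// lee_fin.
by apply: ltW; apply: Hn => /=.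
Qed.

(** Almost sure convergence implies convergence in probability: the events that [th] is reached at
    some index beyond [n] decrease to a subset of [N]. *)
Lemma eventually_small (f : nat -> S -> R) (N : set S) (th e : R) :
  (forall n, measurable_fun setT (f n)) -> measurable N ->
  (forall w, ~ N w -> exists n0, forall n, (n0 <= n)%N -> f n w < th) -> 0 < e ->
  exists n0, forall n, (n0 <= n)%N -> exists B,
    [/\ measurable B, (P B <= P N + e%:E)%E & forall w, ~ B w -> f n w < th].
Proof.
move=> mf mN fN e0.
pose A n := \bigcup_(j in [set j | (n <= j)%N]) [set w | th <= f j w].
have mth j : measurable [set w | th <= f j w].
  rewrite -[X in measurable X]setTI (_ : [set w | th <= f j w] = f j @^-1` `[th, +oo[).
    exact: mf.
  by apply/seteqP; split => w /=; rewrite in_itv/= andbT.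
have mA n : measurable (A n) by apply: bigcup_measurable => j _; exact: mth.
have dA : nonincreasing_seq A.
  by move=> i j ij; apply/subsetPset => w [k /= jk wk]; exists k => //=; exact: leq_trans jk.
have AN : \bigcap_n A n `<=` N.
  move=> w Aw; apply: contrapT => /fN[n0 Hn0].
  by have [j /= n0j] := Aw n0 I; rewrite leNgt Hn0.
have [n0 PA] := decreasing_small mA dA mN AN e0.
exists n0 => n n0n; exists (A n0 `|` N); split => //; first exact: measurableU.
move=> w /not_orP[nA _]; rewrite ltNge; apply/negP => H; apply: nA.
by exists n.
Qed.

(* Egorov-type statement; [g] need not be measurable, hence the Cauchy
   formulation of the bad set in the proof. *)
Lemma mx_cvg_small p q (f : nat -> S -> 'M[R]_(p, q)) (g : S -> 'M[R]_(p, q))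
    (N : set S) (th e : R) :
  (forall n, mx_measurable (f n)) -> measurable N ->
  (forall w, ~ N w -> forall t, 0 < t ->
     exists n0, forall n, (n0 <= n)%N -> hsnorm (f n w - g w) <= t) ->
  0 < th -> 0 < e ->
  exists n0, exists B, [/\ measurable B, (P B <= P N + e%:E)%E &
    forall n w, (n0 <= n)%N -> ~ B w -> hsnorm (f n w - g w) <= th].
Proof.
move=> mf mN fN th0 e0.
pose A n := \bigcup_(i in [set i | (n <= i)%N]) \bigcup_(j in [set j | (n <= j)%N])
  [set w | th / 2 <= hsnorm (f i w - f j w)].
have mth i j : measurable [set w | th / 2 <= hsnorm (f i w - f j w)].
  rewrite -[X in measurable X]setTI
    (_ : [set w | _] = (fun w => hsnorm (f i w - f j w)) @^-1` `[th / 2, +oo[).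
    by apply: measurable_hsnorm => //; exact: mx_measurableB.
  by apply/seteqP; split => w /=; rewrite in_itv/= andbT.
have mA n : measurable (A n).
  by apply: bigcup_measurable => i _; apply: bigcup_measurable => j _; exact: mth.
have dA : nonincreasing_seq A.
  move=> a c ac; apply/subsetPset => w [i /= ci [j /= cj wij]].
  by exists i; [exact: leq_trans ci|exists j => //=; exact: leq_trans cj].
have AN : \bigcap_n A n `<=` N.
  move=> w Aw; apply: contrapT => /fN/(_ (th / 5)).
  rewrite divr_gt0// => /(_ isT)[n0 Hn0].
  have [i /= n0i [j /= n0j]] := Aw n0 I.
  have := Hn0 i n0i; have := Hn0 j n0j.
  have := hsnormD (f i w - g w) (g w - f j w); rewrite [hsnorm (g w - _)]hsnormBC.
  by rewrite addrA subrK => *; lra.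
have [n0 PA] := decreasing_small mA dA mN AN e0.
exists n0; exists (A n0 `|` N); split => //; first exact: measurableU.
move=> n w n0n /not_orP[nA nN].
have H j : (n0 <= j)%N -> hsnorm (f n w - f j w) < th / 2.
  move=> n0j; rewrite ltNge; apply/negP => H; apply: nA.
  by exists n => //; exists j.
have /(_ (th / 2))[] := fN w nN; first by rewrite divr_gt0.
move=> n1 /(_ (maxn n0 n1) (leq_maxr _ _)); have := H (maxn n0 n1) (leq_maxl _ _).
have := hsnormD (f n w - f (maxn n0 n1) w) (f (maxn n0 n1) w - g w).
by rewrite addrA subrK => *; lra.
Qed.

End SmallSets.

(** Heine-Cantor from the near-covering form of compactness: [Q del] holds near each point for all
    small [del > 0], hence on the whole interval for some [del]. *)
Lemma heine_mx (R : realType) (T : R) a b (f : R -> 'M[R]_(a, b)) :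
  {within `[0, T], continuous f} -> forall e, 0 < e ->
  exists2 del, 0 < del & forall x y, 0 <= x <= T -> 0 <= y <= T -> `|x - y| < del ->
    hsnorm (f x - f y) <= e.
Proof.
move=> /subspace_continuousP cf e e0.
have /compact_near_coveringP cov := @segment_compact R 0 T.
pose e' := e / ((a * b)%:R + 1) / 2.
have D0 : 0 < (a * b)%:R + 1 :> R by rewrite ltr_wpDl.
have e'0 : 0 < e' by rewrite !divr_gt0.
pose Q (del x : R) := `[0, T]%classic x -> forall y, `[0, T]%classic y -> `|x - y| < del ->
  forall i j, `|f x i j - f y i j| < e' + e'.
have : \forall del \near 0^'+, `[0, T]%classic `<=` Q del.
  apply: cov => x0 Kx0.
  have := cf x0 Kx0 (@mx_ball _ _ _ _ (f x0) e') (nbhsx_ballx (f x0) e' e'0).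
  rewrite /= /within /= => /nbhs_ballP[r /= r0 Hr].
  have r20 : 0 < r / 2 by rewrite divr_gt0.
  exists (ball x0 (r / 2), [set del : R | del < r / 2]).
    by split => /=; [exact: nbhsx_ballx|exact: nbhs_right_lt].
  - move=> [x del] /= [xx0 dr] Kx y Ky xy i j.
    have [_ fx] : @mx_ball _ _ _ _ (f x0) e' (f x).
      apply: Hr => //; apply: le_ball xx0; rewrite ler_pdivrMr// ler_peMr//; lra.
    have [_ fy] : @mx_ball _ _ _ _ (f x0) e' (f y).
      apply: Hr => //; rewrite /ball/= in xx0 *.
      rewrite (_ : x0 - y = (x0 - x) + (x - y)); last by ring.
      rewrite (le_lt_trans (ler_normD _ _))// [r]splitr ltrD//.
      exact: lt_trans dr.
    rewrite (_ : f x i j - f y i j = (f x0 i j - f y i j) - (f x0 i j - f x i j)); last by ring.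
    by rewrite (le_lt_trans (ler_normB _ _))// ltrD//; [exact: fy|exact: fx].
move=> /(@filterI _ _ _ _ _ (nbhs_right_gt 0)) /filter_ex[del /= [del0 HQ]].
exists del => // x y x0 y0 xy.
have Kx : `[0, T]%classic x by rewrite /= in_itv.
have Ky : `[0, T]%classic y by rewrite /= in_itv.
apply: (@le_trans _ _ ((a * b)%:R * (e' + e'))).
  apply: hsnorm_le_entries => [|i j]; first by rewrite addr_ge0// ltW.
  by rewrite !mxE; apply: ltW; exact: HQ.
rewrite /e' -splitr mulrCA ler_piMr ?ltW//.
by rewrite ltr_pdivrMr// mul1r ltrDl.
Qed.

(** * Common refinements of partitions *)

Section Refinement.
Context (R : realType).

Lemma increasing_ltP (rho : nat -> R) K :
  (forall k, (k < K)%N -> rho k < rho k.+1) ->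
  forall i j, (i <= K)%N -> (j <= K)%N -> (rho i < rho j) = (i < j)%N.
Proof.
move=> inc.
have lt i j : (i < j)%N -> (j <= K)%N -> rho i < rho j.
  elim: j => // j IH; rewrite ltnS leq_eqVlt => /predU1P[->|ij] jK; first exact: inc.
  by apply: lt_trans (inc _ jK); apply: IH => //; exact: ltnW.
move=> i j iK jK; case: (ltngtP i j) => [ij|ji|->]; first exact: lt.
  by apply/negbTE; rewrite -leNgt ltW// lt.
by rewrite ltxx.
Qed.

Lemma merged_partition (s1 s2 : seq R) : exists (rho : nat -> R) (K : nat),
  [/\ (forall k, (k < K)%N -> rho k < rho k.+1),
      (forall x, x \in s1 -> exists2 k, (k <= K)%N & rho k = x),
      (forall x, x \in s2 -> exists2 k, (k <= K)%N & rho k = x) &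
      (s1 != [::] -> forall k, (k <= K)%N -> (rho k \in s1) || (rho k \in s2))].
Proof.
pose s := sort <=%R (undup (s1 ++ s2)).
have ss : sorted <%R s by rewrite sort_lt_sorted undup_uniq.
have mem x : (x \in s) = (x \in s1) || (x \in s2).
  by rewrite mem_sort mem_undup mem_cat.
(* The last index is one less than the number of points. For empty lists [nth] returns its default
   0, which belongs to neither list; hence the nonemptiness in the last clause. *)
exists (nth 0 s), (size s).-1; split.
- move=> k kK; have /(sortedP 0) nth_lt := ss.
  by apply: nth_lt; rewrite -ltn_predRL.
- move=> x x1; have xs : x \in s by rewrite mem x1.
  exists (index x s); last exact: nth_index.
  by rewrite -ltnS prednK ?index_mem//; case: (s) xs.
- move=> x x2; have xs : x \in s by rewrite mem x2 orbT.
  exists (index x s); last exact: nth_index.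
  by rewrite -ltnS prednK ?index_mem//; case: (s) xs.
- move=> s10 k kK; rewrite -mem mem_nth//.
  have : (0 < size s)%N.
    have [x x1] : exists x, x \in s1 by case: (s1) s10 => // x ? _; exists x; rewrite mem_head.
    have : x \in s by rewrite mem x1.
    by case: (s).
  by move=> s0; rewrite -(prednK s0) ltnS.
Qed.

Context (Omega : Type) (d m : nat) (W : R -> Omega -> 'cV[R]_m).

(** Cells are open on the left and closed on the right, like the intervals of the step process, so
    the value on a cell is read at its right end. *)
Lemma step_eval_cell (S : step_process R Omega d m) (rho : nat -> R) K :
  (forall k, (k < K)%N -> rho k < rho k.+1) ->
  (forall i, (i <= step_size S)%N -> exists2 k, (k <= K)%N & rho k = step_time S i) ->
  forall k v w, (k < K)%N -> rho k < v <= rho k.+1 ->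
  step_eval S v w = step_eval S (rho k.+1) w.
Proof.
move=> inc sub k v w kK /andP[kv vk]; rewrite /step_eval; apply: eq_bigl => i.
have [p pK <-] := sub i (ltnW (ltn_ord i)).
have [q qK <-] := sub i.+1 (ltn_ord i).
have ltP := increasing_ltP inc.
rewrite (ltP p k.+1)// [X in _ = _ && X]leNgt (ltP q k.+1)//.
have -> : (rho p < v) = (p < k.+1)%N.
  rewrite ltnS; have [pk|kp] := leqP p k.
    by apply: le_lt_trans kv; rewrite leNgt (ltP k p) -?leqNgt// ltnW.
  apply/negbTE; rewrite -leNgt (le_trans vk)// leNgt (ltP p k.+1)// -leqNgt.
  exact: kp.
congr (_ && _); rewrite -leqNgt.
have [kq|qk] := leqP k.+1 q.
  by rewrite (le_trans vk)// leNgt (ltP q k.+1)// -leqNgt.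
apply/negbTE; rewrite -ltNge; apply: le_lt_trans kv.
by rewrite leNgt (ltP k q)// ?(ltnW kK)// -leqNgt -ltnS.
Qed.

(** After exchanging the two sums, the increments of [W] over the cells of one original interval
    telescope. *)
Lemma step_integral_refine (S : step_process R Omega d m) (rho : nat -> R) K w :
  (forall k, (k < K)%N -> rho k < rho k.+1) ->
  (forall i, (i < step_size S)%N -> step_time S i < step_time S i.+1) ->
  (forall i, (i <= step_size S)%N -> exists2 k, (k <= K)%N & rho k = step_time S i) ->
  step_integral W S w =
  \sum_(k < K) step_eval S (rho k.+1) w *m (W (rho k.+1) w - W (rho k) w).
Proof.
move=> inc tinc sub; rewrite /step_integral /step_eval.
under [RHS]eq_bigr do rewrite mulmx_suml.
rewrite [RHS](exchange_big_dep xpredT)//=; apply: eq_bigr => i _.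
rewrite -mulmx_sumr; congr (_ *m _).
have [p pK Ep] := sub i (ltnW (ltn_ord i)).
have [q qK Eq] := sub i.+1 (ltn_ord i).
have ltP := increasing_ltP inc.
have pq : (p < q)%N by rewrite -(ltP p q)// Ep Eq; exact: tinc.
rewrite -Ep -Eq -(telescope_sumr (fun k => W (rho k) w) (ltnW pq)).
rewrite -(big_mkord (fun k => (rho p < rho k.+1) && (rho k.+1 <= rho q))
  (fun k => W (rho k.+1) w - W (rho k) w)).
rewrite (big_nat_widen _ _ _ _ _ qK) (big_nat_widenl _ _ _ _ _ (leq0n p)).
rewrite [LHS]big_nat_cond [RHS]big_nat_cond; apply: eq_bigl => k.
case: (boolP (0 <= k < K)%N) => //= kK.
rewrite (ltP p k.+1)// ltnS leNgt (ltP q k.+1)// -leqNgt.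
by rewrite andbC.
Qed.

End Refinement.

(** * Riemann sums along continuous paths *)

Definition ucont (R : realType) (u : R) a b (f : R -> 'M[R]_(a, b)) :=
  forall e, 0 < e -> exists2 del, 0 < del &
    forall x y, 0 <= x <= u -> 0 <= y <= u -> `|x - y| < del -> hsnorm (f x - f y) <= e.

Section UniformPaths.
Variable R : realType.

Lemma ucont_sub (u T : R) a b (f : R -> 'M[R]_(a, b)) : u <= T -> ucont T f -> ucont u f.
Proof.
move=> uT cf e /cf[del del0 H]; exists del => // x y /andP[x0 xu] /andP[y0 yu].
by apply: H; rewrite ?x0 ?y0 /=; [exact: le_trans uT|exact: le_trans uT].
Qed.

(** Starting from 0, each move of length at most [del / 2] changes the norm by at most 1. The bound
    is an integer because it indexes the localising events. *)
Lemma ucont_bounded (T : R) a b (f : R -> 'M[R]_(a, b)) : ucont T f ->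
  exists N : nat, forall t, 0 <= t <= T -> hsnorm (f t) <= N%:R.
Proof.
move=> /(_ 1 ltr01)[del del0 H].
have chain n t : 0 <= t <= T -> t <= n%:R * (del / 2) -> hsnorm (f t) <= hsnorm (f 0) + n%:R.
  elim: n t => [|n IH] t /andP[t0 tT] tn.
    rewrite addr0; have -> : t = 0 by apply/eqP; rewrite eq_le t0 andbT; move: tn; rewrite mul0r.
    by [].
  have s1 : hsnorm (f (Num.max 0 (t - del / 2))) <= hsnorm (f 0) + n%:R.
    apply: IH; first by rewrite le_max lexx/= ge_max (le_trans t0)//=; lra.
    rewrite ge_max; apply/andP; split; first by rewrite mulr_ge0// divr_ge0// ltW.
    by move: tn; rewrite -natr1; lra.
  have s2 : hsnorm (f t - f (Num.max 0 (t - del / 2))) <= 1.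
    apply: H; rewrite ?t0//.
      by rewrite le_max lexx/= ge_max (le_trans t0)//=; lra.
    by rewrite ltr_norml; have [|] := leP 0 (t - del / 2) => ?; apply/andP; split; lra.
  have := hsnormD (f t - f (Num.max 0 (t - del / 2))) (f (Num.max 0 (t - del / 2))).
  by rewrite subrK -natr1; lra.
pose n := (Num.truncn (T / (del / 2))).+1.
exists (Num.truncn (hsnorm (f 0) + n%:R)).+1 => t tT.
apply: (@le_trans _ _ (hsnorm (f 0) + n%:R)); last exact/ltW/Num.Theory.truncnS_gt.
apply: chain => //; case/andP: tT => _ tT; apply: (le_trans tT).
rewrite -ler_pdivrMr; last by rewrite divr_gt0.
exact/ltW/Num.Theory.truncnS_gt.
Qed.

Lemma ucont_lipschitz_comp (T : R) d a b (f : R -> 'cV[R]_d -> 'M[R]_(a, b))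
    (X : R -> 'cV[R]_d) : locally_lipschitz T f -> ucont T X -> ucont T (fun t => f t (X t)).
Proof.
move=> lf cX e e0; have [N XN] := ucont_bounded cX.
have [L fL] := lf N%:R.
have L0 : 0 < `|L| + 1 by rewrite ltr_wpDl.
pose e1 := e / (`|L| + 1) / 2.
have e10 : 0 < e1 by rewrite !divr_gt0.
have [del del0 H] := cX e1 e10.
exists (Num.min del e1); first by rewrite lt_min del0.
move=> x y xT yT; rewrite lt_min => /andP[xy1 xy2].
apply: (le_trans (fL _ _ _ _ xT yT (XN _ xT) (XN _ yT))).
have s1 := H x y xT yT xy1.
have S0 : 0 <= `|x - y| + hsnorm (X x - X y) by rewrite addr_ge0// hsnorm_ge0.
apply: (@le_trans _ _ ((`|L| + 1) * (e1 + e1))).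
  apply: (@le_trans _ _ ((`|L| + 1) * (`|x - y| + hsnorm (X x - X y)))).
    by apply: ler_wpM2r => //; have := ler_norm L; lra.
  by apply: ler_wpM2l; [exact: ltW|lra].
by rewrite /e1 -splitr mulrC divfK// gt_eqF.
Qed.

(* Extends a path on [0, u] to the real line, where continuity gives
   measurability. *)
Definition clamp (u v : R) : R := Num.max 0 (Num.min v u).

Lemma clamp_in (u v : R) : 0 <= u -> 0 <= clamp u v <= u.
Proof. by move=> u0; rewrite /clamp le_max lexx/= ge_max u0 ge_min lexx orbT. Qed.

Lemma clamp_id (u v : R) : 0 <= v <= u -> clamp u v = v.
Proof. by case/andP => v0 vu; rewrite /clamp (min_idPl vu) (max_idPr v0). Qed.

Lemma clamp_lip (u x y : R) : 0 <= u -> `|clamp u x - clamp u y| <= `|x - y|.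
Proof.
move=> u0; rewrite /clamp.
by case: (leP x u) => xu; case: (leP y u) => yu;
  [case: (leP 0 x) => x0; case: (leP 0 y) => y0|case: (leP 0 x) => x0; case: (leP 0 u) => y0|
   case: (leP 0 u) => x0; case: (leP 0 y) => y0|];
  rewrite ?subrr ?normr0//; rewrite ler_norml; have := ler_norm (x - y);
  have := ler_norm (y - x); rewrite (distrC y x) => *; apply/andP; split; lra.
Qed.

Lemma ucont_clamp_measurable (u : R) a b (f : R -> 'M[R]_(a, b)) : 0 <= u ->
  ucont u f -> mx_measurable (fun v : R => f (clamp u v)).
Proof.
move=> u0 cf i j; apply: continuous_measurable_fun => x.
apply/cvgrPdist_le => e e0; have [del del0 H] := cf e e0.
apply/nbhs_ballP; exists del => //= y xy.
have := hsnorm_entry (f (clamp u x) - f (clamp u y)) i j; rewrite !mxE => fij.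
apply: (le_trans fij); apply: H; rewrite ?clamp_in//.
exact: (le_lt_trans (clamp_lip _ _ u0)).
Qed.

Lemma lebesgue_measure_cell (x y : R) : x <= y ->
  lebesgue_measure `]x, y]%classic = (y - x)%:E.
Proof.
move=> xy; rewrite lebesgue_measure_itv/= lte_fin.
case: ltP => [_|yx]; first by rewrite EFinB.
by have -> : y = x; [apply/eqP; rewrite eq_le yx xy|rewrite subrr].
Qed.

Lemma cells_le_integral (rho c : nat -> R) K (Phi : R -> R) :
  (forall k, (k < K)%N -> rho k < rho k.+1) ->
  measurable_fun setT Phi -> (forall v, 0 <= Phi v) -> (forall k, 0 <= c k) ->
  (forall k v, (k < K)%N -> rho k < v <= rho k.+1 -> c k <= Phi v) ->
  ((\sum_(k < K) (rho k.+1 - rho k) * c k)%:E <=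
    \int[lebesgue_measure]_(v in `](rho 0%N), (rho K)]) (Phi v)%:E)%E.
Proof.
move=> inc mPhi Phi0 c0 cPhi.
have mE (D : set R) : measurable_fun D (fun v => (Phi v)%:E).
  by apply/measurable_EFinP; exact: measurable_funTS.
elim: K inc cPhi => [|K IH] inc cPhi.
  by rewrite big_ord0; apply: integral_ge0 => v _; rewrite lee_fin.
have ltP := increasing_ltP inc.
have le0K : rho 0%N <= rho K by rewrite leNgt (ltP K 0%N).
have ltK : rho K < rho K.+1 by exact: inc.
have -> : `](rho 0%N), (rho K.+1)]%classic =
    `](rho 0%N), (rho K)]%classic `|` `](rho K), (rho K.+1)]%classic.
  apply/seteqP; split => v /=; rewrite !in_itv/=.
    move=> /andP[v0 vK]; have [h|h] := leP v (rho K); [left|right].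
      by rewrite v0.
    by rewrite vK.
  move=> [|] /andP[a1 a2]; apply/andP; split=> //.
    exact: le_trans (ltW ltK).
  exact: le_lt_trans a1.
rewrite ge0_integral_setU//=; last 3 first.
- exact: mE.
- by move=> v _; rewrite lee_fin.
- apply/disj_setPS => v /= []; rewrite !in_itv/= => /andP[_ h1] /andP[h2 _].
  by have := le_lt_trans h1 h2; rewrite ltxx.
rewrite big_ord_recr/= EFinD; apply: leeD.
  apply: IH => [k kK|k v kK]; first by apply: inc; exact: ltnW.
  by apply: cPhi; exact: ltnW.
apply: (@le_trans _ _ (\int[lebesgue_measure]_(v in `](rho K), (rho K.+1)]) (c K)%:E)%E).
  rewrite integral_cst//= lebesgue_measure_cell; last exact: ltW.
  by rewrite -EFinM mulrC.
apply: ge0_le_integral => //=.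
- by move=> v _; rewrite lee_fin.
- exact: mE.
- by move=> v vK; rewrite lee_fin; apply: cPhi => //; move: vK; rewrite ?in_itv.
Qed.

Context (Omega : Type) (d m : nat).
Implicit Type S : step_process R Omega d m.

Lemma step_eval_measurable S w : mx_measurable (fun v : R => step_eval S v w).
Proof.
have -> : (fun v => step_eval S v w) = (fun v => \sum_(i < step_size S)
   \1_(`](step_time S i), (step_time S i.+1)]%classic) v *: step_val S i w).
  apply/funext => v; rewrite /step_eval big_mkcond; apply: eq_bigr => i _.
  rewrite indicE mem_setE in_itv/=; case: ifP => _; first by rewrite scale1r.
  by rewrite scale0r.
apply: mx_measurable_sum => i _; apply: mx_measurableZf.
  exact: measurable_indic.
exact: mx_measurable_cst.
Qed.

(** On a common refinement the left side is the quadratic variation of the difference of the two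
    stochastic sums. [H] is inserted between them: [S] is uniformly close to it on the path, [S'] is
    close to it in L^2. *)
Lemma step_distance_le S S' (rho : nat -> R) K (u e : R) (H : R -> 'M[R]_(d, m)) w :
  0 <= u -> ucont u H ->
  (forall k, (k < K)%N -> rho k < rho k.+1) ->
  (forall i, (i <= step_size S)%N -> exists2 k, (k <= K)%N & rho k = step_time S i) ->
  (forall i, (i <= step_size S')%N -> exists2 k, (k <= K)%N & rho k = step_time S' i) ->
  (forall k, (k <= K)%N -> 0 <= rho k <= u) -> 0 <= e ->
  (forall v, 0 < v <= u -> hsnorm (step_eval S v w - H v) <= e) ->
  ((\sum_(k < K) (rho k.+1 - rho k) *
      hsnorm (step_eval S (rho k.+1) w - step_eval S' (rho k.+1) w) ^+ 2)%:E <=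
   2%:E * \int[lebesgue_measure]_(v in `[0%R, u])
      ((hsnorm (step_eval S' v w - H v) ^+ 2)%R)%:E + (2 * e ^+ 2 * u)%:E)%E.
Proof.
move=> u0 cH inc sub sub' rhou e0 SH.
pose g v := hsnorm (step_eval S' v w - H (clamp u v)) ^+ 2.
pose Phi v := 2 * g v + 2 * e ^+ 2.
have mg : measurable_fun setT g.
  apply: measurable_hsnorm2; apply: mx_measurableB; first exact: step_eval_measurable.
  exact: ucont_clamp_measurable.
have m2g : measurable_fun setT (fun v => 2 * g v).
  by apply: measurable_funM => //; exact: measurable_cst.
have mPhi : measurable_fun setT Phi.
  by apply: measurable_funD => //; exact: measurable_cst.
have g0 v : 0 <= g v by exact: sqr_ge0.
have e2 : 0 <= 2 * e ^+ 2 by rewrite mulr_ge0// sqr_ge0.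
have Phi0 v : 0 <= Phi v by rewrite /Phi addr_ge0// mulr_ge0.
apply: (le_trans (cells_le_integral (c := fun k =>
   hsnorm (step_eval S (rho k.+1) w - step_eval S' (rho k.+1) w) ^+ 2) inc mPhi Phi0 _ _)).
- by move=> k; exact: sqr_ge0.
- move=> k v kK kv.
  have /andP[r1 _] := rhou k (ltnW kK); have /andP[_ r2] := rhou k.+1 kK.
  have v0 : 0 < v <= u.
    by case/andP: kv => a1 a2; rewrite (le_lt_trans r1 a1) (le_trans a2 r2).
  rewrite -(step_eval_cell inc sub w kK kv) -(step_eval_cell inc sub' w kK kv).
  rewrite /Phi /g clamp_id; last by case/andP: v0 => /ltW -> ->.
  have -> : step_eval S v w - step_eval S' v w =
     (step_eval S v w - H v) + (H v - step_eval S' v w) by rewrite addrA subrK.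
  apply: (le_trans (sqr_hsnormD_le _ _)); rewrite (hsnormBC (H v)).
  have := SH v v0; have := hsnorm_ge0 (step_eval S v w - H v); nra.
have -> : (2%:E * \int[lebesgue_measure]_(v in `[0%R, u])
      ((hsnorm (step_eval S' v w - H v) ^+ 2)%R)%:E + (2 * e ^+ 2 * u)%:E =
    \int[lebesgue_measure]_(v in `[0%R, u]) (Phi v)%:E)%E.
  rewrite /Phi; under [RHS]eq_integral do rewrite EFinD.
  rewrite ge0_integralD//=; last 2 first.
  - by move=> v _; rewrite lee_fin mulr_ge0.
  - by apply/measurable_EFinP; exact: measurable_funTS.
  rewrite integral_cst//= lebesgue_measure_itv/=.
  under [X in _ = (X + _)%E]eq_integral do rewrite EFinM.
  rewrite ge0_integralZl_EFin//=; last 2 first.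
  - by move=> v _; rewrite lee_fin.
  - by apply/measurable_EFinP; exact: measurable_funTS.
  have -> : (\int[lebesgue_measure]_(v in `[0%R, u])
      ((hsnorm (step_eval S' v w - H v) ^+ 2)%R)%:E =
      \int[lebesgue_measure]_(v in `[0%R, u]) (g v)%:E)%E.
    apply: eq_integral => v; rewrite inE/= in_itv/= => vu.
    by rewrite /g clamp_id.
  set I := (\int[_]_(_ in _) _)%E; suff -> : ((2 * e ^+ 2)%:E *
     (if (0 < u%:E)%E then (u%:E - 0%:E)%E else 0%E) = (2 * e ^+ 2 * u)%:E)%E by [].
  rewrite lte_fin; move: u0; rewrite le_eqVlt => /predU1P[<-|->].
    by rewrite ltxx mulr0 mule0.
  by rewrite -EFinB -EFinM subr0.
apply: ge0_subset_integral => //=.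
- by apply/measurable_EFinP; exact: measurable_funTS.
- by move=> v _; rewrite lee_fin.
- move=> v /=; rewrite !in_itv/= => /andP[a1 a2].
  have /andP[r1 _] := rhou 0%N (leq0n _); have /andP[_ r2] := rhou K (leqnn _).
  by rewrite (ltW (le_lt_trans r1 a1)) (le_trans a2 r2).
Qed.

Definition grid_process (H : R -> Omega -> 'M[R]_(d, m)) (J : nat) (del : R) :=
  StepProcess J (fun i => i%:R * del) (fun i => H (i%:R * del)).

Lemma grid_eval (H : R -> Omega -> 'M[R]_(d, m)) J del i v w : 0 < del -> (i < J)%N ->
  i%:R * del < v <= i.+1%:R * del -> step_eval (grid_process H J del) v w = H (i%:R * del) w.
Proof.
move=> del0 iJ iv; rewrite /step_eval /=.
have inc k : (k < J)%N -> k%:R * del < k.+1%:R * del by rewrite ltr_pM2r// ltr_nat.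
rewrite (big_pred1 (Ordinal iJ))// => k /=; apply/idP/eqP => [/andP[k1 k2]|->//].
case/andP: iv => i1 i2; apply/val_inj/eqP => /=; rewrite eqn_leq; apply/andP; split.
  by have := lt_le_trans k1 i2; rewrite ltr_pM2r// ltr_nat ltnS.
by have := lt_le_trans i1 k2; rewrite ltr_pM2r// ltr_nat ltnS.
Qed.

Lemma grid_cell J (del v : R) : 0 < del -> 0 < v <= J%:R * del ->
  exists2 i, (i < J)%N & i%:R * del < v <= i.+1%:R * del.
Proof.
move=> del0; elim: J => [|J IH] /andP[v0 vJ].
  by move: vJ; rewrite mul0r leNgt v0.
have [vJ'|Jv] := leP v (J%:R * del).
  by have [|i iJ] := IH; [rewrite v0|exists i => //; exact: ltnW].
by exists J => //; rewrite Jv vJ.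
Qed.

Lemma grid_near (H : R -> Omega -> 'M[R]_(d, m)) J del eta e u w :
  0 < del -> J%:R * del = u -> del < eta ->
  (forall x y, 0 <= x <= u -> 0 <= y <= u -> `|x - y| < eta -> hsnorm (H x w - H y w) <= e) ->
  forall v, 0 < v <= u -> hsnorm (step_eval (grid_process H J del) v w - H v w) <= e.
Proof.
move=> del0 <- de HH v vJ.
have [i iJ iv] := grid_cell del0 vJ.
rewrite (grid_eval H w del0 iJ iv); case/andP: vJ => v0 vJ; case/andP: iv => i1 i2.
have i0 : 0 <= i%:R * del by rewrite mulr_ge0// ltW.
apply: HH; rewrite ?i0 ?(ltW v0) ?(le_trans (ltW i1) vJ)//.
move: i2; rewrite -natr1 => i2.
by rewrite distrC ger0_norm; lra.
Qed.

End UniformPaths.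

(** * Lenglart's inequality for discrete sums *)

(** Cell by cell, the integrand is compared with its value at the left end, and each cell
    contributes at most [e * del]. The clamped function supplies measurability on the whole line. *)
Lemma riemann_sum_near (R : realType) (f : R -> R) J (del eta e M : R) :
  let u := J%:R * del in
  0 < del -> del < eta -> 0 <= e ->
  measurable_fun setT (fun v => f (clamp u v)) ->
  (forall v, 0 <= v <= u -> `|f v| <= M) ->
  (forall x y, 0 <= x <= u -> 0 <= y <= u -> `|x - y| < eta -> `|f x - f y| <= e) ->
  `|\sum_(i < J) del * f (i%:R * del)
     - \int[lebesgue_measure]_(v in `[0, u]) f v| <= e * u.
Proof.
move=> u del0 de e0 mf fM ff.
have u0 : 0 <= u by rewrite mulr_ge0// ltW.
pose g v := f (clamp u v).
have -> : \int[lebesgue_measure]_(v in `[0, u]) f v =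
    \int[lebesgue_measure]_(v in `[0, u]) g v.
  by apply: eq_Rintegral => v; rewrite inE/= in_itv/= => vu; rewrite /g clamp_id.
have gi : (@lebesgue_measure R).-integrable `[0, u] (EFin \o g).
  apply: measurable_bounded_integrable => //=.
  - by rewrite lebesgue_measure_itv/=; case: ifP => _; rewrite -?EFinB ltry.
  - exact: measurable_funTS.
  - exists M; split; first exact: num_real.
    move=> x Mx v /=; rewrite in_itv/= => vu; rewrite /g clamp_id//.
    by apply: (le_trans (fM v vu)); exact: ltW.
have sub (x y : R) : 0 <= x -> y <= u -> `]x, y]%classic `<=` `[0, u]%classic.
  move=> x0 yu v /=; rewrite !in_itv/= => /andP[xv vy].
  by rewrite (le_trans x0 (ltW xv)) (le_trans vy yu).
have gS (D : set R) : measurable D -> D `<=` `[0, u] ->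
    (@lebesgue_measure R).-integrable D (EFin \o g).
  by move=> mD Du; exact: integrableS gi.
rewrite -Rintegral_itv_obnd_cbnd; last by apply: gS => //; exact: (sub _ _ (lexx _) (lexx _)).
suff key j : (j <= J)%N -> `|\sum_(i < j) del * f (i%:R * del)
     - \int[lebesgue_measure]_(v in `]0, (j%:R * del)]) g v| <= e * (j%:R * del).
  exact: key.
elim: j => [|j IH] jJ.
  by rewrite big_ord0 mul0r set_itv_ge ?bnd_simp// Rintegral_set0 subr0 normr0 mulr0.
have jle : j.+1%:R * del <= u by rewrite ler_wpM2r ?(ltW del0)// ler_nat.
have j0 : 0 <= j%:R * del by rewrite mulr_ge0// ltW.
have jS : j.+1%:R * del = j%:R * del + del by rewrite -natr1 mulrDl mul1r.
have jj : j%:R * del <= j.+1%:R * del by rewrite jS lerDl ltW.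
have ju : j%:R * del <= u by exact: le_trans jle.
have E : `]0, (j.+1%:R * del)]%classic =
    `]0, (j%:R * del)]%classic `|` `](j%:R * del), (j.+1%:R * del)]%classic.
  apply/seteqP; split => v /=; rewrite !in_itv/=.
    move=> /andP[v0 vK]; have [h|h] := leP v (j%:R * del); [left|right].
      by rewrite v0.
    by rewrite vK.
  move=> [|] /andP[a1 a2]; apply/andP; split=> //; first exact: le_trans jj.
  exact: le_lt_trans a1.
rewrite E Rintegral_setU//=; last 2 first.
- by rewrite -E; apply: gS => //; exact: (sub _ _ (lexx _) jle).
- apply/disj_setPS => v /= []; rewrite !in_itv/= => /andP[_ h1] /andP[h2 _].
  by have := le_lt_trans h1 h2; rewrite ltxx.
set D := `](j%:R * del), (j.+1%:R * del)]%classic.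
have lebD : lebesgue_measure D = del%:E.
  by rewrite lebesgue_measure_cell// jS addrC addKr.
have giD : (@lebesgue_measure R).-integrable D (EFin \o g) by apply: gS; [exact: measurable_itv|exact: (sub _ _ j0 jle)].
have ci c : (@lebesgue_measure R).-integrable D (EFin \o cst c).
  apply: measurable_bounded_integrable; first exact: measurable_itv.
  - by have := ltry del; rewrite -lebD.
  - exact: measurable_cst.
  - by exists `|c|; split; [exact: num_real|move=> x cx v _ /=; exact: ltW].
have mD : measurable D by exact: measurable_itv.
have cD c : \int[lebesgue_measure]_(v in D) c = c * del.
  by rewrite Rintegral_cst//; congr (_ * _); have := congr1 fine lebD; apply: etrans.
have cell : `|del * f (j%:R * del) - \int[lebesgue_measure]_(v in D) g v| <= e * del.
  have -> : del * f (j%:R * del) = \int[lebesgue_measure]_(v in D) (f (j%:R * del)).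
    by rewrite cD mulrC.
  rewrite -RintegralB//; last exact: ci.
  apply: (le_trans (le_normr_Rintegral _ _)) => //.
    exact: (integrableB _ (ci _) giD).
  rewrite -(cD e).
  apply: le_Rintegral => //.
  - exact: (integrable_abse (integrableB _ (ci (f (j%:R * del))) giD)).
  - exact: ci.
  move=> v; rewrite /D/= in_itv/= => /andP[v1 v2]; rewrite /g clamp_id; last first.
    by rewrite (ltW (le_lt_trans j0 v1)) (le_trans v2 jle).
  apply: ff; rewrite ?j0 ?ju//.
    by rewrite (ltW (le_lt_trans j0 v1)) (le_trans v2 jle).
  by rewrite distrC ger0_norm; move: v2; rewrite jS; lra.
rewrite big_ord_recr/=.
rewrite opprD addrACA.
apply: (le_trans (ler_normD _ _)); rewrite jS mulrDr.
by apply: lerD => //; apply: IH; exact: ltnW.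
Qed.

(** * Sums stopped by their quadratic variation *)

Section StochasticRiemann.
Context (R : realType) (T : R) (disp : measure_display)
  (Omega : measurableType disp) (P : probability Omega R)
  (F : R -> set (set Omega)) (m : nat) (W : R -> Omega -> 'cV[R]_m).
Hypothesis rcF : right_continuous_filtration T F.
Hypothesis wW : wiener_process T P F W.

Section Lenglart.
Variables (n K : nat) (rho : nat -> R) (A : nat -> Omega -> 'M[R]_(n, m)).
Hypothesis inc : forall k, (k < K)%N -> rho k < rho k.+1.
Hypothesis rhoT : forall k, (k <= K)%N -> 0 <= rho k <= T.
Hypothesis mA : forall k, (k < K)%N -> Fmx F (rho k) (A k).

Definition quad_var k w := \sum_(i < k) (rho i.+1 - rho i) * hsnorm (A i w) ^+ 2.

Let rho_mono i j : (i <= j)%N -> (j <= K)%N -> rho i <= rho j.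
Proof.
move=> ij jK; rewrite leNgt (increasing_ltP inc) -?leqNgt//.
exact: leq_trans jK.
Qed.

Let Fr i j a b (Y : Omega -> 'M[R]_(a, b)) : (i <= j)%N -> (j <= K)%N ->
  Fmx F (rho i) Y -> Fmx F (rho j) Y.
Proof.
move=> ij jK; have iK := leq_trans ij jK.
have /andP[i0 _] := rhoT iK; have /andP[_ jT] := rhoT jK.
exact: (Fmx_mono rcF i0 (rho_mono ij jK) jT).
Qed.

(** The index [j.+1] is allowed since the last term involves only [A j], known at time [rho j]; the
    cutoff of term [k], which looks at [quad_var k.+1], is therefore adapted. *)
Lemma quad_var_measurable k j : (k <= j.+1)%N -> (j < K)%N ->
  measurable_fun setT (quad_var k : g_sigma_algebraType (F (rho j)) -> R).
Proof.
move=> kj jK; apply: measurable_sum => i.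
apply: measurable_funM; first exact: measurable_cst.
apply: measurable_hsnorm2; have ik := leq_trans (ltn_ord i) kj.
by apply: (Fr (i := i)) => //; [exact: ltnW|apply: mA; exact: leq_trans jK].
Qed.

Lemma quad_var_measurableT k : (k <= K)%N -> measurable_fun setT (quad_var k).
Proof.
move=> kK; apply: measurable_sum => i.
apply: measurable_funM; first exact: measurable_cst.
have iK := leq_trans (ltn_ord i) kK; have /andP[i0 iT] := rhoT (ltnW iK).
by apply: measurable_hsnorm2; exact: (Fmx_measurable rcF i0 iT (mA iK)).
Qed.

Variables (th : R).
Hypothesis th0 : 0 <= th.

(* Sum stopped before its quadratic variation exceeds [th]: it has second moment
   at most [6 * th] and agrees with the original sum when [quad_var K < th]. *)
Let cutoff k w : R := (quad_var k.+1 w < th)%R%:R.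
Let B k w := cutoff k w *: A k w.
Let S k w := \sum_(i < k) B i w *m (W (rho i.+1) w - W (rho i) w).

Let mcut k : (k < K)%N ->
  measurable_fun setT (cutoff k : g_sigma_algebraType (F (rho k)) -> R).
Proof.
move=> kK; have mq := quad_var_measurable (leqnn k.+1) kK.
have mb : measurable_fun setT
     ((fun w => quad_var k.+1 w < th) : g_sigma_algebraType (F (rho k)) -> bool).
  by apply: measurable_fun_ltr => //; exact: measurable_cst.
rewrite (_ : cutoff k = fun w => if quad_var k.+1 w < th then 1 else 0); last first.
  by apply/funext => w; rewrite /cutoff; case: ifP.
by apply: measurable_fun_ifT => //; exact: measurable_cst.
Qed.

Let mB k : (k < K)%N -> Fmx F (rho k) (B k).
Proof. by move=> kK; apply: mx_measurableZf; [exact: mcut|exact: mA]. Qed.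

Let mS k : (k <= K)%N -> Fmx F (rho k) (S k).
Proof.
move=> kK; apply: mx_measurable_sum => i _.
have iK := leq_trans (ltn_ord i) kK.
have /andP[i0 _] := rhoT (ltnW iK); have /andP[_ iT] := rhoT iK.
apply: mx_measurableM; first by apply: (Fr (ltnW (ltn_ord i)) kK); exact: mB.
apply: (Fr (ltn_ord i) kK).
exact: (increment_measurable rcF wW i0 (rho_mono (leqnSn i) iK) iT).
Qed.

Let qB i w := (rho i.+1 - rho i) * hsnorm (B i w) ^+ 2.

Let qB0 i w : (i < K)%N -> 0 <= qB i w.
Proof. by move=> iK; rewrite mulr_ge0 ?sqr_ge0// subr_ge0 ltW// inc. Qed.

(** The second clause serves a step that is kept: no earlier term has been cut, so the bound by [th]
    is inherited from [quad_var]. *)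
Let sum_qB k w : (k <= K)%N ->
  0 <= \sum_(i < k) qB i w <= th /\
  (quad_var k w < th -> \sum_(i < k) qB i w <= quad_var k w).
Proof.
elim: k => [|k IH] kK; first by rewrite !big_ord0 lexx th0 /quad_var big_ord0.
have [/andP[h0 h1] h2] := IH (ltnW kK).
have q0 := qB0 w kK; rewrite big_ord_recr/=.
have QS : quad_var k.+1 w = quad_var k w + (rho k.+1 - rho k) * hsnorm (A k w) ^+ 2.
  by rewrite /quad_var big_ord_recr.
have Q0 : 0 <= (rho k.+1 - rho k) * hsnorm (A k w) ^+ 2.
  by rewrite mulr_ge0 ?sqr_ge0// subr_ge0 ltW// inc.
have [lt|ge] := ltP (quad_var k.+1 w) th.
  have -> : qB k w = (rho k.+1 - rho k) * hsnorm (A k w) ^+ 2.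
    by rewrite /qB /B /cutoff lt scale1r.
  have hk : quad_var k w < th by lra.
  have := h2 hk; split; last by move=> _; lra.
  by apply/andP; split; lra.
have -> : qB k w = 0.
  by rewrite /qB /B /cutoff ltNge ge/= scale0r hsnorm0 expr0n mulr0.
by rewrite addr0 h0 h1; split=> //; rewrite ltNge ge.
Qed.

Let mqB i : (i < K)%N -> measurable_fun setT (qB i).
Proof.
move=> iK; have /andP[i0 iT] := rhoT (ltnW iK).
apply: measurable_funM; first exact: measurable_cst.
by apply: measurable_hsnorm2; exact: (Fmx_measurable rcF i0 iT (mB iK)).
Qed.

Let qB_th i w : (i < K)%N -> qB i w <= th.
Proof.
move=> iK; have [/andP[_ h] _] := sum_qB w iK.
apply: le_trans h; rewrite big_ord_recr/= lerDr.
by have [/andP[]] := sum_qB w (ltnW iK).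
Qed.

Let eB i := fine (\int[P]_w (qB i w)%:E).

Let eBE i : (i < K)%N -> (\int[P]_w (qB i w)%:E = (eB i)%:E)%E.
Proof.
move=> iK; rewrite /eB fineK// ge0_fin_numE; last first.
  by apply: integral_ge0 => w _; rewrite lee_fin qB0.
apply: (@le_lt_trans _ _ th%:E); last exact: ltry.
apply: (@Ele_mono _ _ _ P (qB i) (fun=> th)) => //.
- exact: mqB.
- by move=> w; exact: qB0.
- by move=> w; exact: qB_th.
- exact: Ele_cst.
Qed.

(** One conditioning per step, on the sure event. Each new term costs six times its expected
    quadratic variation, a quantity that sums to at most [th] pathwise. *)
Let ES k : (k <= K)%N -> Ele P (fun w => hsnorm (S k w) ^+ 2) (\sum_(i < k) 6 * eB i).
Proof.
elim: k => [|k IH] kK.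
  rewrite big_ord0 /Ele; under eq_integral do rewrite /S big_ord0 hsnorm0 expr0n.
  exact: Ele_cst.
have /andP[k0 _] := rhoT (ltnW kK); have /andP[_ kT] := rhoT kK.
have kT' : rho k <= T by apply: le_trans kT; exact/ltW/inc.
have FT : F (rho k) setT.
  have kI : 0 <= rho k <= T by rewrite k0.
  have [s0 sC _] := filtration_sigma_algebra rcF kI.
  by have := sC _ s0; rewrite setD0.
have := @step_second_moment _ _ _ _ _ _ _ _ rcF wW _ _ k0 (inc kK) kT _ setT (S k) (B k)
  (\sum_(i < k.+1) 6 * eB i) FT (mS (ltnW kK)) (mB kK).
have iT (f : Omega -> R) : (fun w => \1_setT w * f w) = f.
  by apply/funext => w; rewrite indicT mul1r.
rewrite !iT.
have -> : (fun w => hsnorm (S k.+1 w) ^+ 2) =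
    (fun w => hsnorm (S k w + B k w *m (W (rho k.+1) w - W (rho k) w)) ^+ 2).
  by apply/funext => w; rewrite /S big_ord_recr.
apply; rewrite big_ord_recr/=.
apply: EleD.
- by apply: measurable_hsnorm2; exact: (Fmx_measurable rcF k0 kT' (mS (ltnW kK))).
- apply: measurable_funM; first exact: measurable_cst.
  by apply: measurable_hsnorm2; exact: (Fmx_measurable rcF k0 kT' (mB kK)).
- by move=> w; exact: sqr_ge0.
- move=> w; apply: mulr_ge0; last exact: sqr_ge0.
  by rewrite mulr_ge0// subr_ge0; exact/ltW/inc.
- exact: IH (ltnW kK).
- have := @EleZ _ _ _ P 6 (qB k) (eB k) _ (mqB kK) (fun w => qB0 w kK).
  have -> : (fun w => 6 * (rho k.+1 - rho k) * hsnorm (B k w) ^+ 2) = (fun w => 6 * qB k w).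
    by apply/funext => w; rewrite /qB mulrA.
  by apply=> //; rewrite /Ele eBE.
Qed.

Let sum_eB : \sum_(i < K) eB i <= th.
Proof.
rewrite -lee_fin -sumEFin.
under eq_bigr => i _ do rewrite -(eBE (ltn_ord i)).
rewrite -ge0_integral_sum//; last 2 first.
- by move=> i; exact/measurable_EFinP/mqB.
- by move=> i w _; rewrite lee_fin qB0.
under eq_integral do rewrite sumEFin.
apply: (@Ele_mono _ _ _ P (fun w => \sum_(i < K) qB i w) (fun=> th)) => //.
- by apply: measurable_sum => i; exact: mqB.
- by move=> w; have [/andP[]] := sum_qB w (leqnn K).
- by move=> w; have [/andP[]] := sum_qB w (leqnn K).
- exact: Ele_cst.
Qed.

(** Chebyshev's inequality is applied to the stopped sum, which has a second moment even if the
    original one has none; where [quad_var K] stays below [th], nothing was cut off. *)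
Lemma lenglart (e : R) : 0 < e -> exists D,
  [/\ measurable D, (P D <= P [set w | (th <= quad_var K w)%R] + (6 * th / e ^+ 2)%:E)%E &
    forall w, ~ D w ->
      hsnorm (\sum_(i < K) A i w *m (W (rho i.+1) w - W (rho i) w)) < e].
Proof.
move=> e0.
have /andP[K0 KT] := rhoT (leqnn K).
have mSK : measurable_fun setT (fun w => hsnorm (S K w) ^+ 2).
  by apply: measurable_hsnorm2; exact: (Fmx_measurable rcF K0 KT (mS (leqnn K))).
have mD1 : measurable [set w | th <= quad_var K w].
  rewrite -[X in measurable X]setTI (_ : [set w | _] = quad_var K @^-1` `[th, +oo[).
    exact: quad_var_measurableT.
  by apply/seteqP; split => w /=; rewrite in_itv/= andbT.
have mD2 : measurable [set w | e ^+ 2 <= hsnorm (S K w) ^+ 2].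
  rewrite -[X in measurable X]setTI
    (_ : [set w | _] = (fun w => hsnorm (S K w) ^+ 2) @^-1` `[e ^+ 2, +oo[).
    exact: mSK.
  by apply/seteqP; split => w /=; rewrite in_itv/= andbT.
exists ([set w | th <= quad_var K w] `|` [set w | e ^+ 2 <= hsnorm (S K w) ^+ 2]); split.
- exact: measurableU.
- apply: (le_trans (measureU2 _ _ _)) => //; rewrite leeD2l//.
  apply: Ele_markov => //; first by move=> w; exact: sqr_ge0.
    by rewrite exprn_gt0.
  apply: Ele_le (ES (leqnn K)); rewrite -mulr_sumr.
  by rewrite ler_wpM2l// sum_eB.
- move=> w /not_orP[/negP + /negP]; rewrite -!ltNge => qv Se.
  rewrite -(@ltr_pXn2r _ 2) ?nnegrE ?hsnorm_ge0 ?(ltW e0)//.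
  rewrite (_ : \sum_(i < K) _ = S K w)//; apply: eq_bigr => i _.
  congr (_ *m _); rewrite /B /cutoff (_ : quad_var i.+1 w < th = true) ?scale1r//.
  apply: le_lt_trans qv; rewrite /quad_var.
  rewrite -(big_mkord xpredT (fun i => (rho i.+1 - rho i) * hsnorm (A i w) ^+ 2)).
  rewrite -(big_mkord xpredT (fun i => (rho i.+1 - rho i) * hsnorm (A i w) ^+ 2)).
  rewrite [leRHS](big_cat_nat (n := i.+1))//= lerDl big_nat_cond.
  apply: sumr_ge0 => j /andP[/andP[_ jK] _].
  by rewrite mulr_ge0 ?sqr_ge0// subr_ge0 ltW// inc.
Qed.

End Lenglart.
End StochasticRiemann.

(** * Riemann sums of the Ito integral *)

Lemma ereal_cvg0_le (R : realType) (f : nat -> \bar R) (e : R) :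
  f n @[n --> \oo] --> 0%E -> 0 < e ->
  exists n0, forall n, (n0 <= n)%N -> (f n <= e%:E)%E.
Proof.
move=> /fine_cvgP[fin cvf] e0.
have : \forall n \near \oo, f n \is a fin_num /\ fine (f n) < e.
  apply: filterS2 fin _; first by move=> n /= h1 h2; split; [exact: h1|exact: h2].
  by have := @cvgr_lt R _ \oo _ _ _ cvf e; apply.
move=> [n0 _ Hn]; exists n0 => n n0n; have [fn le] := Hn n n0n.
by rewrite -(fineK fn) lee_fin ltW.
Qed.

Section RiemannIto.
Context (R : realType) (T : R) (disp : measure_display)
  (Omega : measurableType disp) (P : probability Omega R)
  (F : R -> set (set Omega)) (d m : nat) (W : R -> Omega -> 'cV[R]_m).
Hypothesis rcF : right_continuous_filtration T F.
Hypothesis wW : wiener_process T P F W.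

Lemma step_eval_Fmx (S : step_process R Omega d m) (rho : nat -> R) K :
  (forall k, (k < K)%N -> rho k < rho k.+1) ->
  (forall k, (k <= K)%N -> 0 <= rho k <= T) ->
  (forall i, (i <= step_size S)%N -> exists2 k, (k <= K)%N & rho k = step_time S i) ->
  (forall i, (i < step_size S)%N -> Fmx F (step_time S i) (step_val S i)) ->
  forall k, (k < K)%N -> Fmx F (rho k) (step_eval S (rho k.+1)).
Proof.
move=> inc rhoT sub mS k kK; rewrite /step_eval.
have -> : (fun w => \sum_(i < step_size S | step_time S i < rho k.+1 <= step_time S i.+1)
    step_val S i w) = (fun w => \sum_(i < step_size S)
    (if step_time S i < rho k.+1 <= step_time S i.+1 then step_val S i w else 0)).
  by apply/funext => w; rewrite big_mkcond.
apply: mx_measurable_sum => i _.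
case: (boolP (step_time S i < rho k.+1 <= step_time S i.+1)) => [/andP[lt _]|_]; last exact: mx_measurable_cst.
have [p pK Ep] := sub i (ltnW (ltn_ord i)).
have ltP := increasing_ltP inc.
have pk : (p <= k)%N by rewrite -ltnS -(ltP p k.+1)// Ep.
have /andP[p0 _] := rhoT p pK; have /andP[_ kT] := rhoT k (ltnW kK).
apply: (@Fmx_mono _ _ _ _ F rcF (rho p)) => //.
  by rewrite leNgt (ltP k p)// ?(ltnW kK)// -leqNgt.
by rewrite Ep; exact: mS.
Qed.

Lemma simple_time_in (S : step_process R Omega d m) u : simple_process F u S ->
  forall i, (i <= step_size S)%N -> 0 <= step_time S i <= u.
Proof.
move=> [S0 Su inc _ _] i iS; rewrite -S0 -Su.
have ltP := increasing_ltP inc.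
by rewrite !leNgt (ltP i 0%N)// (ltP (step_size S) i)// -!leqNgt leq0n iS.
Qed.

Lemma riemann_ito (H : R -> Omega -> 'M[R]_(d, m)) u (I : Omega -> 'cV[R]_d)
    (N0 : set Omega) (J : nat -> nat) (del : nat -> R) :
  0 < u <= T -> (forall t, 0 <= t <= T -> Fmx F t (H t)) ->
  measurable N0 -> P N0 = 0%E -> (forall w, ~ N0 w -> ucont u (fun v => H v w)) ->
  is_ito_integral P F W H u I ->
  (forall n, 0 < del n) -> (forall n, (J n)%:R * del n = u) ->
  (forall e, 0 < e -> exists n0, forall n, (n0 <= n)%N -> del n < e) ->
  forall e eta, 0 < e -> 0 < eta -> exists n0, forall n, (n0 <= n)%N ->
  exists B, [/\ measurable B, (P B <= eta%:E)%E & forall w, ~ B w ->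
    hsnorm (step_integral W (grid_process H (J n) (del n)) w - I w) <= e].
Proof.
move=> /andP[u0 uT] mH mN0 PN0 cH [S [simS cv1 cv2]] del0 Ju del_small e eta e0 eta0.
(* Both sums are written on a common refinement of the grid and the partition
   of a simple process close to [H]; Lenglart's inequality is applied to their
   difference. *)
have [th th0 thE] : exists2 th : R, 0 < th & 6 * (3 * th) / (e / 2) ^+ 2 = eta / 4.
  exists (eta / 4 * (e / 2) ^+ 2 / 18); last by field; rewrite gt_eqF.
  apply: divr_gt0; last exact: ltr0n.
  by apply: mulr_gt0; [exact: divr_gt0|apply: exprn_gt0; exact: divr_gt0].
have e20 : 0 < e / 2 by rewrite divr_gt0.
have eta4 : 0 < eta / 4 by rewrite divr_gt0.
have [mQ PQ] := cv1 th th0; have [mD PD] := cv2 (e / 2) e20.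
have [n1 /(_ _ (leq_maxl _ _))Hn1] := ereal_cvg0_le PQ eta4.
have [n2 /(_ (maxn n1 n2) (leq_maxr _ _))Hn2] := ereal_cvg0_le PD eta4.
have {}Hn1 := Hn1 n2.
(* One simple process, of index [p], is fixed for good; from here only the grid varies. *)
move: (maxn n1 n2) Hn1 Hn2 => p Hn1 Hn2.
pose Sp := S p; have simp : simple_process F u Sp by exact: simS.
pose s2 := [seq step_time Sp i | i <- iota 0 (step_size Sp).+1].
pose s1 n := [seq i%:R * del n | i <- iota 0 (J n).+1].
have /choice[rk Hrk] : forall n, exists rk : (nat -> R) * nat,
    [/\ (forall k, (k < rk.2)%N -> rk.1 k < rk.1 k.+1),
      (forall x, x \in s1 n -> exists2 k, (k <= rk.2)%N & rk.1 k = x),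
      (forall x, x \in s2 -> exists2 k, (k <= rk.2)%N & rk.1 k = x) &
      (s1 n != [::] -> forall k, (k <= rk.2)%N -> (rk.1 k \in s1 n) || (rk.1 k \in s2))].
  by move=> n; have [rho [K HK]] := merged_partition (s1 n) s2; exists (rho, K).
pose rho n := (rk n).1; pose K n := (rk n).2.
have inc n : forall k, (k < K n)%N -> rho n k < rho n k.+1 by have [] := Hrk n.
pose G n := grid_process H (J n) (del n).
have subG n i : (i <= step_size (G n))%N -> exists2 k, (k <= K n)%N & rho n k = step_time (G n) i.
  move=> iJ; have [_ + _ _] := Hrk n; apply; apply/mapP; exists i => //.
  by rewrite mem_iota/= add0n ltnS.
have subS n i : (i <= step_size Sp)%N -> exists2 k, (k <= K n)%N & rho n k = step_time Sp i.
  move=> iJ; have [_ _ + _] := Hrk n; apply; apply/mapP; exists i => //.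
  by rewrite mem_iota/= add0n ltnS.
have rhou n k : (k <= K n)%N -> 0 <= rho n k <= u.
  move=> kK; have [_ _ _ /(_ isT k kK)/orP[|] /mapP[i]] := Hrk n;
    rewrite mem_iota/= add0n ltnS => iJ; rewrite -/(rho n) => ->.
    by rewrite mulr_ge0 ?(ltW (del0 n))//= -(Ju n) ler_wpM2r ?(ltW (del0 n))// ler_nat.
  exact: simple_time_in.
have rhoT n k : (k <= K n)%N -> 0 <= rho n k <= T.
  by move=> /rhou/andP[-> ku]; exact: le_trans uT.
pose A n k w := step_eval (G n) (rho n k.+1) w - step_eval Sp (rho n k.+1) w.
have mA n k : (k < K n)%N -> Fmx F (rho n k) (A n k).
  move=> kK; apply: mx_measurableB.
    apply: (step_eval_Fmx (@inc n) (@rhoT n) (subG n)) => // i iJ /=; apply: mH.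
    by have [q qK Eq] := subG n i (ltnW iJ); have := rhoT n q qK; rewrite Eq.
  apply: (step_eval_Fmx (@inc n) (@rhoT n) (subS n)) => // i iS.
  have /andP[i0 iu] := simple_time_in simp (ltnW iS).
  have iI : 0 <= step_time Sp i <= T by rewrite i0 (le_trans iu).
  have /measurable_wrt_mx h := filtration_sigma_algebra rcF iI.
  by apply/h; have [_ _ _ + _] := simp; apply.
pose Q := [set w | (th%:E <= \int[lebesgue_measure]_(v in `[0%R, u])
            ((hsnorm (step_eval Sp v w - H v w) ^+ 2)%R)%:E)%E].
have mQp : measurable Q by exact: mQ.
have PQN : (P (Q `|` N0) <= (eta / 4)%:E)%E.
  rewrite -[eta / 4]addr0; apply: probability_setU_le => //.
  by rewrite PN0.
have small w : ~ (Q `|` N0) w -> exists n0, forall n, (n0 <= n)%N ->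
    quad_var (rho n) (A n) (K n) w < 3 * th.
  move=> /not_orP[nQ nN].
  have cHw := cH w nN.
  (* This accuracy contributes [th / 2], so the quadratic variation stays below
     [2 th + th / 2 < 3 th]. *)
  pose e' := Num.sqrt (th / (4 * u)).
  have e'0 : 0 < e' by rewrite sqrtr_gt0 divr_gt0// mulr_gt0.
  have e'2 : 2 * e' ^+ 2 * u = th / 2.
    rewrite sqr_sqrtr; first by field; rewrite gt_eqF.
    by apply: ltW; apply: divr_gt0 => //; exact: mulr_gt0.
  have [del' del'0 Hdel] := cHw e' e'0.
  have [n0 Hn0] := del_small del' del'0.
  exists n0 => n /Hn0 dn.
  have := @step_distance_le _ _ _ _ (G n) Sp (rho n) (K n) u e' (fun v => H v w) w
    (ltW u0) cHw (@inc n) (subG n) (subS n) (@rhou n) (ltW e'0)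
    (grid_near (del0 n) (Ju n) dn Hdel).
  rewrite e'2 -/(quad_var (rho n) (A n) (K n) w) => qle.
  rewrite -lte_fin; apply: (le_lt_trans qle).
  move: nQ => /negP; rewrite -ltNge.
  set I1 := (\int[_]_(_ in _) _)%E => I1th.
  apply: (@le_lt_trans _ _ (2%:E * th%:E + (th / 2)%:E)%E).
    by rewrite leeD2r// lee_wpmul2l// ltW.
  by rewrite -EFinM -EFinD lte_fin; lra.
have [n0 Hn0] := @eventually_small _ _ _ P (fun n => quad_var (rho n) (A n) (K n))
  (Q `|` N0) (3 * th) (eta / 4)
  (fun n => quad_var_measurableT rcF (@rhoT n) (@mA n) (leqnn _))
  (measurableU _ _ mQp mN0) small eta4.
exists n0 => n n0n; have [B [mB PB QB]] := Hn0 n n0n.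
have th30 : 0 <= 3 * th by rewrite mulr_ge0// ltW.
have [D [mDD PDD DD]] := lenglart rcF wW (@inc n) (@rhoT n) (@mA n) th30 e20.
exists (D `|` [set w | ((e / 2)%:E <= (hsnorm (step_integral W Sp w - I w))%:E)%E]); split.
- by apply: measurableU => //; exact: mD.
- rewrite (_ : eta = 3 * eta / 4 + eta / 4); last by lra.
  apply: probability_setU_le => //; first exact: mD.
  apply: (le_trans PDD).
  apply: (@le_trans _ _ ((eta / 4 + eta / 4)%:E + (6 * (3 * th) / (e / 2) ^+ 2)%:E)%E).
    rewrite leeD2r//; apply: (@le_trans _ _ (P B)).
      apply: le_measure; rewrite ?inE//; last first.
        move=> w /= Hw; apply: contrapT => /QB.
        by rewrite ltNge Hw.
      rewrite -[X in measurable X]setTI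
        (_ : [set w | _] = quad_var (rho n) (A n) (K n) @^-1` `[3 * th, +oo[).
        exact: (quad_var_measurableT rcF (@rhoT n) (@mA n) (leqnn _)).
      by apply/seteqP; split => w /=; rewrite in_itv/= andbT.
    by apply: (le_trans PB); rewrite EFinD leeD2r.
  rewrite -EFinD lee_fin thE.
  by lra.
- move=> w /not_orP[/DD AW /negP]; rewrite lee_fin -ltNge => SI.
  have Sinc i : (i < step_size Sp)%N -> step_time Sp i < step_time Sp i.+1.
    by have [_ _ + _ _] := simp; apply.
  have Ginc i : (i < step_size (G n))%N -> step_time (G n) i < step_time (G n) i.+1.
    by move=> _ /=; rewrite ltr_pM2r// ltr_nat.
  rewrite (_ : step_integral W (grid_process H (J n) (del n)) w - I w =
    (step_integral W (G n) w - step_integral W Sp w) + (step_integral W Sp w - I w)); last first.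
    by rewrite addrA subrK.
  apply: (le_trans (hsnormD _ _)).
  rewrite [e]splitr; apply: lerD; last exact: ltW.
  apply: ltW; apply: le_lt_trans AW.
  rewrite (step_integral_refine W w (@inc n) Ginc (subG n)).
  rewrite (step_integral_refine W w (@inc n) Sinc (subS n)).
  by rewrite -sumrB; under eq_bigr do rewrite -mulmxBl.
Qed.

End RiemannIto.

(** * Euler sums along the solution *)

(** The deviations need only lie inside small measurable events, so that the limit need not be
    measurable. *)
Definition cvg_prob (R : realType) (disp : measure_display)
    (Omega : measurableType disp) (P : probability Omega R) a c
    (f : nat -> Omega -> 'M[R]_(a, c)) (g : Omega -> 'M[R]_(a, c)) :=
  forall e eta, 0 < e -> 0 < eta -> exists n0, forall n, (n0 <= n)%N ->
  exists B, [/\ measurable B, (P B <= eta%:E)%E &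
    forall w, ~ B w -> hsnorm (f n w - g w) <= e].

Section EulerSum.
Context (R : realType) (T : R) (disp : measure_display)
  (Omega : measurableType disp) (P : probability Omega R)
  (F : R -> set (set Omega)) (d m : nat) (W : R -> Omega -> 'cV[R]_m).
Hypothesis rcF : right_continuous_filtration T F.
Hypothesis wW : wiener_process T P F W.
Context (b : R -> 'cV[R]_d -> 'cV[R]_d) (sigma : R -> 'cV[R]_d -> 'M[R]_(d, m))
  (C M kappa pp : R) (l : nat) (X : R -> Omega -> 'cV[R]_d).
Hypothesis H : sde_coefficients T C M kappa pp l b sigma.
Hypothesis lb : locally_lipschitz T b.
Hypothesis ls : locally_lipschitz T sigma.
Hypothesis sol : sde_solution T P F b sigma W X.

Lemma solution_ucont : exists N0, [/\ measurable N0, P N0 = 0%E &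
  forall w, ~ N0 w -> ucont T (fun t => X t w)].
Proof.
have [N0 [mN0 PN0 sub]] := solution_continuous sol.
exists N0; split => // w nN; apply: heine_mx; apply: contrapT => nc; apply: nN.
exact: sub.
Qed.

Lemma solution_Fmx t : 0 <= t -> t <= T -> Fmx F t (X t).
Proof. by move=> t0 tT; exact: (Fmx_adapted rcF t0 tT (solution_adapted sol)). Qed.

Lemma drift_Fmx t : 0 <= t -> t <= T -> Fmx F t (fun w => b t (X t w)).
Proof.
move=> t0 tT; have tI : 0 <= t <= T by rewrite t0.
exact: (Fmx_comp (b_borel H tI) (solution_Fmx t0 tT)).
Qed.

Lemma diffusion_Fmx t : 0 <= t -> t <= T -> Fmx F t (fun w => sigma t (X t w)).
Proof.
move=> t0 tT; have tI : 0 <= t <= T by rewrite t0.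
exact: (Fmx_comp (sigma_borel H tI) (solution_Fmx t0 tT)).
Qed.

(** The coefficients are evaluated at the solution and not at the sum itself: convergence is then a
    matter of Riemann sums and involves no stability. *)
Definition euler_sum (del : R) (j : nat) (w : Omega) : 'cV[R]_d :=
  X 0 w + \sum_(i < j) (del *: b (i%:R * del) (X (i%:R * del) w)
    + sigma (i%:R * del) (X (i%:R * del) w)
        *m (W (i.+1%:R * del) w - W (i%:R * del) w)).

Section Limit.
Variables (u : R) (J : nat -> nat) (del : nat -> R).
Hypothesis uT : 0 < u <= T.
Hypothesis del0 : forall n, 0 < del n.
Hypothesis Ju : forall n, (J n)%:R * del n = u.
Hypothesis del_small : forall e, 0 < e -> exists n0, forall n, (n0 <= n)%N -> del n < e.

Let gridT n i : (i <= J n)%N -> 0 <= i%:R * del n <= T.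
Proof.
move=> iJ; rewrite mulr_ge0 ?(ltW (del0 n))//=.
by case/andP: uT => _; apply: le_trans; rewrite -(Ju n) ler_wpM2r ?(ltW (del0 n))// ler_nat.
Qed.

Let dsum n w := \sum_(i < J n) del n *: b (i%:R * del n) (X (i%:R * del n) w).
Let dint w : 'cV[R]_d := \col_i \int[lebesgue_measure]_(v in `[0, u]) b v (X v w) i 0.

Lemma drift_sum_cvg w : ucont T (fun t => X t w) -> forall t, 0 < t ->
  exists n0, forall n, (n0 <= n)%N -> hsnorm (dsum n w - dint w) <= t.
Proof.
case/andP: uT => u0 uT' cX t t0.
have cb := ucont_sub uT' (ucont_lipschitz_comp lb cX).
have [N bN] := ucont_bounded cb.
have u1 : 0 < u * ((d * 1)%:R + 1) by rewrite mulr_gt0// ltr_wpDl.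
pose e := t / (u * ((d * 1)%:R + 1)).
have e0 : 0 < e by rewrite divr_gt0.
have [eta eta0 Heta] := cb e e0.
have [n0 Hn0] := del_small eta0.
exists n0 => n /Hn0 dn.
apply: (@le_trans _ _ ((d * 1)%:R * (e * u))).
  apply: hsnorm_le_entries => [|i j]; first by rewrite mulr_ge0// ltW.
  rewrite (ord1 j) /dsum /dint !mxE summxE.
  under eq_bigr do rewrite mxE.
  have := @riemann_sum_near R (fun v => b v (X v w) i 0) (J n) (del n) eta e N%:R.
  rewrite Ju; apply => //.
  - exact: ltW.
  - exact: (ucont_clamp_measurable (ltW u0) cb).
  - by move=> v vu; apply: (le_trans (hsnorm_entry _ _ _)); exact: bN.
  - move=> x y xu yu xy; have := Heta x y xu yu xy; apply: le_trans.
    by have := hsnorm_entry (b x (X x w) - b y (X y w)) i 0; rewrite !mxE.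
rewrite /e; move: (d * 1)%N => k.
have -> : k%:R * (t / (u * (k%:R + 1)) * u) = t * (k%:R / (k%:R + 1)).
  have k1 : k%:R + 1 != 0 :> R by rewrite gt_eqF// ltr_wpDl.
  by field; rewrite k1 gt_eqF.
rewrite ler_piMr ?(ltW t0)// ler_pdivrMr ?ltr_wpDl// mul1r lerDl.
exact: ler01.
Qed.

Lemma euler_sum_cvg : cvg_prob P (fun n => euler_sum (del n) (J n)) (X u).
Proof.
move=> e eta e0 eta0; case/andP: (uT) => u0 uT'.
have uI : 0 <= u <= T by rewrite (ltW u0).
have [N0 [mN0 PN0 cX]] := solution_ucont.
have [I [itoI [N1 [mN1 PN1 sub]]]] := solution_equation sol uI.
have e2 : 0 < e / 2 by rewrite divr_gt0.
have eta2 : 0 < eta / 2 by rewrite divr_gt0.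
have [n1 Hn1] := riemann_ito rcF wW (H := fun v w => sigma v (X v w)) uT
  (fun t tT => diffusion_Fmx (proj1 (andP tT)) (proj2 (andP tT))) mN0 PN0
  (fun w nN => ucont_sub uT' (ucont_lipschitz_comp ls (cX w nN))) itoI del0 Ju del_small e2 eta2.
have md n : mx_measurable (dsum n).
  apply: mx_measurable_sum => i _; apply: mx_measurableZ.
  have /andP[i0 iT] := gridT (ltnW (ltn_ord i)).
  exact: (Fmx_measurable rcF i0 iT (drift_Fmx i0 iT)).
have [n2 [B [mB PB HB]]] := mx_cvg_small P md mN0
  (fun w nN => drift_sum_cvg (cX w nN)) e2 eta2.
exists (maxn n1 n2) => n; rewrite geq_max => /andP[n1n n2n].
have [B' [mB' PB' HB']] := Hn1 n n1n.
exists (N1 `|` (B `|` B')); split.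
- by do 2 apply: measurableU => //.
- rewrite -[eta]add0r; apply: probability_setU_le => //; first exact: measurableU.
    by rewrite PN1.
  rewrite [eta]splitr; apply: probability_setU_le => //.
  by rewrite PN0 add0e in PB.
move=> w /not_orP[nN1 /not_orP[nB nB']].
have Xu : X u w = X 0 w + dint w + I w.
  by apply: contrapT => nX; apply: nN1; exact: sub.
have -> : euler_sum (del n) (J n) w - X u w = (dsum n w - dint w)
   + (step_integral W (grid_process (fun v w => sigma v (X v w)) (J n) (del n)) w - I w).
  rewrite Xu /euler_sum big_split/= /step_integral/= -/(dsum n w).
  set S := \sum_(_ < _) _.
  by rewrite -[_ + I w]addrA [- (X 0 w + _)]opprD addrACA subrr add0r opprD addrACA.
apply: (le_trans (hsnormD _ _)); rewrite [e]splitr; apply: lerD; first exact: HB.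
exact: HB'.
Qed.

End Limit.
End EulerSum.

(** * Fatou's lemma in probability *)

Section Limits.
Context (R : realType) d (S : measurableType d) (P : probability S R).

Lemma integral_indic_mul (A : set S) (f : S -> R) :
  (\int[P]_w (\1_A w * f w)%:E = \int[P]_(w in A) (f w)%:E)%E.
Proof.
rewrite [RHS]integral_mkcond; apply: eq_integral => w _.
by rewrite patchE indicE; case: ifP => _; rewrite ?mul1r ?mul0r.
Qed.

Lemma Ele_indic (A : set S) (c : R) : measurable A -> (P A <= c%:E)%E -> Ele P \1_A c.
Proof. by move=> mA Ac; rewrite /Ele integral_indic// setIT. Qed.

(** Monotone convergence; it removes a localisation once the bound [K] is the same for all
    events. *)
Lemma Ele_exhaust (A : nat -> set S) (N : set S) (f : S -> R) K :
  {homo A : n m / (n <= m)%N >-> (n <= m)%O} -> (forall n, measurable (A n)) ->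
  measurable N -> P N = 0%E -> ~` N `<=` \bigcup_n A n ->
  measurable_fun setT f -> (forall w, 0 <= f w) ->
  (forall n, Ele P (fun w => \1_(A n) w * f w) K) -> Ele P f K.
Proof.
move=> homA mA mN PN NA mf f0 AK.
have mE (D : set S) : measurable_fun D (fun w => (f w)%:E).
  by apply/measurable_EFinP; exact: measurable_funTS.
have mU : measurable (\bigcup_n A n) by exact: bigcup_measurable.
have cv := @ge0_nondecreasing_set_cvg_integral _ _ _ A (fun w => (f w)%:E) P homA mA
  (fun n => mE _) (fun n w _ => ltac:(by rewrite lee_fin)).
have UK : (\int[P]_(w in \bigcup_n A n) (f w)%:E <= K%:E)%E.
  rewrite -(cvg_lim _ cv)//; apply: lime_le; first by apply/cvg_ex; eexists; exact: cv.
  by apply: nearW => n; have := AK n; rewrite /Ele integral_indic_mul.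
rewrite /Ele; apply: le_trans UK.
rewrite (ge0_negligible_integral mN measurableT (mE _) _ PN)//; last first.
  by move=> w _; rewrite lee_fin.
apply: ge0_subset_integral => //.
- exact: measurableD.
- by move=> w _; rewrite lee_fin.
- by move=> w [_ /NA].
Qed.

Lemma cvg_prob_cst a c (g : S -> 'M[R]_(a, c)) : cvg_prob P (fun=> g) g.
Proof.
move=> e eta e0 eta0; exists 0%N => n _; exists set0; split => //.
  by rewrite measure0 lee_fin ltW.
by move=> w _; rewrite subrr hsnorm0 ltW.
Qed.

Lemma cvg_probB a c (f f' : nat -> S -> 'M[R]_(a, c)) g g' :
  cvg_prob P f g -> cvg_prob P f' g' ->
  cvg_prob P (fun n w => f n w - f' n w) (fun w => g w - g' w).
Proof.
move=> fg fg' e eta e0 eta0.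
have e2 : 0 < e / 2 by rewrite divr_gt0.
have eta2 : 0 < eta / 2 by rewrite divr_gt0.
have [n1 Hn1] := fg _ _ e2 eta2; have [n2 Hn2] := fg' _ _ e2 eta2.
exists (maxn n1 n2) => n; rewrite geq_max => /andP[/Hn1[B [mB PB HB]] /Hn2[B' [mB' PB' HB']]].
exists (B `|` B'); split; first exact: measurableU.
  by rewrite [eta]splitr; exact: probability_setU_le.
move=> w /not_orP[/HB h1 /HB' h2].
rewrite (_ : f n w - f' n w - (g w - g' w) = (f n w - g w) - (f' n w - g' w)); last first.
  by rewrite !opprB [LHS]addrACA [RHS]addrACA [- f' n w - _]addrC.
apply: (le_trans (hsnormD _ _)); rewrite hsnormN [e]splitr; exact: lerD.
Qed.

(** The limit is truncated at norm [L]. Off a small event, Young's inequality with weight [th]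
    passes from [f n] to [g]; on that event the truncation bounds the integrand by [L^2]. Monotone
    convergence then removes [L]. *)
Lemma Ele_cvg_prob a c (f : nat -> S -> 'M[R]_(a, c)) g (G : set S) K :
  (forall n, mx_measurable (f n)) -> mx_measurable g -> measurable G -> 0 <= K ->
  cvg_prob P f g ->
  (forall eps, 0 < eps -> exists n0, forall n, (n0 <= n)%N ->
     Ele P (fun w => \1_G w * hsnorm (f n w) ^+ 2) (K + eps)) ->
  Ele P (fun w => \1_G w * hsnorm (g w) ^+ 2) K.
Proof.
move=> mf mg mG K0 fg fK.
have mG1 : measurable_fun setT (\1_G : S -> R) by exact: measurable_indic.
have mg2 := measurable_hsnorm2 mg.
have mGg : measurable_fun setT (fun w => \1_G w * hsnorm (g w) ^+ 2).
  exact: measurable_funM.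
have i0 (A : set S) w : 0 <= \1_A w :> R by rewrite indicE.
have i1 (A : set S) w : \1_A w <= 1 :> R by rewrite indicE; case: (_ \in _).
pose A (L : nat) := [set w | hsnorm (g w) <= L%:R].
have mA L : measurable (A L) by exact: (measurable_hsnorm_le _ mg).
apply: (@Ele_exhaust A set0) => //.
- move=> i j ij; apply/subsetPset => w; rewrite /A/= => /le_trans; apply.
  by rewrite ler_nat.
- move=> w _; exists (Num.truncn (hsnorm (g w))).+1 => //.
  exact/ltW/Num.Theory.truncnS_gt.
- by move=> w; rewrite mulr_ge0// sqr_ge0.
move=> L; apply/lee_addgt0Pr => s s0.
(* Four errors arise: from [th * K], from the slack [e1] in the hypothesis, from the distance [e],
   and from the bad event of probability [eta]. Each is made at most [s / 4]. *)
pose th := s / (4 * (K + 1)); pose e1 := s / (4 * (1 + th)).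
pose e := Num.sqrt (s / (4 * (1 + th^-1))); pose eta := s / (4 * (L%:R ^+ 2 + 1)).
have th0 : 0 < th by rewrite divr_gt0// mulr_gt0// ltr_wpDl.
have e10 : 0 < e1 by rewrite divr_gt0// mulr_gt0// addr_gt0.
have thV0 : 0 < 1 + th^-1 by rewrite addr_gt0// invr_gt0.
have e0 : 0 < e by rewrite sqrtr_gt0 divr_gt0// mulr_gt0.
have L0 : 0 < L%:R ^+ 2 + 1 :> R by rewrite ltr_wpDl// sqr_ge0.
have eta0 : 0 < eta by rewrite divr_gt0// mulr_gt0.
have [n1 Hn1] := fK e1 e10; have [n2 Hn2] := fg e eta e0 eta0.
have {}Hn1 := Hn1 (maxn n1 n2) (leq_maxl _ _).
have [B [mB PB HB]] := Hn2 (maxn n1 n2) (leq_maxr _ _).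
move: (maxn n1 n2) Hn1 HB => n Hn1 HB.
have mfn := measurable_hsnorm2 (mf n).
have mGf : measurable_fun setT (fun w => \1_G w * hsnorm (f n w) ^+ 2).
  exact: measurable_funM.
have m1 : measurable_fun setT (fun w => (1 + th) * (\1_G w * hsnorm (f n w) ^+ 2)).
  by apply: measurable_funM => //; exact: measurable_cst.
have m3 : measurable_fun setT (fun w => L%:R ^+ 2 * \1_B w : R).
  by apply: measurable_funM; [exact: measurable_cst|exact: measurable_indic].
have m2 : measurable_fun setT (fun w => (1 + th^-1) * e ^+ 2 + L%:R ^+ 2 * \1_B w : R).
  by apply: measurable_funD => //; exact: measurable_cst.
have th10 : 0 <= 1 + th by rewrite addr_ge0// ltW.
have ve0 : 0 <= (1 + th^-1) * e ^+ 2 by rewrite mulr_ge0 ?sqr_ge0// ltW.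
apply: (@Ele_mono _ _ _ _ _ (fun w => (1 + th) * (\1_G w * hsnorm (f n w) ^+ 2)
   + ((1 + th^-1) * e ^+ 2 + L%:R ^+ 2 * \1_B w))).
- by apply: measurable_funM => //; exact: measurable_indic.
- exact: measurable_funD.
- by move=> w; do 2 apply: mulr_ge0 => //; exact: sqr_ge0.
- move=> w; have [Bw|nB] := pselect (B w).
    rewrite [\1_B w]indicE mem_set//= mulr1.
    apply: (@le_trans _ _ (L%:R ^+ 2)); last first.
      rewrite addrA lerDr addr_ge0//; do 2 apply: mulr_ge0 => //; exact: sqr_ge0.
    rewrite [\1_(A L) w]indicE; case: (boolP (w \in A L)) => [|_]; last first.
      by rewrite mul0r sqr_ge0.
    rewrite inE /A/= mul1r => gL.
    apply: (@le_trans _ _ (hsnorm (g w) ^+ 2)); first by rewrite ler_piMl// sqr_ge0.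
    by apply: lerXn2r; rewrite ?nnegrE ?hsnorm_ge0.
  apply: (@le_trans _ _ (\1_G w * hsnorm (g w) ^+ 2)).
    by rewrite ler_piMl// mulr_ge0// sqr_ge0.
  have h := HB w nB.
  have : hsnorm (g w) ^+ 2 <= (1 + th) * hsnorm (f n w) ^+ 2 + (1 + th^-1) * e ^+ 2.
    have := sqr_hsnormD_eps (f n w) (g w - f n w) th0; rewrite addrC subrK => /le_trans; apply.
    rewrite lerD2l; apply: ler_wpM2l; first exact: ltW.
    by rewrite hsnormBC; apply: lerXn2r; rewrite ?nnegrE ?hsnorm_ge0// ltW.
  move=> hg; have := ler_wpM2l (i0 G w) hg => /le_trans; apply.
  rewrite mulrDr mulrCA lerD2l; apply: (@le_trans _ _ ((1 + th^-1) * e ^+ 2)).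
    by rewrite ler_piMl.
  by rewrite lerDl mulr_ge0// sqr_ge0.
have -> : K + s = (1 + th) * (K + e1) + ((1 + th^-1) * e ^+ 2 + L%:R ^+ 2 * eta)
   + (s / 4 * (1 / (K + 1)) + s / 4 * (1 / (L%:R ^+ 2 + 1))).
  rewrite sqr_sqrtr ?divr_ge0 ?mulr_ge0 ?(ltW s0) ?(ltW thV0)//.
  have -> : (1 + th^-1) * (s / (4 * (1 + th^-1))) = s / 4.
    by move: (1 + th^-1) thV0 => v v0; field; rewrite gt_eqF.
  have -> : (1 + th) * (K + e1) = (1 + th) * K + s / 4.
    by rewrite /e1; field; rewrite gt_eqF// addr_gt0.
  rewrite /eta /th; field; rewrite !gt_eqF//; last by rewrite ltr_wpDl.
apply: (@Ele_le _ _ _ _ _ ((1 + th) * (K + e1) + ((1 + th^-1) * e ^+ 2 + L%:R ^+ 2 * eta))).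
  have K10 : 0 <= K + 1 by rewrite addr_ge0.
  rewrite lerDl; apply: addr_ge0; apply: mulr_ge0; apply: divr_ge0 => //; exact: ltW.
apply: EleD => //.
- by move=> w; do 2 apply: mulr_ge0 => //; exact: sqr_ge0.
- by move=> w; rewrite addr_ge0// mulr_ge0// sqr_ge0.
- by apply: EleZ => // w; rewrite mulr_ge0// sqr_ge0.
- apply: EleD => //.
  + exact: Ele_cst.
  + apply: EleZ; [exact: sqr_ge0|exact: measurable_indic|by []|exact: Ele_indic].
Qed.

End Limits.

(** The induction step of a discrete Gronwall inequality with growth factor [1 + K * del] and source
    [del * c]. *)
Lemma gronwall_step (R : realType) (K del c a0 : R) j :
  0 <= K -> 0 <= del -> 0 <= c -> 0 <= a0 ->
  (1 + K * del) * (expR (K * (j%:R * del)) * (a0 + j%:R * del * c)) + del * c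
    <= expR (K * (j.+1%:R * del)) * (a0 + j.+1%:R * del * c).
Proof.
move=> K0 del0 c0 a00.
have jS : j.+1%:R * del = j%:R * del + del by rewrite -natr1 mulrDl mul1r.
have j0 : 0 <= j%:R * del by rewrite mulr_ge0.
rewrite jS; set t := j%:R * del in j0 *.
have t0 : 0 <= a0 + t * c by rewrite addr_ge0// mulr_ge0.
have -> : a0 + (t + del) * c = (a0 + t * c) + del * c by ring.
rewrite [leRHS]mulrDr; apply: lerD.
  rewrite mulrA; apply: ler_wpM2r => //.
  rewrite mulrDr expRD mulrC; apply: ler_wpM2l; first exact: expR_ge0.
  exact: expR_ge1Dx.
by rewrite ler_peMl ?mulr_ge0// -expR0 ler_expR mulr_ge0// addr_ge0.
Qed.

(** * Localised second moment bounds *)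

Section LocalEuler.
Context (R : realType) (T : R) (disp : measure_display)
  (Omega : measurableType disp) (P : probability Omega R)
  (F : R -> set (set Omega)) (m : nat) (W : R -> Omega -> 'cV[R]_m).
Hypothesis rcF : right_continuous_filtration T F.
Hypothesis wW : wiener_process T P F W.

Lemma indic_mul_ge0 (G : set Omega) (f : Omega -> R) : (forall w, 0 <= f w) ->
  forall w, 0 <= \1_G w * f w.
Proof. by move=> f0 w; rewrite mulr_ge0// indicE. Qed.

Lemma indic_mul_le (G G' : set Omega) (f : Omega -> R) : G' `<=` G ->
  (forall w, 0 <= f w) -> forall w, \1_G' w * f w <= \1_G w * f w.
Proof.
move=> GG f0 w; apply: ler_wpM2r => //; rewrite !indicE.
have [|] := boolP (w \in G'); last by case: (_ \in _).
by rewrite inE => /GG Gw; rewrite mem_set.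
Qed.

Lemma indic_hsnorm2_measurable (G : set Omega) a c (Y : Omega -> 'M[R]_(a, c)) :
  measurable G -> mx_measurable Y ->
  measurable_fun setT (fun w => \1_G w * hsnorm (Y w) ^+ 2).
Proof.
move=> mG mY; apply: measurable_funM; first exact: measurable_indic.
exact: measurable_hsnorm2.
Qed.

(** A second moment estimate for a recursion with arbitrary adapted coefficients and no structure.
    At each step the indicator is first relaxed to the event known at the start of the step, then
    the increment is integrated. It serves for the increments of one Euler sum and for the
    difference of two. *)
Lemma euler_local n L (del : R) (tau : nat -> R) (G : nat -> set Omega)
    (e beta : nat -> Omega -> 'cV[R]_n) (alpha : nat -> Omega -> 'M[R]_(n, m))
    (a0 p q : R) :
  0 < del <= 1 -> 0 <= a0 -> 0 <= p -> 0 <= q ->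
  (forall i, (i < L)%N -> tau i.+1 = tau i + del) ->
  (forall i, (i <= L)%N -> 0 <= tau i <= T) ->
  (forall i, (i <= L)%N -> F (tau i) (G i)) ->
  (forall i, (i < L)%N -> G i.+1 `<=` G i) ->
  Fmx F (tau 0%N) (e 0%N) ->
  (forall i, (i < L)%N -> Fmx F (tau i) (beta i)) ->
  (forall i, (i < L)%N -> Fmx F (tau i) (alpha i)) ->
  (forall i w, (i < L)%N -> e i.+1 w = e i w + del *: beta i w
     + alpha i w *m (W (tau i.+1) w - W (tau i) w)) ->
  Ele P (fun w => \1_(G 0%N) w * hsnorm (e 0%N w) ^+ 2) a0 ->
  (forall i, (i < L)%N -> Ele P (fun w => \1_(G i) w * hsnorm (beta i w) ^+ 2) p) ->
  (forall i, (i < L)%N -> Ele P (fun w => \1_(G i) w * hsnorm (alpha i w) ^+ 2) q) ->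
  Ele P (fun w => \1_(G L) w * hsnorm (e L w) ^+ 2)
    (expR (L%:R * del) * (a0 + L%:R * del * (2 * p + 6 * q))).
Proof.
move=> /andP[del0 del1] a00 p0 q0 tauS tauT FG subG me0 mb ma eS E0 Eb Ea.
have tl i : (i < L)%N -> tau i <= tau i.+1 by move=> iL; rewrite tauS// lerDl ltW.
have me i : (i <= L)%N -> Fmx F (tau i) (e i).
  elim: i => [//|i IH] iL; have /andP[i0 _] := tauT i (ltnW iL).
  have /andP[_ iT] := tauT _ iL.
  have up a c (Y : Omega -> 'M[R]_(a, c)) : Fmx F (tau i) Y -> Fmx F (tau i.+1) Y.
    exact: (Fmx_mono rcF i0 (tl _ iL) iT).
  rewrite (_ : e i.+1 = fun w => e i w + del *: beta i w
     + alpha i w *m (W (tau i.+1) w - W (tau i) w)); last by apply/funext => w; exact: eS.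
  apply: mx_measurableD.
    apply: mx_measurableD; first by apply: up; exact: IH (ltnW iL).
    by apply: mx_measurableZ; apply: up; exact: mb.
  apply: mx_measurableM; first by apply: up; exact: ma.
  exact: (increment_measurable rcF wW i0 (tl _ iL) iT).
have mT i a c (Y : Omega -> 'M[R]_(a, c)) : (i <= L)%N -> Fmx F (tau i) Y -> mx_measurable Y.
  by move=> /tauT/andP[i0 iT]; exact: (Fmx_measurable rcF).
have mG i : (i <= L)%N -> measurable (G i).
  by move=> iL; have /andP[i0 iT] := tauT i iL; exact: (Fset_measurable rcF i0 iT (FG i iL)).
have c0 : 0 <= 2 * p + 6 * q by rewrite addr_ge0// mulr_ge0.
suff key i : (i <= L)%N -> Ele P (fun w => \1_(G i) w * hsnorm (e i w) ^+ 2)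
    (expR (1 * (i%:R * del)) * (a0 + i%:R * del * (2 * p + 6 * q))).
  by have := key L (leqnn L); rewrite mul1r.
elim: i => [|i IH] iL.
  by rewrite mul0r mulr0 expR0 mul1r mul0r addr0.
apply: (Ele_le (gronwall_step i (@ler01 R) (ltW del0) c0 a00)); rewrite [1 * del]mul1r.
set A := expR _ * _; have {}IH : Ele P (fun w => \1_(G i) w * hsnorm (e i w) ^+ 2) A by exact: IH (ltnW iL).
have /andP[i0 _] := tauT i (ltnW iL); have /andP[_ iT] := tauT _ iL.
have ilt : tau i < tau i.+1 by rewrite tauS// ltrDl.
have mu : Fmx F (tau i) (fun w => e i w + del *: beta i w).
  by apply: mx_measurableD; [exact: me (ltnW iL)|apply: mx_measurableZ; exact: mb].
have mstep : mx_measurable (fun w => e i w + del *: beta i w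
     + alpha i w *m (W (tau i.+1) w - W (tau i) w)).
  have := mT _ _ _ _ iL (me _ iL); congr mx_measurable.
  by apply/funext => w; exact: eS.
apply: (@Ele_mono _ _ _ _ _ (fun w => \1_(G i) w * hsnorm (e i w + del *: beta i w
     + alpha i w *m (W (tau i.+1) w - W (tau i) w)) ^+ 2)).
- exact: indic_hsnorm2_measurable (mG _ iL) (mT _ _ _ _ iL (me _ iL)).
- exact: indic_hsnorm2_measurable (mG _ (ltnW iL)) mstep.
- by apply: indic_mul_ge0 => w; exact: sqr_ge0.
- by move=> w; rewrite -eS//; exact: (@indic_mul_le (G i) (G i.+1)
    (fun w => hsnorm (e i.+1 w) ^+ 2) (subG i iL) (fun v => sqr_ge0 _)).
apply: (step_second_moment rcF wW i0 ilt iT (FG _ (ltnW iL)) mu (ma _ iL)).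
have -> : tau i.+1 - tau i = del by rewrite tauS// addrC addKr.
have iL' := ltnW iL.
have m1 := indic_hsnorm2_measurable (mG _ iL') (mT _ _ _ _ iL' (me _ iL')).
have m2 := indic_hsnorm2_measurable (mG _ iL') (mT _ _ _ _ iL' (mb _ iL)).
have m3 := indic_hsnorm2_measurable (mG _ iL') (mT _ _ _ _ iL' (ma _ iL)).
have mZ (k : R) (f : Omega -> R) : measurable_fun setT f -> measurable_fun setT (fun w => k * f w).
  by move=> mf; apply: measurable_funM => //; exact: measurable_cst.
have f0 a c (Y : Omega -> 'M[R]_(a, c)) w : 0 <= \1_(G i) w * hsnorm (Y w) ^+ 2.
  by move: w; apply: indic_mul_ge0 => v; exact: sqr_ge0.
have d0 := ltW del0.
have -> : (1 + del) * A + del * (2 * p + 6 * q) =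
  (1 + del) * A + (2 * del * p + 6 * del * q) by ring.
apply: (@Ele_mono _ _ _ _ _ (fun w => (1 + del) * (\1_(G i) w * hsnorm (e i w) ^+ 2)
   + (2 * del * (\1_(G i) w * hsnorm (beta i w) ^+ 2)
      + 6 * del * (\1_(G i) w * hsnorm (alpha i w) ^+ 2)))).
- apply: measurable_funM; first exact: measurable_indic (mG _ iL').
  apply: measurable_funD; first exact: measurable_hsnorm2 (mT _ _ _ _ iL' mu).
  by apply: mZ; exact: measurable_hsnorm2 (mT _ _ _ _ iL' (ma _ iL)).
- by apply: measurable_funD; [exact: mZ|apply: measurable_funD; exact: mZ].
- apply: indic_mul_ge0 => w; apply: addr_ge0; first exact: sqr_ge0.
  by apply: mulr_ge0; [exact: mulr_ge0|exact: sqr_ge0].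
- move=> w; rewrite !(mulrCA _ (\1_(G i) w)) -!mulrDr; apply: ler_wpM2l; first by rewrite indicE.
  rewrite [leRHS]addrA lerD2r.
  (* With weight [del] the drift gets the factor [(1 + 1 / del) del^2], at most [2 del] as
     [del <= 1]. *)
  apply: (le_trans (sqr_hsnormD_eps _ _ del0)); rewrite lerD2l hsnormZ exprMn mulrA.
  apply: ler_wpM2r; first exact: sqr_ge0.
  rewrite ger0_norm// mulrDl mul1r expr2 mulrA mulVf ?gt_eqF// mul1r.
  by have := ler_wpM2l d0 del1; rewrite mulr1 => ?; lra.
apply: EleD.
- exact: mZ.
- by apply: measurable_funD; exact: mZ.
- by move=> w; apply: mulr_ge0; [exact: addr_ge0|exact: f0].
- by move=> w; apply: addr_ge0; apply: mulr_ge0; rewrite ?f0//; exact: mulr_ge0.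
- by apply: EleZ => //; rewrite addr_ge0.
- apply: EleD; [exact: mZ|exact: mZ|by move=> w; apply: mulr_ge0; [exact: mulr_ge0|exact: f0]
    |by move=> w; apply: mulr_ge0; [exact: mulr_ge0|exact: f0]| |].
    by apply: EleZ => //; [rewrite mulr_ge0|exact: Eb].
  by apply: EleZ => //; [rewrite mulr_ge0|exact: Ea].
Qed.

End LocalEuler.

(** * Euler sums on dyadic grids *)

Section Localised.
Context (R : realType) (T : R) (disp : measure_display)
  (Omega : measurableType disp) (P : probability Omega R)
  (F : R -> set (set Omega)) (d m : nat) (W : R -> Omega -> 'cV[R]_m).
Hypothesis rcF : right_continuous_filtration T F.
Hypothesis wW : wiener_process T P F W.
Context (b : R -> 'cV[R]_d -> 'cV[R]_d) (sigma : R -> 'cV[R]_d -> 'M[R]_(d, m))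
  (C M kappa pp : R) (l : nat) (X : R -> Omega -> 'cV[R]_d).
Hypothesis H : sde_coefficients T C M kappa pp l b sigma.
Hypothesis lb : locally_lipschitz T b.
Hypothesis ls : locally_lipschitz T sigma.
Hypothesis sol : sde_solution T P F b sigma W X.
Variable h : R.
Hypothesis h01 : 0 < h <= 1.

Let h0 : 0 < h. Proof. by case/andP: h01. Qed.

Definition dyadic_step (n : nat) : R := h / 2 ^+ n.
Local Notation dy := dyadic_step.

Lemma dyadic_gt0 n : 0 < dy n.
Proof. by rewrite divr_gt0// exprn_gt0. Qed.

Lemma dyadic_ge0 n : 0 <= dy n. Proof. exact/ltW/dyadic_gt0. Qed.

Lemma dyadic_le1 n : dy n <= 1.
Proof.
case/andP: h01 => _ h1; rewrite ler_pdivrMr ?exprn_gt0// mul1r (le_trans h1)//.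
by rewrite exprn_ege1// ler1n.
Qed.

Lemma dyadic_refine n p j : (j * 2 ^ p)%:R * dy (n + p) = j%:R * dy n.
Proof.
rewrite /dyadic_step exprD natrM natrX; field.
by rewrite !expf_eq0 pnatr_eq0 !andbF.
Qed.

Lemma dyadic_small n e : 0 < e -> exists p0, forall p, (p0 <= p)%N -> dy (n + p) < e.
Proof.
move=> e0; exists (Num.truncn (h / e)).+1 => p pp0.
rewrite /dyadic_step ltr_pdivrMr ?exprn_gt0// mulrC -ltr_pdivrMr//.
apply: (lt_le_trans (Num.Theory.truncnS_gt _)); rewrite -natrX ler_nat.
by apply: (leq_trans pp0); apply: (leq_trans (leq_addl n p)); exact/ltnW/ltn_expl.
Qed.

Lemma grid_le n i j : (i <= j)%N -> i%:R * dy n <= j%:R * dy n.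
Proof. by move=> ij; rewrite ler_wpM2r ?dyadic_ge0// ler_nat. Qed.

Lemma grid_ge0 n i : 0 <= i%:R * dy n.
Proof. by rewrite mulr_ge0// dyadic_ge0. Qed.

(* Only the dyadic times before [s] are constrained, so that the event belongs
   to [F s]. *)
Definition good (N : nat) (s : R) : set Omega :=
  [set w | forall n j, j%:R * dy n <= s -> hsnorm (X (j%:R * dy n) w) <= N%:R].

Lemma good_sub N s t : s <= t -> good N t `<=` good N s.
Proof. by move=> st w gw n j js; apply: gw; exact: le_trans st. Qed.

Lemma good_mono s : {homo (fun N => good N s) : n p / (n <= p)%N >-> (n <= p)%O}.
Proof.
move=> i j ij; apply/subsetPset => w gw n k ks; apply: (le_trans (gw n k ks)).
by rewrite ler_nat.
Qed.

Lemma good_F N s : 0 <= s -> s <= T -> F s (good N s).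
Proof.
move=> s0 sT; have sI : 0 <= s <= T by rewrite s0.
have sG := filtration_sigma_algebra rcF sI.
rewrite -(sigma_algebra_id sG).
have -> : good N s = \bigcap_n \bigcap_j
   (if j%:R * dy n <= s then [set w | hsnorm (X (j%:R * dy n) w) <= N%:R] else setT).
  apply/seteqP; split => w gw.
    by move=> n _ j _; case: ifP => // js; exact: gw.
  by move=> n j js; have := gw n I j I; rewrite js.
apply: (@bigcapT_measurable _ (g_sigma_algebraType (F s))) => n.
apply: (@bigcapT_measurable _ (g_sigma_algebraType (F s))) => j.
case: ifPn => [js|_]; last exact: (@measurableT _ (g_sigma_algebraType (F s))).
have j0 := grid_ge0 n j.
apply: measurable_hsnorm_le.
apply: (Fmx_mono rcF j0 js sT); apply: (solution_Fmx rcF sol j0).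
exact: le_trans sT.
Qed.

Lemma good_exhaust s : s <= T ->
  exists N0, [/\ measurable N0, P N0 = 0%E & ~` N0 `<=` \bigcup_N good N s].
Proof.
move=> sT; have [N0 [mN0 PN0 cX]] := solution_ucont sol.
exists N0; split => // w /cX/ucont_bounded[N bN]; exists N => // n j js.
by apply: bN; rewrite grid_ge0 (le_trans js).
Qed.

Let jN (N : nat) : R := 1 + N%:R ^+ 2.

Let jap_jN N (x : 'cV[R]_d) k : hsnorm x <= N%:R -> jap x ^+ k <= jN N ^+ k.
Proof.
move=> xN; apply: lerXn2r; rewrite ?nnegrE ?jap_ge0 ?addr_ge0 ?sqr_ge0//.
by rewrite lerD2l; apply: lerXn2r; rewrite ?nnegrE ?hsnorm_ge0.
Qed.

Let jN0 N k : 0 <= jN N ^+ k.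
Proof. by rewrite exprn_ge0// addr_ge0// sqr_ge0. Qed.

Definition coef_bound N : R := (growth_const C M * jN N ^+ l.+1) ^+ 2.

Lemma coef_bound_ge0 N : 0 <= coef_bound N. Proof. exact: sqr_ge0. Qed.

Lemma drift_bound N t x : 0 <= t <= T -> hsnorm x <= N%:R ->
  hsnorm (b t x) ^+ 2 <= coef_bound N.
Proof.
move=> tT xN; have g0 := growth_const_ge0 H.
apply: lerXn2r; rewrite ?nnegrE ?hsnorm_ge0// ?mulr_ge0//.
apply: (le_trans (b_growth_jap H x tT)); apply: ler_wpM2l => //; exact: jap_jN.
Qed.

Lemma diffusion_bound N t x : 0 <= t <= T -> hsnorm x <= N%:R ->
  hsnorm (sigma t x) ^+ 2 <= coef_bound N.
Proof.
move=> tT xN; have g0 := growth_const_ge0 H.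
apply: lerXn2r; rewrite ?nnegrE ?hsnorm_ge0// ?mulr_ge0//.
apply: (le_trans (s_growth_jap H x tT)); apply: ler_wpM2l => //; exact: jap_jN.
Qed.

Let c1 N : R := 8 * C ^+ 2 * jN N ^+ l.+1 ^+ 2.
Let c2 N : R := 32 * C ^+ 2 * jN N ^+ l ^+ 2.

Let c1_ge0 N : 0 <= c1 N. Proof. by rewrite mulr_ge0 ?sqr_ge0// mulr_ge0 ?sqr_ge0. Qed.
Let c2_ge0 N : 0 <= c2 N. Proof. by rewrite mulr_ge0 ?sqr_ge0// mulr_ge0 ?sqr_ge0. Qed.

Let lip_bound (n p : nat) (f : R -> 'cV[R]_d -> 'M[R]_(n, p)) N s t x y :
  hsnorm (f s x - f t x) <= 2 * C * jap x ^+ l.+1 * `|s - t| ->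
  hsnorm (f t x - f t y) <= 2 * C * (jap x ^+ l + jap y ^+ l) * hsnorm (x - y) ->
  hsnorm x <= N%:R -> hsnorm y <= N%:R ->
  hsnorm (f s x - f t y) ^+ 2 <= c1 N * (s - t) ^+ 2 + c2 N * hsnorm (x - y) ^+ 2.
Proof.
move=> f1 f2 xN yN; have C0 := ltW (coef_C H).
have -> : f s x - f t y = (f s x - f t x) + (f t x - f t y) by rewrite addrA subrK.
apply: (le_trans (sqr_hsnormD_le _ _)); rewrite mulrDr; apply: lerD.
  have : hsnorm (f s x - f t x) <= 2 * C * jN N ^+ l.+1 * `|s - t|.
    apply: (le_trans f1); apply: ler_wpM2r => //; apply: ler_wpM2l; first by rewrite mulr_ge0.
    exact: jap_jN.
  move=> /(lerXn2r 2); rewrite !nnegrE hsnorm_ge0 !mulr_ge0// => /(_ isT isT).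
  by rewrite !exprMn real_normK ?num_real// /c1 => h1; lra.
have : hsnorm (f t x - f t y) <= 4 * C * jN N ^+ l * hsnorm (x - y).
  apply: (le_trans f2); apply: ler_wpM2r; first exact: hsnorm_ge0.
  have h1 := jap_jN l xN; have h2 := jap_jN l yN.
  have -> : 4 * C * jN N ^+ l = 2 * C * (jN N ^+ l + jN N ^+ l) by ring.
  by apply: ler_wpM2l; [exact: mulr_ge0|exact: lerD].
move=> /(lerXn2r 2); rewrite !nnegrE !hsnorm_ge0 !mulr_ge0 ?hsnorm_ge0// => /(_ isT isT).
by rewrite !exprMn /c2 => h1; lra.
Qed.

Lemma drift_lip N s t x y : 0 <= s <= T -> 0 <= t <= T ->
  hsnorm x <= N%:R -> hsnorm y <= N%:R ->
  hsnorm (b s x - b t y) ^+ 2 <= c1 N * (s - t) ^+ 2 + c2 N * hsnorm (x - y) ^+ 2.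
Proof.
by move=> sT tT; apply: lip_bound; [exact: (b_time_jap H)|exact: (b_lip_jap H)].
Qed.

Lemma diffusion_lip N s t x y : 0 <= s <= T -> 0 <= t <= T ->
  hsnorm x <= N%:R -> hsnorm y <= N%:R ->
  hsnorm (sigma s x - sigma t y) ^+ 2 <= c1 N * (s - t) ^+ 2 + c2 N * hsnorm (x - y) ^+ 2.
Proof.
by move=> sT tT; apply: lip_bound; [exact: (s_time_jap H)|exact: (s_lip_jap H)].
Qed.

Local Notation euler := (euler_sum W b sigma X).

Lemma dyadic_euler_cvg n j : j%:R * dy n <= T ->
  cvg_prob P (fun p => euler (dy (n + p)) (j * 2 ^ p)) (X (j%:R * dy n)).
Proof.
(* Convergence of Riemann sums is available on intervals of positive length only; at time 0 the sums
   are constant. *)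
case: j => [|j] jT.
  have -> : (fun p => euler (dy (n + p)) (0 * 2 ^ p)) = (fun=> X (0%:R * dy n)).
    by apply/funext => p; apply/funext => w; rewrite mul0n /euler_sum big_ord0 addr0 mul0r.
  exact: cvg_prob_cst.
apply: (euler_sum_cvg rcF wW H lb ls sol).
- by rewrite jT mulr_gt0// dyadic_gt0.
- by move=> p; exact: dyadic_gt0.
- by move=> p; exact: dyadic_refine.
- exact: dyadic_small.
Qed.

Lemma euler_Fmx n j : j%:R * dy n <= T -> Fmx F (j%:R * dy n) (euler (dy n) j).
Proof.
elim: j => [|j IH] jT.
  have -> : euler (dy n) 0 = X 0.
    by apply/funext => w; rewrite /euler_sum big_ord0 addr0.
  by rewrite mul0r; apply: (solution_Fmx rcF sol) => //; move: jT; rewrite mul0r.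
have jj := grid_le n (leqnSn j); have j0 := grid_ge0 n j.
have jT' := le_trans jj jT.
have -> : euler (dy n) j.+1 = fun w => euler (dy n) j w
   + (dy n *: b (j%:R * dy n) (X (j%:R * dy n) w)
    + sigma (j%:R * dy n) (X (j%:R * dy n) w)
        *m (W (j.+1%:R * dy n) w - W (j%:R * dy n) w)).
  by apply/funext => w; rewrite /euler_sum big_ord_recr/= addrA.
have up a c (Y : Omega -> 'M[R]_(a, c)) : Fmx F (j%:R * dy n) Y -> Fmx F (j.+1%:R * dy n) Y.
  exact: (Fmx_mono rcF j0 jj jT).
apply: mx_measurableD; first by apply: up; exact: IH.
apply: mx_measurableD.
  by apply: mx_measurableZ; apply: up; exact: (drift_Fmx rcF H sol).
apply: mx_measurableM; first by apply: up; exact: (diffusion_Fmx rcF H sol).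
exact: (increment_measurable rcF wW j0 jj jT).
Qed.

Let mgood N s : 0 <= s -> s <= T -> measurable (good N s).
Proof. by move=> s0 sT; exact: (Fset_measurable rcF s0 sT (good_F N s0 sT)). Qed.

Definition increment_const N : R := expR T * (8 * coef_bound N).

Lemma increment_const_ge0 N : 0 <= increment_const N.
Proof. by rewrite mulr_ge0 ?expR_ge0// mulr_ge0// coef_bound_ge0. Qed.

Lemma indic_Ele_le (G : set Omega) a c (Y : Omega -> 'M[R]_(a, c)) K :
  measurable G -> mx_measurable Y -> 0 <= K ->
  (forall w, G w -> hsnorm (Y w) ^+ 2 <= K) ->
  Ele P (fun w => \1_G w * hsnorm (Y w) ^+ 2) K.
Proof.
move=> mG mY K0 YK; apply: Ele_mono (Ele_cst P K).
- exact: indic_hsnorm2_measurable.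
- exact: measurable_cst.
- by apply: indic_mul_ge0 => w; exact: sqr_ge0.
- move=> w; rewrite indicE; case: (boolP (w \in G)) => [|_]; last by rewrite mul0r.
  by rewrite inE mul1r => /YK.
Qed.

Lemma euler_increment N n i L : (i + L)%:R * dy n <= T ->
  Ele P (fun w => \1_(good N ((i + L)%:R * dy n)) w
     * hsnorm (euler (dy n) (i + L) w - euler (dy n) i w) ^+ 2)
   (increment_const N * (L%:R * dy n)).
Proof.
move=> iLT.
have tT j : (j <= L)%N -> (i + j)%:R * dy n <= T.
  by move=> jL; apply: le_trans iLT; apply: grid_le; rewrite leq_add2l.
have tI j : (j <= L)%N -> 0 <= (i + j)%:R * dy n <= T by move=> /tT ->; rewrite grid_ge0.
have LT : L%:R * dy n <= T by apply: le_trans iLT; apply: grid_le; rewrite leq_addl.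
have cb0 := coef_bound_ge0 N.
have mT j a c (Y : Omega -> 'M[R]_(a, c)) : (j <= L)%N -> Fmx F ((i + j)%:R * dy n) Y ->
    mx_measurable Y.
  by move=> jL; exact: (Fmx_measurable rcF (grid_ge0 n (i + j)) (tT _ jL)).
have md j : (j <= L)%N ->
    Fmx F ((i + j)%:R * dy n) (fun w => b ((i + j)%:R * dy n) (X ((i + j)%:R * dy n) w)).
  by move=> jL; exact: (drift_Fmx rcF H sol (grid_ge0 n (i + j)) (tT _ jL)).
have ms j : (j <= L)%N ->
    Fmx F ((i + j)%:R * dy n) (fun w => sigma ((i + j)%:R * dy n) (X ((i + j)%:R * dy n) w)).
  by move=> jL; exact: (diffusion_Fmx rcF H sol (grid_ge0 n (i + j)) (tT _ jL)).
have := @euler_local _ _ _ _ P F _ W rcF wW _ L (dy n) (fun j => (i + j)%:R * dy n)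
  (fun j => good N ((i + j)%:R * dy n))
  (fun j w => euler (dy n) (i + j) w - euler (dy n) i w)
  (fun j w => b ((i + j)%:R * dy n) (X ((i + j)%:R * dy n) w))
  (fun j w => sigma ((i + j)%:R * dy n) (X ((i + j)%:R * dy n) w))
  0 (coef_bound N) (coef_bound N).
move=> E; apply: (Ele_le _ (E _ (lexx 0) cb0 cb0 _ _ _ _ _ _ _ _ _ _ _)).
- rewrite add0r /increment_const (_ : 2 * _ + _ = 8 * coef_bound N); last by ring.
  rewrite -[leRHS]mulrA [_ * (L%:R * _)]mulrC; apply: ler_wpM2r; last by rewrite ler_expR.
  by apply: mulr_ge0; [exact: grid_ge0|exact: mulr_ge0].
- by rewrite dyadic_gt0 dyadic_le1.
- by move=> j _; rewrite addnS -natr1 mulrDl mul1r.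
- exact: tI.
- by move=> j jL; apply: good_F; [exact: grid_ge0|exact: tT].
- by move=> j _; apply: good_sub; apply: grid_le; rewrite addnS.
- rewrite (_ : (fun w => _) = fun=> 0); first exact: mx_measurable_cst.
  by apply/funext => w; rewrite addn0 subrr.
- by move=> j jL; exact: md (ltnW jL).
- by move=> j jL; exact: ms (ltnW jL).
- by move=> j w jL; rewrite addnS /euler_sum big_ord_recr/= -[RHS]addrA [X 0 w + (_ + _)]addrA [LHS]addrAC.
- rewrite (_ : (fun w => _) = fun=> 0); first exact: Ele_cst.
  by apply/funext => w; rewrite addn0 subrr hsnorm0 expr0n mulr0.
- move=> j jL; apply: indic_Ele_le => //.
  + exact: mgood (grid_ge0 _ _) (tT _ (ltnW jL)).
  + exact: mT (ltnW jL) (md _ (ltnW jL)).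
  + by move=> w gw; apply: drift_bound; [exact: tI (ltnW jL)|exact: gw].
- move=> j jL; apply: indic_Ele_le => //.
  + exact: mgood (grid_ge0 _ _) (tT _ (ltnW jL)).
  + exact: mT (ltnW jL) (ms _ (ltnW jL)).
  + by move=> w gw; apply: diffusion_bound; [exact: tI (ltnW jL)|exact: gw].
Qed.

Let grid_measurable n j : j%:R * dy n <= T -> mx_measurable (X (j%:R * dy n)).
Proof.
by move=> jT; have j0 := grid_ge0 n j; exact: (Fmx_measurable rcF j0 jT (solution_Fmx rcF sol j0 jT)).
Qed.

(** The limit of [euler_increment] along finer grids. The event constrains all dyadic levels at
    once, so it is the same for every refinement and survives the limit. *)
Lemma solution_increment N n i L : (i + L)%:R * dy n <= T ->
  Ele P (fun w => \1_(good N ((i + L)%:R * dy n)) w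
     * hsnorm (X ((i + L)%:R * dy n) w - X (i%:R * dy n) w) ^+ 2)
   (increment_const N * (L%:R * dy n)).
Proof.
move=> iLT; have iT : i%:R * dy n <= T by apply: le_trans iLT; apply: grid_le; rewrite leq_addr.
have mE p j : j%:R * dy n <= T -> mx_measurable (euler (dy (n + p)) (j * 2 ^ p)).
  rewrite -(dyadic_refine n p) => jT.
  exact: (Fmx_measurable rcF (grid_ge0 _ _) jT (euler_Fmx jT)).
apply: (Ele_cvg_prob (f := fun p w => euler (dy (n + p)) ((i + L) * 2 ^ p) w
   - euler (dy (n + p)) (i * 2 ^ p) w)).
- by move=> p; apply: mx_measurableB; exact: mE.
- by apply: mx_measurableB; exact: grid_measurable.
- exact: mgood (grid_ge0 _ _) iLT.
- by rewrite mulr_ge0 ?increment_const_ge0// grid_ge0.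
- by apply: cvg_probB; exact: dyadic_euler_cvg.
move=> eps eps0; exists 0%N => p _.
have := @euler_increment N (n + p) (i * 2 ^ p) (L * 2 ^ p).
rewrite -mulnDl !dyadic_refine => /(_ iLT); apply: Ele_le.
by rewrite lerDl ltW.
Qed.

Section Coarse.
Variables (n p : nat).

Let K := (2 ^ p)%N.
Let tau i := (i %/ K * K)%N.
Let dp := dy (n + p).

(* The Euler sum of step [dy n] written on the grid of step [dy (n + p)], so
   that both sums can be compared step by step. *)
Definition coarse_euler (j : nat) (w : Omega) : 'cV[R]_d :=
  X 0 w + \sum_(i < j) (dp *: b ((tau i)%:R * dp) (X ((tau i)%:R * dp) w)
    + sigma ((tau i)%:R * dp) (X ((tau i)%:R * dp) w)
        *m (W (i.+1%:R * dp) w - W (i%:R * dp) w)).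

Lemma coarse_eulerE j w : coarse_euler (j * K) w = euler (dy n) j w.
Proof.
rewrite /coarse_euler /euler_sum; congr (_ + _).
rewrite -(big_mkord xpredT (fun i => dp *: b ((tau i)%:R * dp) (X ((tau i)%:R * dp) w)
    + sigma ((tau i)%:R * dp) (X ((tau i)%:R * dp) w)
        *m (W (i.+1%:R * dp) w - W (i%:R * dp) w))).
rewrite big_nat_mul big_mkord; apply: eq_bigr => i _.
rewrite (eq_big_nat _ _ (F2 := fun k => dp *: b (i%:R * dy n) (X (i%:R * dy n) w)
    + sigma (i%:R * dy n) (X (i%:R * dy n) w)
        *m (W (k.+1%:R * dp) w - W (k%:R * dp) w))); last first.
  move=> k /andP[ik ki].
  have -> : tau k = (i * K)%N.
    rewrite /tau; congr (_ * _)%N; apply/eqP; rewrite eqn_leq.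
    by rewrite leq_divRL ?expn_gt0// ik andbT -ltnS ltn_divLR ?expn_gt0.
  by rewrite /dp dyadic_refine.
rewrite big_split/= -mulmx_sumr; congr (_ + _); last congr (_ *m _).
  rewrite big_const_nat -mulnBl subSnn mul1n iter_addr addr0 -scaler_nat scalerA.
  congr (_ *: _); have := dyadic_refine n p 1; rewrite mul1n mul1r => <-.
  by [].
rewrite (telescope_sumr (fun k => W (k%:R * dp) w)) ?leq_mul//.
by rewrite /dp !dyadic_refine.
Qed.

End Coarse.

Definition euler_const N : R :=
  expR T * T * (8 * (c1 N + c2 N * increment_const N)).

Lemma euler_const_ge0 N : 0 <= T -> 0 <= euler_const N.
Proof.
move=> T0; have ic0 := increment_const_ge0 N; rewrite mulr_ge0//.
  by rewrite mulr_ge0 ?expR_ge0.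
apply: mulr_ge0 => //; apply: addr_ge0; first exact: c1_ge0.
by apply: mulr_ge0 => //; exact: c2_ge0.
Qed.

(** Levels [n] and [n + p] are compared on the finer grid. There the difference of the Euler sums
    has as coefficients the increments of [b] and [sigma] along X between a fine time and the last
    coarse time before it; on the event these are controlled by local Lipschitz bounds and
    [solution_increment]. The resulting bound does not depend on [p], and [p] tends to infinity. *)
Lemma solution_euler N n j : j%:R * dy n <= T -> 0 <= T ->
  Ele P (fun w => \1_(good N (j%:R * dy n)) w
     * hsnorm (X (j%:R * dy n) w - euler (dy n) j w) ^+ 2)
   (euler_const N * dy n).
Proof.
move=> jT T0; have ec0 := euler_const_ge0 N T0; have ic0 := increment_const_ge0 N.
have mE p : mx_measurable (euler (dy (n + p)) (j * 2 ^ p)).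
  have := jT; rewrite -(dyadic_refine n p) => jT'.
  exact: (Fmx_measurable rcF (grid_ge0 _ _) jT' (euler_Fmx jT')).
have mEn : mx_measurable (euler (dy n) j).
  exact: (Fmx_measurable rcF (grid_ge0 _ _) jT (euler_Fmx jT)).
apply: (Ele_cvg_prob (f := fun p w => euler (dy (n + p)) (j * 2 ^ p) w - euler (dy n) j w)).
- by move=> p; exact: mx_measurableB.
- by apply: mx_measurableB => //; exact: grid_measurable.
- exact: mgood (grid_ge0 _ _) jT.
- by rewrite mulr_ge0// dyadic_ge0.
- by apply: cvg_probB; [exact: dyadic_euler_cvg|exact: cvg_prob_cst].
move=> eps eps0; exists 0%N => p _.
apply: (@Ele_le _ _ _ _ _ (euler_const N * dy n)); first by rewrite lerDl ltW.
set dp := dy (n + p); set K := (2 ^ p)%N; pose tau i := (i %/ K * K)%N.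
pose L := (j * K)%N.
have LT : L%:R * dp <= T by rewrite /L /dp dyadic_refine.
have tT i : (i <= L)%N -> i%:R * dp <= T by move=> iL; exact: le_trans (grid_le _ iL) LT.
have tI i : (i <= L)%N -> 0 <= i%:R * dp <= T by move=> /tT ->; rewrite grid_ge0.
have tau_le i : (tau i <= i)%N by exact: leq_trunc_div.
have tau_dist i : 0 <= i%:R * dp - (tau i)%:R * dp <= dy n.
  rewrite subr_ge0 grid_le//= -mulrBl -natrB//.
  have := dyadic_refine n p 1; rewrite mul1n mul1r => <-; rewrite -/dp; apply: ler_wpM2r; first exact: dyadic_ge0.
  rewrite ler_nat /tau {1}(divn_eq i K) addKn; apply: ltnW.
  by rewrite ltn_mod expn_gt0.
pose B i w := b (i%:R * dp) (X (i%:R * dp) w) - b ((tau i)%:R * dp) (X ((tau i)%:R * dp) w).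
pose A i w := sigma (i%:R * dp) (X (i%:R * dp) w)
  - sigma ((tau i)%:R * dp) (X ((tau i)%:R * dp) w).
have up i a c (Y : Omega -> 'M[R]_(a, c)) : (i <= L)%N -> Fmx F ((tau i)%:R * dp) Y ->
    Fmx F (i%:R * dp) Y.
  by move=> iL; apply: (Fmx_mono rcF (grid_ge0 _ _) _ (tT i iL)); exact: grid_le.
have mB i : (i <= L)%N -> Fmx F (i%:R * dp) (B i).
  move=> iL; apply: mx_measurableB; first exact: (drift_Fmx rcF H sol (grid_ge0 _ _) (tT i iL)).
  apply: up => //; apply: (drift_Fmx rcF H sol (grid_ge0 _ _)).
  by apply: tT; exact: leq_trans iL.
have mA i : (i <= L)%N -> Fmx F (i%:R * dp) (A i).
  move=> iL; apply: mx_measurableB; first exact: (diffusion_Fmx rcF H sol (grid_ge0 _ _) (tT i iL)).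
  apply: up => //; apply: (diffusion_Fmx rcF H sol (grid_ge0 _ _)).
  by apply: tT; exact: leq_trans iL.
have mT i a c (Y : Omega -> 'M[R]_(a, c)) : (i <= L)%N -> Fmx F (i%:R * dp) Y ->
    mx_measurable Y.
  by move=> iL; exact: (Fmx_measurable rcF (grid_ge0 _ _) (tT i iL)).
pose q := (c1 N + c2 N * increment_const N) * dy n.
have q0 : 0 <= q.
  rewrite mulr_ge0 ?dyadic_ge0//; apply: addr_ge0; first exact: c1_ge0.
  by apply: mulr_ge0 => //; exact: c2_ge0.
have bound a c (Y : Omega -> 'M[R]_(a, c)) i : (i <= L)%N -> Fmx F (i%:R * dp) Y ->
    (forall w, good N (i%:R * dp) w -> hsnorm (Y w) ^+ 2 <=
      c1 N * (i%:R * dp - (tau i)%:R * dp) ^+ 2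
      + c2 N * hsnorm (X (i%:R * dp) w - X ((tau i)%:R * dp) w) ^+ 2) ->
    Ele P (fun w => \1_(good N (i%:R * dp)) w * hsnorm (Y w) ^+ 2) q.
  move=> iL mY Yle.
  have mG := mgood N (grid_ge0 (n + p) i) (tT i iL).
  have mX := grid_measurable (tT i iL).
  have mXt := grid_measurable (le_trans (grid_le (n + p) (tau_le i)) (tT i iL)).
  have mD := indic_hsnorm2_measurable mG (mx_measurableB mX mXt).
  have := @solution_increment N (n + p) (tau i) (i - tau i).
  rewrite subnKC// -/dp => /(_ (tT i iL)) inc.
  have dn := dyadic_ge0 n.
  have [d1 d2] := andP (tau_dist i).
  have E2 : Ele P (fun w => \1_(good N (i%:R * dp)) w
     * hsnorm (X (i%:R * dp) w - X ((tau i)%:R * dp) w) ^+ 2) (increment_const N * dy n).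
    by apply: Ele_le inc; rewrite natrB// mulrBl ler_wpM2l.
  have f0 w : 0 <= \1_(good N (i%:R * dp)) w
     * hsnorm (X (i%:R * dp) w - X ((tau i)%:R * dp) w) ^+ 2.
    by move: w; apply: indic_mul_ge0 => w; exact: sqr_ge0.
  apply: (@Ele_mono _ _ _ _ _ (fun w => c1 N * dy n + c2 N * (\1_(good N (i%:R * dp)) w
     * hsnorm (X (i%:R * dp) w - X ((tau i)%:R * dp) w) ^+ 2))).
  - exact: indic_hsnorm2_measurable mG (mT _ _ _ _ iL mY).
  - by apply: measurable_funD => //; apply: measurable_funM.
  - by apply: indic_mul_ge0 => w; exact: sqr_ge0.
  - move=> w; rewrite indicE; case: (boolP (w \in _)) => [|_]; last first.
      rewrite !mul0r mulr0 addr0; apply: mulr_ge0 => //; exact: c1_ge0.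
    rewrite inE !mul1r => /Yle /le_trans; apply; rewrite lerD2r.
    apply: ler_wpM2l; first exact: c1_ge0.
    apply: (@le_trans _ _ (dy n ^+ 2)); first by apply: lerXn2r; rewrite ?nnegrE.
    by rewrite expr2 ler_piMr// dyadic_le1.
  rewrite /q mulrDl -mulrA; apply: EleD => //.
  - by apply: measurable_funM.
  - by move=> w; rewrite mulr_ge0// c1_ge0.
  - by move=> w; apply: mulr_ge0 => //; exact: c2_ge0.
  - exact: Ele_cst.
  - by apply: EleZ => //; exact: c2_ge0.
have tauI i : (i <= L)%N -> 0 <= (tau i)%:R * dp <= T.
  by move=> iL; apply: tI; exact: leq_trans iL.
have := @euler_local _ _ _ _ P F _ W rcF wW _ L dp (fun i => i%:R * dp)
  (fun i => good N (i%:R * dp))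
  (fun i w => euler dp i w - coarse_euler n p i w) B A 0 q q.
move=> E; have {}E : Ele P (fun w => \1_(good N (L%:R * dp)) w *
     hsnorm (euler dp L w - coarse_euler n p L w) ^+ 2)
    (expR (L%:R * dp) * (0 + L%:R * dp * (2 * q + 6 * q))).
  apply: E => //.
  - by rewrite dyadic_gt0 dyadic_le1.
  - by move=> i _; rewrite -natr1 mulrDl mul1r.
  - by move=> i iL; apply: good_F; [exact: grid_ge0|exact: tT].
  - by move=> i _; apply: good_sub; exact: grid_le.
  - rewrite (_ : (fun w => _) = fun=> 0); first exact: mx_measurable_cst.
    by apply/funext => w; rewrite /euler_sum /coarse_euler !big_ord0 subrr.
  - by move=> i iL; exact: mB (ltnW iL).
  - by move=> i iL; exact: mA (ltnW iL).
  - move=> i w iL; rewrite /euler_sum /coarse_euler !big_ord_recr/= -/dp -/(tau i).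
    rewrite /B /A scalerBr mulmxBl.
    set E1 := \sum_(_ < _) _; set E2 := \sum_(_ < _) _.
    set x1 := dp *: _; set x2 := _ *m _; set y1 := dp *: _; set y2 := _ *m _.
    by apply/matrixP => a c; rewrite !mxE; ring.
  - rewrite (_ : (fun w => _) = fun=> 0); first exact: Ele_cst.
    apply/funext => w; rewrite /euler_sum /coarse_euler !big_ord0 subrr hsnorm0.
    by rewrite expr0n mulr0.
  - move=> i iL; have iL' := ltnW iL; apply: bound => //; first exact: mB.
    move=> w gw; apply: drift_lip; [exact: tI|exact: tauI|exact: gw|].
    by apply: gw; exact: grid_le.
  - move=> i iL; have iL' := ltnW iL; apply: bound => //; first exact: mA.
    move=> w gw; apply: diffusion_lip; [exact: tI|exact: tauI|exact: gw|].
    by apply: gw; exact: grid_le.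
have EC : coarse_euler n p L = euler (dy n) j by apply/funext => w; exact: coarse_eulerE.
move: E; rewrite EC /L /dp dyadic_refine; apply: Ele_le.
rewrite add0r (_ : 2 * q + 6 * q = 8 * q); last by ring.
have -> : euler_const N * dy n = expR T * (T * (8 * q)) by rewrite /euler_const /q; ring.
have q80 : 0 <= 8 * q by exact: mulr_ge0.
apply: ler_pM; [exact: expR_ge0| |by rewrite ler_expR|exact: ler_wpM2r].
by apply: mulr_ge0 => //; exact: grid_ge0.
Qed.

End Localised.

(** * Comparison of the scheme with the solution *)

Lemma two_hsdot_le (R : realType) m n (c : R) (A B : 'M[R]_(m, n)) : 0 < c ->
  2 * hsdot A B <= c^-1 * hsnorm A ^+ 2 + c * hsnorm B ^+ 2.
Proof.
move=> c0; have := sqr_ge0 (hsnorm (A + (- c) *: B)).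
rewrite sqr_hsnormD hsdotZr hsnormZ exprMn real_normK ?num_real// sqrrN => h1.
have cV : 0 < c^-1 by rewrite invr_gt0.
rewrite -(ler_pM2l c0) mulrDr !mulrA mulfV ?gt_eqF// mul1r.
by move: h1; set s := hsdot _ _; nra.
Qed.

(* [D] is the error V - X at a grid time, [g] is X - Y with Y the Euler sum, [b1]
   and [a1] are consistency errors, [b2] and [a2] differences of coefficients at
   V and X. The monotonicity condition can only be used on V - X, and the
   remaining cross term 2 <g, b2> is weighted by [lam]. *)
Lemma comparison_step (R : realType) n p (D g b1 b2 : 'cV[R]_n) (a1 a2 : 'M[R]_(n, p))
    (C del lam : R) : 0 <= C -> 0 < del <= 1 -> 0 < lam ->
  2 * hsdot D b2 + 12 * hsnorm a2 ^+ 2 <= 2 * C * hsnorm D ^+ 2 ->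
  hsnorm ((D + g) + del *: (b1 + b2)) ^+ 2 + 6 * del * hsnorm (a1 + a2) ^+ 2 <=
  (1 + (1 + 4 * C) * del) * hsnorm (D + g) ^+ 2
  + del * (3 * hsnorm b1 ^+ 2 + 12 * hsnorm a1 ^+ 2
           + (4 * C + lam^-1) * hsnorm g ^+ 2 + (lam + 2 * del) * hsnorm b2 ^+ 2).
Proof.
move=> C0 /andP[d0 d1] l0 mono.
rewrite sqr_hsnormD hsdotZr hsnormZ ger0_norm ?(ltW d0)// exprMn hsdotDr.
have h1 := two_hsdot_le (D + g) b1 (@ltr01 R); rewrite invr1 !mul1r in h1.
have h2 := two_hsdot_le g b2 l0.
have h3 := sqr_hsnormD_le b1 b2; have h4 := sqr_hsnormD_le a1 a2.
have h5 : hsnorm D ^+ 2 <= 2 * (hsnorm (D + g) ^+ 2 + hsnorm g ^+ 2).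
  by have := sqr_hsnormD_le (D + g) (- g); rewrite addrK hsnormN.
have h6 := ler_wpM2l C0 h5.
have e2 : hsdot (D + g) b2 = hsdot D b2 + hsdot g b2 by rewrite hsdotDl.
rewrite e2; move: h1 h2 h3 h4 mono h6.
have := sqr_ge0 (hsnorm b1); have := sqr_ge0 (hsnorm b2).
set E := hsnorm (D + g) ^+ 2; set B1 := hsnorm b1 ^+ 2; set B2 := hsnorm b2 ^+ 2.
set A1 := hsnorm a1 ^+ 2; set A2 := hsnorm a2 ^+ 2; set G := hsnorm g ^+ 2.
set BB := hsnorm (b1 + b2) ^+ 2; set AA := hsnorm (a1 + a2) ^+ 2; set DD := hsnorm D ^+ 2.
set x := hsdot (D + g) b1; set y := hsdot D b2; set z := hsdot g b2.
move=> B20 B10 h1 h2 h3 h4 mono h6; move: lam^-1 h2 => u h2.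
have k1 : 2 * x + 2 * y + 2 * z + 6 * AA <=
    (1 + 4 * C) * E + B1 + 12 * A1 + (4 * C + u) * G + lam * B2.
  by lra.
have k2 := ler_wpM2l (ltW d0) k1.
have k3 : del ^+ 2 * BB <= del * (2 * B1) + del * (2 * del * B2).
  have : del ^+ 2 * BB <= del ^+ 2 * (2 * (B1 + B2)) by rewrite ler_wpM2l// sqr_ge0.
  have : del ^+ 2 * B1 <= del * B1.
    by rewrite expr2 -mulrA ler_piMl// mulr_ge0// ltW.
  by rewrite expr2; nra.
have -> : E + 2 * (del * (x + (y + z))) + del ^+ 2 * BB + 6 * del * AA =
  E + del * (2 * x + 2 * y + 2 * z + 6 * AA) + del ^+ 2 * BB by ring.
have -> : (1 + (1 + 4 * C) * del) * E + del * (3 * B1 + 12 * A1 + (4 * C + u) * G +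
    (lam + 2 * del) * B2) = E + del * ((1 + 4 * C) * E + B1 + 12 * A1
     + (4 * C + u) * G + lam * B2) + (del * (2 * B1) + del * (2 * del * B2)) by ring.
by apply: lerD => //; rewrite lerD2l.
Qed.

Lemma Ele_dom4 (R : realType) d (S : measurableType d) (P : probability S R)
    (f g1 g2 g3 g4 : S -> R) (c1 c2 c3 c4 K1 K2 K3 K4 : R) :
  measurable_fun setT f -> measurable_fun setT g1 -> measurable_fun setT g2 ->
  measurable_fun setT g3 -> measurable_fun setT g4 ->
  (forall w, 0 <= f w) -> (forall w, 0 <= g1 w) -> (forall w, 0 <= g2 w) ->
  (forall w, 0 <= g3 w) -> (forall w, 0 <= g4 w) ->
  0 <= c1 -> 0 <= c2 -> 0 <= c3 -> 0 <= c4 ->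
  (forall w, f w <= c1 * g1 w + c2 * g2 w + (c3 * g3 w + c4 * g4 w)) ->
  Ele P g1 K1 -> Ele P g2 K2 -> Ele P g3 K3 -> Ele P g4 K4 ->
  Ele P f (c1 * K1 + c2 * K2 + (c3 * K3 + c4 * K4)).
Proof.
move=> mf m1 m2 m3 m4 f0 g10 g20 g30 g40 c10 c20 c30 c40 fg E1 E2 E3 E4.
have mZ (k : R) (g : S -> R) : measurable_fun setT g -> measurable_fun setT (fun w => k * g w).
  by move=> mg; apply: measurable_funM => //; exact: measurable_cst.
have M12 : measurable_fun setT (fun w => c1 * g1 w + c2 * g2 w).
  by apply: measurable_funD; exact: mZ.
have M34 : measurable_fun setT (fun w => c3 * g3 w + c4 * g4 w).
  by apply: measurable_funD; exact: mZ.
have Z (c : R) (g : S -> R) : 0 <= c -> (forall w, 0 <= g w) -> forall w, 0 <= c * g w.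
  by move=> c0 g0 w; exact: mulr_ge0.
apply: (@Ele_mono _ _ _ _ _ (fun w => c1 * g1 w + c2 * g2 w + (c3 * g3 w + c4 * g4 w))) => //.
  exact: measurable_funD.
apply: EleD => //.
- by move=> w; apply: addr_ge0; exact: Z.
- by move=> w; apply: addr_ge0; exact: Z.
- by apply: EleD; [exact: mZ|exact: mZ|exact: Z|exact: Z|exact: EleZ|exact: EleZ].
- by apply: EleD; [exact: mZ|exact: mZ|exact: Z|exact: Z|exact: EleZ|exact: EleZ].
Qed.

(** * Consistency errors of the coefficients *)

Section SchemeCoefficients.
Context (R : realType) (T : R) (d m : nat) (b : R -> 'cV[R]_d -> 'cV[R]_d)
  (sigma : R -> 'cV[R]_d -> 'M[R]_(d, m)) (C M kappa pp : R) (l q : nat).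
Hypothesis H : sde_coefficients T C M kappa pp l b sigma.
Hypothesis ql : (4 * l.+1 <= q.+1)%N.

(** The time variation is at most [h], so its square is of order [h] at least. In the space
    variation the polynomial Lipschitz factors must be detached from [v - x], whose fourth moment is
    of order [h^2]; dividing by [h] leaves order [h]. The condition [4 * l.+1 <= q.+1] keeps all
    powers within the available moments. *)
Let consistency_aux n p (f : R -> 'cV[R]_d -> 'M[R]_(n, p)) (h eta s t : R) x v :
  0 < h <= 1 -> 0 <= eta <= h -> `|t - s| = eta ->
  hsnorm (f t x - f s x) <= 2 * C * jap x ^+ l.+1 * `|t - s| ->
  hsnorm (f s x - f s v) <= 2 * C * (jap x ^+ l + jap v ^+ l) * hsnorm (x - v) ->
  hsnorm (f t x - f s v) ^+ 2 <= 16 * C ^+ 2 * h * jap x ^+ q.+1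
    + 8 * C ^+ 2 * h * jap v ^+ q.+1 + 16 * C ^+ 2 * h^-1 * hsnorm (v - x) ^+ 4.
Proof.
move=> /andP[h0 h1] /andP[e0 eh] ts f1 f2; have C0 := ltW (coef_C H).
have -> : f t x - f s v = (f t x - f s x) + (f s x - f s v) by rewrite addrA subrK.
apply: (le_trans (sqr_hsnormD_le _ _)); rewrite (hsnormBC v x); rewrite ts in f1.
set z := hsnorm (x - v) in f2 *; have z0 : 0 <= z by exact: hsnorm_ge0.
have s1 : hsnorm (f t x - f s x) ^+ 2 <= 4 * C ^+ 2 * h * jap x ^+ q.+1.
  apply: (@le_trans _ _ ((2 * C * jap x ^+ l.+1 * eta) ^+ 2)).
    by apply: lerXn2r; rewrite ?nnegrE ?hsnorm_ge0 ?(le_trans (hsnorm_ge0 _) f1).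
  have -> : (2 * C * jap x ^+ l.+1 * eta) ^+ 2 =
     4 * C ^+ 2 * (eta ^+ 2 * (jap x ^+ l.+1) ^+ 2) by ring.
  rewrite -[leRHS]mulrA; apply: ler_wpM2l; first by rewrite mulr_ge0// sqr_ge0.
  apply: ler_pM; [exact: sqr_ge0|exact: sqr_ge0| |].
    by have := ler_wpM2l e0 (le_trans eh h1); rewrite mulr1 -expr2 => /le_trans; apply.
  rewrite -exprM; apply: japX_le; apply: leq_trans ql; rewrite mulnC.
  by rewrite leq_mul2r orbT.
(* Young's inequality with weight [h], the one that balances a bounded moment against a fourth
   moment of order [h^2]. *)
have am (a : R) : a ^+ 2 * z ^+ 2 <= (h * a ^+ 4 + h^-1 * z ^+ 4) / 2.
  have hV : 0 < h^-1 by rewrite invr_gt0.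
  have : 0 <= h^-1 * (h * a ^+ 2 - z ^+ 2) ^+ 2 by rewrite mulr_ge0 ?sqr_ge0// ltW.
  have -> : h^-1 * (h * a ^+ 2 - z ^+ 2) ^+ 2 =
    h * a ^+ 4 - 2 * (a ^+ 2 * z ^+ 2) + h^-1 * z ^+ 4 by field; rewrite gt_eqF.
  by move=> ?; lra.
have pw (y : 'cV[R]_d) : (jap y ^+ l) ^+ 4 <= jap y ^+ q.+1.
  rewrite -exprM; apply: japX_le; apply: leq_trans ql; rewrite mulnC.
  by rewrite leq_mul2l leqnSn.
have s2 : hsnorm (f s x - f s v) ^+ 2 <= 4 * C ^+ 2 *
   (h * jap x ^+ q.+1 + h * jap v ^+ q.+1 + 2 * (h^-1 * z ^+ 4)).
  apply: (@le_trans _ _ ((2 * C * (jap x ^+ l + jap v ^+ l) * z) ^+ 2)).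
    by apply: lerXn2r; rewrite ?nnegrE ?hsnorm_ge0 ?(le_trans (hsnorm_ge0 _) f2).
  have -> : (2 * C * (jap x ^+ l + jap v ^+ l) * z) ^+ 2 =
     4 * C ^+ 2 * ((jap x ^+ l + jap v ^+ l) ^+ 2 * z ^+ 2) by ring.
  apply: ler_wpM2l; first by rewrite mulr_ge0// sqr_ge0.
  have a1 := am (jap x ^+ l); have a2 := am (jap v ^+ l).
  have b1 := ler_wpM2l (ltW h0) (pw x); have b2 := ler_wpM2l (ltW h0) (pw v).
  have : (jap x ^+ l + jap v ^+ l) ^+ 2 * z ^+ 2 <=
     2 * ((jap x ^+ l) ^+ 2 * z ^+ 2) + 2 * ((jap v ^+ l) ^+ 2 * z ^+ 2).
    by have := sqr_ge0 ((jap x ^+ l - jap v ^+ l) * z); nra.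
  by move=> ?; lra.
have C20 : 0 <= C ^+ 2 := sqr_ge0 C.
have : 0 <= C ^+ 2 * (h * jap v ^+ q.+1) by rewrite !mulr_ge0 ?japX_ge0 ?sqr_ge0// ltW.
move: s1 s2; set u1 := hsnorm (f t x - _) ^+ 2; set u2 := hsnorm (f s x - f s v) ^+ 2.
have -> : 16 * C ^+ 2 * h * jap x ^+ q.+1 + 8 * C ^+ 2 * h * jap v ^+ q.+1
    + 16 * C ^+ 2 * h^-1 * z ^+ 4 =
  2 * (4 * C ^+ 2 * h * jap x ^+ q.+1 + 4 * C ^+ 2 *
   (h * jap x ^+ q.+1 + h * jap v ^+ q.+1 + 2 * (h^-1 * z ^+ 4))) by ring.
by move=> *; lra.
Qed.

Lemma drift_consistency (h eta s t : R) x v : 0 < h <= 1 -> 0 <= eta <= h ->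
  `|t - s| = eta -> 0 <= s <= T -> 0 <= t <= T ->
  hsnorm (b t x - b s v) ^+ 2 <= 16 * C ^+ 2 * h * jap x ^+ q.+1
    + 8 * C ^+ 2 * h * jap v ^+ q.+1 + 16 * C ^+ 2 * h^-1 * hsnorm (v - x) ^+ 4.
Proof.
by move=> h01 eh ts sT tT; apply: consistency_aux ts _ _ => //;
  [exact: (b_time_jap H)|exact: (b_lip_jap H)].
Qed.

Lemma diffusion_consistency (h eta s t : R) x v : 0 < h <= 1 -> 0 <= eta <= h ->
  `|t - s| = eta -> 0 <= s <= T -> 0 <= t <= T ->
  hsnorm (sigma t x - sigma s v) ^+ 2 <= 16 * C ^+ 2 * h * jap x ^+ q.+1
    + 8 * C ^+ 2 * h * jap v ^+ q.+1 + 16 * C ^+ 2 * h^-1 * hsnorm (v - x) ^+ 4.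
Proof.
by move=> h01 eh ts sT tT; apply: consistency_aux ts _ _ => //;
  [exact: (s_time_jap H)|exact: (s_lip_jap H)].
Qed.

Lemma drift_growth_sqr t x : 0 <= t <= T ->
  hsnorm (b t x) ^+ 2 <= growth_const C M ^+ 2 * jap x ^+ q.+1.
Proof.
move=> tT; apply: (@le_trans _ _ ((growth_const C M * jap x ^+ l.+1) ^+ 2)).
  apply: lerXn2r; rewrite ?nnegrE ?hsnorm_ge0 ?mulr_ge0 ?japX_ge0 ?(growth_const_ge0 H)//.
  exact: (b_growth_jap H).
rewrite exprMn -exprM; apply: ler_wpM2l; first exact: sqr_ge0.
by apply: japX_le; apply: leq_trans ql; rewrite mulnC leq_mul2r orbT.
Qed.

(** The 12 is twice the constant 6 of the Gaussian second moment; the doubling comes from splitting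
    the diffusion error into a consistency part and a difference at equal times. *)
Lemma monotone_coef t x y : 12 <= pp -> 0 <= t <= T ->
  2 * hsdot (x - y) (b t x - b t y) + 12 * hsnorm (sigma t x - sigma t y) ^+ 2
    <= 2 * C * hsnorm (x - y) ^+ 2.
Proof.
move=> pp12 tT; have := coef_mono H x y tT; rewrite dotpE.
have : (12 - pp) * hsnorm (sigma t x - sigma t y) ^+ 2 <= 0.
  by rewrite mulr_le0_ge0 ?sqr_ge0// subr_le0.
by set s := hsdot _ _; set u := hsnorm (sigma t x - _) ^+ 2; move=> *; lra.
Qed.

End SchemeCoefficients.

(** * The scheme against the Euler sums, block by block *)

Section Comparison.
Context (R : realType) (T : R) (disp : measure_display)
  (Omega : measurableType disp) (P : probability Omega R)
  (F : R -> set (set Omega)) (d m : nat) (W : R -> Omega -> 'cV[R]_m).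
Hypothesis rcF : right_continuous_filtration T F.
Hypothesis wW : wiener_process T P F W.
Context (b : R -> 'cV[R]_d -> 'cV[R]_d) (sigma : R -> 'cV[R]_d -> 'M[R]_(d, m))
  (C M kappa pp : R) (l : nat) (X : R -> Omega -> 'cV[R]_d).
Hypothesis H : sde_coefficients T C M kappa pp l b sigma.
Hypothesis lb : locally_lipschitz T b.
Hypothesis ls : locally_lipschitz T sigma.
Hypothesis sol : sde_solution T P F b sigma W X.
Context (q : nat) (r h : R) (Pi : 'cV[R]_d -> 'cV[R]_d).
Hypothesis rk : r * (kappa - 1) <= 1 / 2.
Hypothesis ql : (4 * l.+1 <= q.+1)%N.
Hypothesis rq : 3 <= 2 * r * q%:R.
Hypothesis h01 : 0 < h <= 1.
Hypothesis PiP : ball_projection (h `^ (- r)) Pi.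
Hypothesis T0 : 0 <= T.
Hypothesis ppq : 2 * power_c1 R q <= pp.
Hypothesis pp12 : 12 <= pp.
Variable B : R.
Hypothesis B0 : 0 <= B.
Hypothesis EB : Ele P (fun w => jap (X 0 w) ^+ q.+1) B.

Let h0 : 0 < h. Proof. by case/andP: h01. Qed.
Let h1 : h <= 1. Proof. by case/andP: h01. Qed.
Let C0 : 0 <= C. Proof. exact/ltW/(coef_C H). Qed.
Let mX0 : Fmx F 0 (X 0). Proof. exact: (solution_Fmx rcF sol). Qed.

Local Notation bar := (scheme W b sigma r h (X 0) Pi).
Local Notation pre := (pre_scheme W b sigma r h (X 0) Pi).
Local Notation dy := (dyadic_step h).
Local Notation euler := (euler_sum W b sigma X).
Local Notation mrate := (moment_rate m C M q).

(** Neither this constant nor the three that follow involve [h], the localisation level or the fine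
    grid. *)
Definition scheme_bound : R := expR (mrate * T) * B.
Definition pre_bound : R := (1 + mrate) * scheme_bound.
Definition increment_bound : R :=
  16 * (growth_const C M ^+ 4 * (1 + (2 ^+ 2) ^+ m * (m%:R * gauss_const R 2))) * scheme_bound.
Definition consistency_const : R :=
  16 * C ^+ 2 * scheme_bound + 8 * C ^+ 2 * pre_bound + 16 * C ^+ 2 * increment_bound.

Let mr0 : 0 <= mrate. Proof. exact: (moment_rate_ge0 H). Qed.

Lemma scheme_bound_ge0 : 0 <= scheme_bound.
Proof. by rewrite mulr_ge0// expR_ge0. Qed.
Let sb0 := scheme_bound_ge0.

Lemma pre_bound_ge0 : 0 <= pre_bound.
Proof. by rewrite mulr_ge0// addr_ge0. Qed.
Let pb0 := pre_bound_ge0.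

Lemma increment_bound_ge0 : 0 <= increment_bound.
Proof.
apply: mulr_ge0 => //; apply: mulr_ge0 => //.
have g0 := growth_const_ge0 H; have g2 := gauss_const_ge0 R 2.
apply: mulr_ge0; first exact: exprn_ge0.
by apply: addr_ge0 => //; apply: mulr_ge0; [do 2 apply: exprn_ge0|exact: mulr_ge0].
Qed.
Let ib0 := increment_bound_ge0.

Lemma consistency_const_ge0 : 0 <= consistency_const.
Proof.
have C2 := sqr_ge0 C.
by apply: addr_ge0; first apply: addr_ge0; apply: mulr_ge0 => //; exact: mulr_ge0.
Qed.

Lemma bar_moment k : k%:R * h <= T -> Ele P (fun w => jap (bar k w) ^+ q.+1) scheme_bound.
Proof. exact: (scheme_moment rcF wW H rk ql h01 PiP mX0 T0 ppq B0 EB). Qed.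

Section OneBlock.
Variables (k n : nat).
Hypothesis kT : k.+1%:R * h <= T.
Let K := (2 ^ n)%N.
Let del := dy n.
Let s i := (k * K + i)%:R * del.
Let V i := pre k (i%:R * del).

Let blockE i : s i = k%:R * h + i%:R * del.
Proof.
rewrite /s natrD mulrDl; congr (_ + _); have := @dyadic_refine _ h 0 n k.
by rewrite add0n => ->; rewrite /dyadic_step expr0 divr1.
Qed.

Let del0 : 0 < del. Proof. exact: dyadic_gt0. Qed.
Let Kdel : K%:R * del = h.
Proof.
have := @dyadic_refine _ h 0 n 1; rewrite add0n mul1n => ->.
by rewrite /dyadic_step expr0 divr1 mul1r.
Qed.

Let etaI i : (i <= K)%N -> 0 <= i%:R * del <= h.
Proof. by move=> iK; rewrite grid_ge0//= -Kdel grid_le. Qed.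

Let s_h i : (i <= K)%N -> k%:R * h + i%:R * del <= T.
Proof.
move=> /etaI/andP[_ ih]; apply: le_trans kT; rewrite -natr1 mulrDl mul1r.
by rewrite lerD2l.
Qed.

Let sT i : (i <= K)%N -> s i <= T. Proof. by rewrite blockE; exact: s_h. Qed.
Let s_ge0 i : 0 <= s i. Proof. exact: grid_ge0. Qed.
Let sI i : (i <= K)%N -> 0 <= s i <= T. Proof. by move=> /sT ->; rewrite s_ge0. Qed.
Let k0 : 0 <= k%:R * h. Proof. by rewrite mulr_ge0// ltW. Qed.
Let kT' : k%:R * h <= T.
Proof. by have := s_h (leq0n K); rewrite mul0r addr0. Qed.
Let kI : 0 <= k%:R * h <= T. Proof. by rewrite k0. Qed.
Let ks i : k%:R * h <= s i. Proof. by rewrite blockE lerDl grid_ge0. Qed.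

Let mbar : Fmx F (k%:R * h) (bar k).
Proof. exact: (scheme_Fmx rcF wW H h01 PiP mX0). Qed.

Let mV i : (i <= K)%N -> Fmx F (s i) (V i).
Proof.
move=> iK; rewrite blockE; have /andP[e0 _] := etaI iK.
exact: (pre_scheme_Fmx rcF wW H h01 e0 (s_h iK) mbar).
Qed.

Let up i a c (Y : Omega -> 'M[R]_(a, c)) : (i <= K)%N -> Fmx F (k%:R * h) Y -> Fmx F (s i) Y.
Proof. by move=> iK; exact: (Fmx_mono rcF k0 (ks i) (sT iK)). Qed.

Let mT i a c (Y : Omega -> 'M[R]_(a, c)) : (i <= K)%N -> Fmx F (s i) Y -> mx_measurable Y.
Proof. by move=> iK; exact: (Fmx_measurable rcF (s_ge0 i) (sT iK)). Qed.

Let EV i : (i <= K)%N -> Ele P (fun w => jap (V i w) ^+ q.+1) pre_bound.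
Proof.
move=> iK; have /andP[_ ih] := etaI iK.
apply: Ele_le (pre_scheme_moment rcF wW H rk ql h01 PiP mX0 ppq (etaI iK) (s_h iK)
  (bar_moment kT')).
apply: ler_wpM2r => //; rewrite lerD2l ler_piMr//; exact: le_trans h1.
Qed.

Let Einc i : (i <= K)%N ->
  Ele P (fun w => hsnorm (V i w - bar k w) ^+ 4) (h ^+ 2 * increment_bound).
Proof.
move=> iK; apply: Ele_le (increment4_le rcF wW H ql h01 PiP mX0 sb0 (etaI iK) (s_h iK)
  (bar_moment kT')).
by rewrite /increment_bound le_eqVlt; apply/orP; left; apply/eqP; ring.
Qed.

Let mjapX i (Y : Omega -> 'cV[R]_d) : (i <= K)%N -> Fmx F (s i) Y ->
  measurable_fun setT (fun w => jap (Y w) ^+ q.+1).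
Proof.
move=> iK mY; apply: measurable_funX; apply: measurable_funD; first exact: measurable_cst.
exact: measurable_hsnorm2 (mT iK mY).
Qed.

Let consistent i a c (Y : Omega -> 'M[R]_(a, c)) : (i <= K)%N -> Fmx F (s i) Y ->
  (forall w, hsnorm (Y w) ^+ 2 <= 16 * C ^+ 2 * h * jap (bar k w) ^+ q.+1
    + 8 * C ^+ 2 * h * jap (V i w) ^+ q.+1
    + 16 * C ^+ 2 * h^-1 * hsnorm (V i w - bar k w) ^+ 4) ->
  Ele P (fun w => hsnorm (Y w) ^+ 2) (consistency_const * h).
Proof.
move=> iK mY Yle; have C2 := sqr_ge0 C; have hV : 0 <= h^-1 by rewrite invr_ge0 ltW.
have mB := up iK mbar; have hh := ltW h0.
have -> : consistency_const * h = 16 * C ^+ 2 * h * scheme_bound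
    + 8 * C ^+ 2 * h * pre_bound
    + (16 * C ^+ 2 * h^-1 * (h ^+ 2 * increment_bound) + 0 * 0).
  by rewrite /consistency_const; field; rewrite gt_eqF.
apply: (@Ele_dom4 _ _ _ _ _ (fun w => jap (bar k w) ^+ q.+1) (fun w => jap (V i w) ^+ q.+1)
  (fun w => hsnorm (V i w - bar k w) ^+ 4) (fun=> 0)).
- exact: measurable_hsnorm2 (mT iK mY).
- exact: mjapX iK mB.
- exact: mjapX iK (mV iK).
- apply: measurable_funX; apply: measurable_hsnorm.
  by apply: mx_measurableB; [exact: mT iK (mV iK)|exact: mT iK mB].
- exact: measurable_cst.
- by move=> w; exact: sqr_ge0.
- by move=> w; exact: japX_ge0.
- by move=> w; exact: japX_ge0.
- by move=> w; rewrite exprn_ge0// hsnorm_ge0.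
- by [].
- by apply: mulr_ge0 => //; exact: mulr_ge0.
- by apply: mulr_ge0 => //; exact: mulr_ge0.
- by apply: mulr_ge0 => //; exact: mulr_ge0.
- by [].
- by move=> w; rewrite mul0r addr0; exact: Yle.
- exact: bar_moment.
- exact: EV.
- exact: Einc.
- exact: Ele_cst.
Qed.

Let b1 i w := b (k%:R * h) (bar k w) - b (s i) (V i w).
Let b2 i w := b (s i) (V i w) - b (s i) (X (s i) w).
Let a1 i w := sigma (k%:R * h) (bar k w) - sigma (s i) (V i w).
Let a2 i w := sigma (s i) (V i w) - sigma (s i) (X (s i) w).
Let e i w := V i w - euler del (k * K + i) w.
Let D i w := V i w - X (s i) w.
Let g i w := X (s i) w - euler del (k * K + i) w.

Let mXs i : (i <= K)%N -> Fmx F (s i) (X (s i)).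
Proof. by move=> iK; exact: (solution_Fmx rcF sol (s_ge0 i) (sT iK)). Qed.

Let mcomp_b i (Y : Omega -> 'cV[R]_d) : (i <= K)%N -> Fmx F (s i) Y ->
  Fmx F (s i) (fun w => b (s i) (Y w)).
Proof. by move=> iK; exact: (Fmx_comp (b_borel H (sI iK))). Qed.

Let mcomp_s i (Y : Omega -> 'cV[R]_d) : (i <= K)%N -> Fmx F (s i) Y ->
  Fmx F (s i) (fun w => sigma (s i) (Y w)).
Proof. by move=> iK; exact: (Fmx_comp (sigma_borel H (sI iK))). Qed.

Let mb1 i : (i <= K)%N -> Fmx F (s i) (b1 i).
Proof.
move=> iK; apply: mx_measurableB; last by apply: mcomp_b => //; exact: mV.
by apply: up => //; exact: (Fmx_comp (b_borel H kI) mbar).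
Qed.

Let ma1 i : (i <= K)%N -> Fmx F (s i) (a1 i).
Proof.
move=> iK; apply: mx_measurableB; last by apply: mcomp_s => //; exact: mV.
by apply: up => //; exact: (Fmx_comp (sigma_borel H kI) mbar).
Qed.

Let mb2 i : (i <= K)%N -> Fmx F (s i) (b2 i).
Proof. by move=> iK; apply: mx_measurableB; apply: mcomp_b => //; [exact: mV|exact: mXs]. Qed.

Let ma2 i : (i <= K)%N -> Fmx F (s i) (a2 i).
Proof. by move=> iK; apply: mx_measurableB; apply: mcomp_s => //; [exact: mV|exact: mXs]. Qed.

Let meul i : (i <= K)%N -> Fmx F (s i) (euler del (k * K + i)).
Proof. by move=> iK; exact: (euler_Fmx rcF wW H sol h01 (sT iK)). Qed.

Let me i : (i <= K)%N -> Fmx F (s i) (e i).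
Proof. by move=> iK; apply: mx_measurableB; [exact: mV|exact: meul]. Qed.

Let mg i : (i <= K)%N -> Fmx F (s i) (g i).
Proof. by move=> iK; apply: mx_measurableB; [exact: mXs|exact: meul]. Qed.

Let dist i : `|k%:R * h - s i| = i%:R * del.
Proof. by rewrite blockE opprD addNKr normrN ger0_norm// grid_ge0. Qed.

Let Eb1 i : (i <= K)%N -> Ele P (fun w => hsnorm (b1 i w) ^+ 2) (consistency_const * h).
Proof.
move=> iK; apply: consistent (mb1 iK) _ => // w.
exact: (drift_consistency H ql _ _ h01 (etaI iK) (dist i) (sI iK) kI).
Qed.

Let Ea1 i : (i <= K)%N -> Ele P (fun w => hsnorm (a1 i w) ^+ 2) (consistency_const * h).
Proof.
move=> iK; apply: consistent (ma1 iK) _ => // w.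
exact: (diffusion_consistency H ql _ _ h01 (etaI iK) (dist i) (sI iK) kI).
Qed.

Variable N : nat.
Let G i := good X h N (s i).

Let mG i : (i <= K)%N -> measurable (G i).
Proof.
by move=> iK; exact: (Fset_measurable rcF (s_ge0 i) (sT iK) (good_F rcF sol h01 N (s_ge0 i) (sT iK))).
Qed.

(* Bound on E |b(s, V) - b(s, X)|^2 over [good X h N s]; it depends on N but is
   multiplied by a factor that vanishes with the fine step. *)
Definition stability_const : R :=
  2 * growth_const C M ^+ 2 * pre_bound + 2 * coef_bound C M l N.

Let Eb2 i : (i <= K)%N -> Ele P (fun w => \1_(G i) w * hsnorm (b2 i w) ^+ 2) stability_const.
Proof.
move=> iK; have G2 := sqr_ge0 (growth_const C M).
have -> : stability_const = 2 * growth_const C M ^+ 2 * pre_bound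
   + 2 * coef_bound C M l N * 1 + (0 * 0 + 0 * 0) by rewrite /stability_const; ring.
have cb0 := coef_bound_ge0 C M l N.
apply: (@Ele_dom4 _ _ _ _ _ (fun w => jap (V i w) ^+ q.+1) (fun=> 1) (fun=> 0) (fun=> 0));
  try exact: measurable_cst; try exact: Ele_cst; try by [].
- exact: indic_hsnorm2_measurable (mG iK) (mT iK (mb2 iK)).
- exact: mjapX iK (mV iK).
- by apply: indic_mul_ge0 => w; exact: sqr_ge0.
- by move=> w; exact: japX_ge0.
- exact: mulr_ge0.
- exact: mulr_ge0.
- move=> w; rewrite !mul0r !addr0 mulr1 indicE.
  have J0 : 0 <= 2 * growth_const C M ^+ 2 * jap (V i w) ^+ q.+1.
    by rewrite mulr_ge0 ?japX_ge0// mulr_ge0.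
  case: (boolP (w \in _)) => [|_]; last by rewrite mul0r addr_ge0// mulr_ge0.
  rewrite inE mul1r => Gw; apply: (le_trans (sqr_hsnormD_le _ _)).
  rewrite mulrDr hsnormN -mulrA; apply: lerD; apply: ler_wpM2l => //.
    exact: (drift_growth_sqr H ql _ (sI iK)).
  by apply: (drift_bound H (sI iK)); exact: Gw.
- exact: EV.
Qed.

Variables (lam c A : R).
Hypothesis lam0 : 0 < lam.
Hypothesis c_ge : 15 * (consistency_const * h)
  + ((4 * C + lam^-1) * (euler_const T C M l N * del) + (lam + 2 * del) * stability_const) <= c.
Hypothesis A0 : 0 <= A.

Let del01 : 0 < del <= 1. Proof. by rewrite del0 dyadic_le1. Qed.

Let stepE i w : (i < K)%N -> e i.+1 w = e i w + del *: (b1 i w + b2 i w)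
  + (a1 i w + a2 i w) *m (W (s i.+1) w - W (s i) w).
Proof.
move=> iK; rewrite /e /V /pre_scheme addnS /euler_sum big_ord_recr/=.
have -> : b1 i w + b2 i w = b (k%:R * h) (bar k w) - b (s i) (X (s i) w).
  by rewrite /b1 /b2 addrA subrK.
have -> : a1 i w + a2 i w = sigma (k%:R * h) (bar k w) - sigma (s i) (X (s i) w).
  by rewrite /a1 /a2 addrA subrK.
rewrite -!blockE -/(s i).
have -> : (k * K + i).+1%:R * del = s i.+1 by rewrite /s addnS.
rewrite -[i.+1%:R]natr1 mulrDl mul1r scalerDl scalerBr mulmxBl !mulmxBr.
set E1 := \sum_(_ < _) _.
set x1 := _ *: b (k%:R * h) _; set x2 := del *: b (k%:R * h) _; set x3 := del *: b (s i) _.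
set y1 := _ *m W (s i.+1) w; set y2 := _ *m W (s i) w; set y3 := _ *m W (k%:R * h) w.
set z1 := _ *m W (s i.+1) w; set z2 := _ *m W (s i) w.
by apply/matrixP => u v; rewrite !mxE; ring.
Qed.

(** [comparison_step] and one conditioning are iterated over the fine steps inside a coarse step,
    where no projection takes place. The difference [a2] of diffusions needs no moment bound, being
    absorbed by monotonicity. In [c_ge] the number 15 is 3 + 12, for the consistency errors of drift
    and diffusion. *)
Lemma block_comparison :
  Ele P (fun w => \1_(G 0%N) w * hsnorm (e 0%N w) ^+ 2) A ->
  Ele P (fun w => \1_(G K) w * hsnorm (e K w) ^+ 2)
    (expR ((1 + 4 * C) * h) * (A + h * c)).
Proof.
move=> EA; have cc0 := consistency_const_ge0; have ec0 : 0 <= euler_const T C M l N by exact: euler_const_ge0.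
have st0 : 0 <= stability_const.
  have cb0 := coef_bound_ge0 C M l N; have G2 := sqr_ge0 (growth_const C M).
  by apply: addr_ge0; apply: mulr_ge0 => //; exact: mulr_ge0.
have lV : 0 <= lam^-1 by rewrite invr_ge0 ltW.
have hh := ltW h0; have dd := ltW del0.
have c0 : 0 <= c.
  apply: le_trans c_ge; apply: addr_ge0; first by apply: mulr_ge0 => //; exact: mulr_ge0.
  apply: addr_ge0; apply: mulr_ge0 => //.
  - by apply: addr_ge0 => //; exact: mulr_ge0.
  - exact: mulr_ge0.
  - by apply: addr_ge0; [exact: ltW|exact: mulr_ge0].
have K1 : 0 <= 1 + 4 * C by rewrite addr_ge0// mulr_ge0.
suff key i : (i <= K)%N -> Ele P (fun w => \1_(G i) w * hsnorm (e i w) ^+ 2)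
    (expR ((1 + 4 * C) * (i%:R * del)) * (A + i%:R * del * c)).
  by have := key K (leqnn K); rewrite Kdel.
elim: i => [|i IH] iK; first by rewrite mul0r mulr0 expR0 mul1r mul0r addr0.
apply: (Ele_le (gronwall_step i K1 dd c0 A0)).
set Ai := expR _ * _; have iK' := ltnW iK.
have {}IH : Ele P (fun w => \1_(G i) w * hsnorm (e i w) ^+ 2) Ai by exact: IH.
have Ai0 : 0 <= Ai.
  by rewrite mulr_ge0 ?expR_ge0// addr_ge0// mulr_ge0// grid_ge0.
have sS : s i.+1 = s i + del by rewrite /s addnS -natr1 mulrDl mul1r.
have ilt : s i < s i.+1 by rewrite sS ltrDl.
have mb12 : Fmx F (s i) (fun w => b1 i w + b2 i w).
  by apply: mx_measurableD; [exact: mb1|exact: mb2].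
have mu : Fmx F (s i) (fun w => e i w + del *: (b1 i w + b2 i w)).
  by apply: mx_measurableD; [exact: me|exact: mx_measurableZ].
have ma : Fmx F (s i) (fun w => a1 i w + a2 i w).
  by apply: mx_measurableD; [exact: ma1|exact: ma2].
have GF : F (s i) (G i) by exact: (good_F rcF sol h01 N (s_ge0 i) (sT iK')).
have eE : e i.+1 = fun w => e i w + del *: (b1 i w + b2 i w)
  + (a1 i w + a2 i w) *m (W (s i.+1) w - W (s i) w).
  by apply/funext => w; exact: stepE.
apply: (@Ele_mono _ _ _ _ _ (fun w => \1_(G i) w * hsnorm (e i.+1 w) ^+ 2)).
- exact: indic_hsnorm2_measurable (mG iK) (mT iK (me iK)).
- exact: indic_hsnorm2_measurable (mG iK') (mT iK (me iK)).
- by apply: indic_mul_ge0 => w; exact: sqr_ge0.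
- by apply: indic_mul_le => [|w]; [apply: good_sub; exact: ltW|exact: sqr_ge0].
rewrite eE; apply: (step_second_moment rcF wW (s_ge0 i) ilt (sT iK) GF mu ma).
have -> : s i.+1 - s i = del by rewrite sS addrC addKr.
(* The consistency errors have global moments; the other two terms involve X and keep the
   indicator. *)
pose rest w := 3 * hsnorm (b1 i w) ^+ 2 + 12 * hsnorm (a1 i w) ^+ 2
  + ((4 * C + lam^-1) * (\1_(G i) w * hsnorm (g i w) ^+ 2)
     + (lam + 2 * del) * (\1_(G i) w * hsnorm (b2 i w) ^+ 2)).
have m1 : measurable_fun setT (fun w => hsnorm (b1 i w) ^+ 2).
  exact: measurable_hsnorm2 (mT iK' (mb1 iK')).
have m2 : measurable_fun setT (fun w => hsnorm (a1 i w) ^+ 2).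
  exact: measurable_hsnorm2 (mT iK' (ma1 iK')).
have m3 := indic_hsnorm2_measurable (mG iK') (mT iK' (mg iK')).
have m4 := indic_hsnorm2_measurable (mG iK') (mT iK' (mb2 iK')).
have i2 a a' (Y : Omega -> 'M[R]_(a, a')) w : 0 <= \1_(G i) w * hsnorm (Y w) ^+ 2.
  by move: w; apply: indic_mul_ge0 => w; exact: sqr_ge0.
have lC : 0 <= 4 * C + lam^-1 by apply: addr_ge0 => //; exact: mulr_ge0.
have ld : 0 <= lam + 2 * del by apply: addr_ge0; [exact: ltW|exact: mulr_ge0].
have mrest : measurable_fun setT rest.
  by apply: measurable_funD; apply: measurable_funD; apply: measurable_funM => //;
    exact: measurable_cst.
have rest0 w : 0 <= rest w.
  by apply: addr_ge0; apply: addr_ge0; apply: mulr_ge0 => //; exact: sqr_ge0.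
have Eg : Ele P (fun w => \1_(G i) w * hsnorm (g i w) ^+ 2) (euler_const T C M l N * del).
  exact: (solution_euler rcF wW H lb ls sol h01 N (sT iK') T0).
have Erest : Ele P rest c.
  apply: (Ele_le c_ge).
  have -> : 15 * (consistency_const * h)
    + ((4 * C + lam^-1) * (euler_const T C M l N * del) + (lam + 2 * del) * stability_const) =
    3 * (consistency_const * h) + 12 * (consistency_const * h)
    + ((4 * C + lam^-1) * (euler_const T C M l N * del) + (lam + 2 * del) * stability_const).
    by ring.
  apply: (@Ele_dom4 _ _ _ _ rest _ _ _ _ _ _ _ _ _ _ _ _ mrest m1 m2 m3 m4) => //.
  - by move=> w; exact: sqr_ge0.
  - by move=> w; exact: sqr_ge0.
  - exact: Eb1.
  - exact: Ea1.
  - exact: Eb2.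
have me2 := indic_hsnorm2_measurable (mG iK') (mT iK' (me iK')).
have Kd : 0 <= 1 + (1 + 4 * C) * del by rewrite addr_ge0// mulr_ge0.
apply: (@Ele_mono _ _ _ _ _ (fun w => (1 + (1 + 4 * C) * del) *
   (\1_(G i) w * hsnorm (e i w) ^+ 2) + del * rest w)).
- apply: measurable_funM; first exact: measurable_indic (mG iK').
  apply: measurable_funD; first exact: measurable_hsnorm2 (mT iK' mu).
  apply: measurable_funM; first exact: measurable_cst.
  exact: measurable_hsnorm2 (mT iK' ma).
- by apply: measurable_funD; apply: measurable_funM => //; exact: measurable_cst.
- apply: indic_mul_ge0 => w; apply: addr_ge0; first exact: sqr_ge0.
  by apply: mulr_ge0; [exact: mulr_ge0|exact: sqr_ge0].
- move=> w; have mono := monotone_coef H (V i w) (X (s i) w) pp12 (sI iK').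
  have := comparison_step (g i w) (b1 i w) (a1 i w) C0 del01 lam0 mono.
  have -> : V i w - X (s i) w + g i w = e i w by rewrite /g /e addrA subrK.
  rewrite -/(b2 i w) -/(a2 i w) /rest indicE.
  case: (boolP (w \in G i)) => _; rewrite ?mul1r//.
    by rewrite -![in leRHS]addrA.
  move=> _; rewrite !mul0r !mulr0 !add0r !addr0; apply: mulr_ge0 => //.
  by apply: addr_ge0; apply: mulr_ge0 => //; exact: sqr_ge0.
apply: EleD.
- by apply: measurable_funM => //; exact: measurable_cst.
- by apply: measurable_funM => //; exact: measurable_cst.
- by move=> w; exact: mulr_ge0.
- by move=> w; exact: mulr_ge0.
- exact: EleZ.
- exact: EleZ.
Qed.

End OneBlock.

(** Blocks are chained through the projections. Young's inequality with weight [h] costs a factor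
    [1 + h], which raises [1 + 4 C] to [2 + 4 C] in the exponent, and [8 h^2] times a moment per
    block, that is, a source of order [h] per unit time. The projection of the initial value gives
    the term with [B]. *)
Lemma coarse_comparison N n (lam c : R) k : 0 < lam ->
  15 * (consistency_const * h)
    + ((4 * C + lam^-1) * (euler_const T C M l N * dy n)
       + (lam + 2 * dy n) * stability_const N) <= c ->
  k%:R * h <= T ->
  Ele P (fun w => \1_(good X h N ((k * 2 ^ n)%:R * dy n)) w
     * hsnorm (bar k w - euler (dy n) (k * 2 ^ n) w) ^+ 2)
   (expR ((2 + 4 * C) * (k%:R * h)) * (4 * h * B + k%:R * h * (c + 8 * h * pre_bound))).
Proof.
move=> lam0 c_ge; have hh := ltW h0.
have gridE j : (j * 2 ^ n)%:R * dy n = j%:R * h.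
  by have := @dyadic_refine _ h 0 n j; rewrite add0n => ->; rewrite /dyadic_step expr0 divr1.
have jT j : j%:R * h <= T -> (j * 2 ^ n)%:R * dy n <= T by rewrite gridE.
have mGood j : j%:R * h <= T -> measurable (good X h N ((j * 2 ^ n)%:R * dy n)).
  move=> /jT jT'; have j0 := grid_ge0 h01 n (j * 2 ^ n).
  exact: (Fset_measurable rcF j0 jT' (good_F rcF sol h01 N j0 jT')).
have mEul j : j%:R * h <= T -> mx_measurable (euler (dy n) (j * 2 ^ n)).
  move=> /jT jT'; exact: (Fmx_measurable rcF (grid_ge0 h01 _ _) jT' (euler_Fmx rcF wW H sol h01 jT')).
have mBar j : j%:R * h <= T -> mx_measurable (bar j).
  move=> jT'; have j0 : 0 <= j%:R * h by rewrite mulr_ge0.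
  exact: (Fmx_measurable rcF j0 jT' (scheme_Fmx rcF wW H h01 PiP mX0 jT')).
have c0 : 0 <= c.
  have cc0 := consistency_const_ge0; have dd := dyadic_ge0 h01 n.
  have ec0 : 0 <= euler_const T C M l N by exact: euler_const_ge0.
  have cb0 := coef_bound_ge0 C M l N; have G2 := sqr_ge0 (growth_const C M).
  have lV : 0 <= lam^-1 by rewrite invr_ge0 ltW.
  apply: le_trans c_ge; apply: addr_ge0; first by apply: mulr_ge0 => //; exact: mulr_ge0.
  apply: addr_ge0; apply: mulr_ge0 => //.
  - by apply: addr_ge0 => //; exact: mulr_ge0.
  - exact: mulr_ge0.
  - by apply: addr_ge0; [exact: ltW|exact: mulr_ge0].
  - by apply: addr_ge0; apply: mulr_ge0 => //; exact: mulr_ge0.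
have hpb : 0 <= 8 * h * pre_bound by apply: mulr_ge0 => //; exact: mulr_ge0.
have hB : 0 <= 4 * h * B by apply: mulr_ge0 => //; exact: mulr_ge0.
have mJ (Y : Omega -> 'cV[R]_d) : mx_measurable Y ->
    measurable_fun setT (fun w => jap (Y w) ^+ q.+1).
  move=> mY; apply: measurable_funX; apply: measurable_funD; first exact: measurable_cst.
  exact: measurable_hsnorm2.
elim: k => [|k IH] kT.
  rewrite mul0n !mul0r mulr0 expR0 mul1r addr0.
  have mY0 : mx_measurable (X 0) by exact: (Fmx_measurable rcF (lexx 0) T0 mX0).
  have mb0 := mBar 0%N kT.
  have mD : measurable_fun setT (fun w => hsnorm (bar 0 w - X 0 w) ^+ 2).
    exact: measurable_hsnorm2 (mx_measurableB mb0 mY0).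
  apply: (@Ele_mono _ _ _ _ _ (fun w => 4 * h * jap (X 0 w) ^+ q.+1)).
  - have := indic_hsnorm2_measurable (mGood _ kT) (mx_measurableB mb0 (mEul _ kT)).
    by rewrite mul0n mul0r.
  - by apply: measurable_funM; [exact: measurable_cst|exact: mJ].
  - by apply: indic_mul_ge0 => w; exact: sqr_ge0.
  - move=> w; apply: (@le_trans _ _ (hsnorm (bar 0 w - X 0 w) ^+ 2)).
      rewrite /euler_sum big_ord0 addr0; apply: ler_piMl; first exact: sqr_ge0.
      by rewrite indicE; case: (w \in _).
    apply: (le_trans (scheme0_defect W b sigma (X 0) rq h01 PiP w)).
    apply: ler_wpM2r; first exact: japX_ge0.
    by apply: ler_wpM2l => //; rewrite exprS ler_piMr// exprn_ile1.
  - apply: EleZ => //; [exact: mulr_ge0|exact: mJ|by move=> w; exact: japX_ge0].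
have kT' : k%:R * h <= T by apply: le_trans kT; rewrite ler_wpM2r// ler_nat.
set A := expR _ * _ in IH; have A0 : 0 <= A.
  apply: mulr_ge0; first exact: expR_ge0.
  apply: addr_ge0 => //; apply: mulr_ge0; first exact: mulr_ge0.
  exact: addr_ge0.
have := @block_comparison k n kT N lam c A lam0 c_ge A0.
rewrite addn0 mul0r.
have -> : (fun w => \1_(good X h N ((k * 2 ^ n)%:R * dy n)) w
     * hsnorm (pre k 0 w - euler (dy n) (k * 2 ^ n) w) ^+ 2) =
   (fun w => \1_(good X h N ((k * 2 ^ n)%:R * dy n)) w
     * hsnorm (bar k w - euler (dy n) (k * 2 ^ n) w) ^+ 2).
  by apply/funext => w; rewrite pre_scheme0.
have -> : (2 ^ n)%:R * dy n = h by have := gridE 1%N; rewrite mul1n mul1r.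
have -> : (k * 2 ^ n + 2 ^ n = k.+1 * 2 ^ n)%N by rewrite mulSn addnC.
move=> /(_ (IH kT')) Epre.
have kh : k%:R * h + h <= T by move: kT; rewrite -natr1 mulrDl mul1r.
have kh0 : 0 <= k%:R * h + h by rewrite addr_ge0// mulr_ge0.
have mPre : mx_measurable (pre k h).
  apply: (Fmx_measurable rcF kh0 kh); apply: (pre_scheme_Fmx rcF wW H h01 hh kh).
  exact: (scheme_Fmx rcF wW H h01 PiP mX0 kT').
have EV : Ele P (fun w => jap (pre k h w) ^+ q.+1) pre_bound.
  have hI : 0 <= h <= h by rewrite hh lexx.
  apply: Ele_le (pre_scheme_moment rcF wW H rk ql h01 PiP mX0 ppq hI kh (bar_moment kT')).
  by apply: ler_wpM2r => //; rewrite lerD2l ler_piMr.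
have mG' := mGood _ kT.
have mP := indic_hsnorm2_measurable mG' (mx_measurableB mPre (mEul _ kT)).
apply: (@Ele_le _ _ _ _ _ ((1 + h) * (expR ((1 + 4 * C) * h) * (A + h * c))
   + 8 * h ^+ 2 * pre_bound + (0 * 0 + 0 * 0))).
  rewrite !mul0r !addr0.
  have kS : k.+1%:R * h = k%:R * h + h by rewrite -natr1 mulrDl mul1r.
  have e1 : (1 + h) * expR ((1 + 4 * C) * h) <= expR ((2 + 4 * C) * h).
    have -> : (2 + 4 * C) * h = h + (1 + 4 * C) * h by ring.
    rewrite expRD; apply: ler_wpM2r; [exact: expR_ge0|exact: expR_ge1Dx].
  rewrite mulrA; apply: (@le_trans _ _ (expR ((2 + 4 * C) * h) * (A + h * c)
     + 8 * h ^+ 2 * pre_bound)).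
    by rewrite lerD2r; apply: ler_wpM2r => //; rewrite addr_ge0// mulr_ge0.
  have C40 : 0 <= 2 + 4 * C by rewrite addr_ge0// mulr_ge0.
  have e2 : 1 <= expR ((2 + 4 * C) * (k%:R * h)).
    by rewrite -[leLHS]expR0 ler_expR; apply: mulr_ge0 => //; exact: mulr_ge0.
  have e3 : 1 <= expR ((2 + 4 * C) * h) by rewrite -[leLHS]expR0 ler_expR mulr_ge0.
  have -> : expR ((2 + 4 * C) * (k.+1%:R * h)) =
      expR ((2 + 4 * C) * (k%:R * h)) * expR ((2 + 4 * C) * h).
    by rewrite kS mulrDr expRD.
  rewrite kS /A.
  set E1 := expR ((2 + 4 * C) * (k%:R * h)) in e2 *.
  set E2 := expR ((2 + 4 * C) * h) in e3 *.
  set a := 4 * h * B in hB *; set t := k%:R * h; set pb := pre_bound.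
  have hp : 0 <= 8 * h ^+ 2 * pb by apply: mulr_ge0 => //; apply: mulr_ge0 => //; exact: sqr_ge0.
  have hc : 0 <= h * c by exact: mulr_ge0.
  have -> : (E1 * E2) * (a + (t + h) * (c + 8 * h * pb)) =
     E1 * (a + t * (c + 8 * h * pb)) * E2 + (E1 * E2) * (h * c)
      + (E1 * E2) * (8 * h ^+ 2 * pb) by ring.
  have E12 : E2 <= E1 * E2 by rewrite ler_peMl// (le_trans ler01).
  rewrite [E2 * (_ + _)]mulrDr [E2 * (E1 * _)]mulrC; apply: lerD.
    by rewrite lerD2l ler_wpM2r.
  by rewrite ler_peMl// (le_trans e3).
apply: (@Ele_dom4 _ _ _ _ _ _ (fun w => jap (pre k h w) ^+ q.+1) (fun=> 0) (fun=> 0)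
   _ _ _ _ _ _ _ _ _ mP); try exact: measurable_cst; try exact: Ele_cst; try by [].
- exact: indic_hsnorm2_measurable mG' (mx_measurableB (mBar _ kT) (mEul _ kT)).
- exact: mJ.
- by apply: indic_mul_ge0 => w; exact: sqr_ge0.
- by apply: indic_mul_ge0 => w; exact: sqr_ge0.
- by move=> w; exact: japX_ge0.
- exact: addr_ge0.
- by apply: mulr_ge0 => //; exact: sqr_ge0.
- move=> w; rewrite !mul0r !addr0.
  have J0 : 0 <= 8 * h ^+ 2 * jap (pre k h w) ^+ q.+1.
    by apply: mulr_ge0; [apply: mulr_ge0 => //; exact: sqr_ge0|exact: japX_ge0].
  rewrite indicE; case: (boolP (w \in _)) => _; last by rewrite !mul0r mulr0 add0r.
  rewrite !mul1r schemeS.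
  set v := pre k h w; set y := euler _ _ w.
  have -> : Pi v - y = (v - y) + (Pi v - v) by rewrite [RHS]addrC addrA subrK.
  apply: (le_trans (sqr_hsnormD_eps _ _ h0)); rewrite lerD2l.
  have hV : 0 <= 1 + h^-1 by rewrite addr_ge0// invr_ge0.
  apply: (le_trans (ler_wpM2l hV (projection_defect rq h01 PiP v))).
  rewrite mulrA; apply: ler_wpM2r; first exact: japX_ge0.
  have -> : (1 + h^-1) * (4 * h ^+ 3) = 4 * h ^+ 2 * (h + 1) by field; rewrite gt_eqF.
  have -> : 8 * h ^+ 2 = 4 * h ^+ 2 * 2 by ring.
  by apply: ler_wpM2l; [apply: mulr_ge0 => //; exact: sqr_ge0|have := h1; lra].
Qed.

Definition rate_const : R :=
  expR ((2 + 4 * C) * T) * (4 * B + T * (15 * consistency_const + 8 * pre_bound)).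

Lemma rate_const_ge0 : 0 <= rate_const.
Proof.
have cc0 := consistency_const_ge0.
apply: mulr_ge0; first exact: expR_ge0.
apply: addr_ge0; first exact: mulr_ge0.
by apply: mulr_ge0 => //; apply: addr_ge0; exact: mulr_ge0.
Qed.

Lemma scheme_convergence k : k%:R * h <= T ->
  Ele P (fun w => hsnorm (bar k w - X (k%:R * h) w) ^+ 2) (rate_const * h).
Proof.
move=> kT; have hh := ltW h0; have k0 : 0 <= k%:R * h by rewrite mulr_ge0.
have C40 : 0 <= 2 + 4 * C by rewrite addr_ge0// mulr_ge0.
have cc0 := consistency_const_ge0; have rc0 := rate_const_ge0.
have mb : mx_measurable (bar k).
  exact: (Fmx_measurable rcF k0 kT (scheme_Fmx rcF wW H h01 PiP mX0 kT)).
have mX : mx_measurable (X (k%:R * h)).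
  exact: (Fmx_measurable rcF k0 kT (solution_Fmx rcF sol k0 kT)).
have [N0 [mN0 PN0 ex]] := good_exhaust sol h01 kT.
have mGood N : measurable (good X h N (k%:R * h)).
  exact: (Fset_measurable rcF k0 kT (good_F rcF sol h01 N k0 kT)).
apply: (Ele_exhaust (@good_mono _ _ _ _ X h (k%:R * h)) mGood mN0 PN0 ex).
- exact: measurable_hsnorm2 (mx_measurableB mb mX).
- by move=> w; exact: sqr_ge0.
move=> N.
have dy0 : dy 0 = h by rewrite /dyadic_step expr0 divr1.
have gridE n : (k * 2 ^ n)%:R * dy n = k%:R * h.
  by have := @dyadic_refine _ h 0 n k; rewrite add0n dy0.
apply: (Ele_cvg_prob (f := fun n w => bar k w - euler (dy n) (k * 2 ^ n) w)).
- move=> n; apply: mx_measurableB => //.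
  have nT : (k * 2 ^ n)%:R * dy n <= T by rewrite gridE.
  exact: (Fmx_measurable rcF (grid_ge0 h01 _ _) nT (euler_Fmx rcF wW H sol h01 nT)).
- exact: mx_measurableB.
- exact: mGood.
- exact: mulr_ge0.
- apply: cvg_probB; first exact: cvg_prob_cst.
  have kT0 : k%:R * dy 0 <= T by rewrite dy0.
  by have := dyadic_euler_cvg rcF wW H lb ls sol h01 kT0; rewrite dy0.
move=> eps eps0.
(* The excess [e] allowed in the source is chosen so that, multiplied by [T] and the Gronwall
   factor, it stays below [eps]. *)
have ET0 : 0 < expR ((2 + 4 * C) * T) * (T + 1) by rewrite mulr_gt0 ?expR_gt0// ltr_wpDl.
pose e := eps / (expR ((2 + 4 * C) * T) * (T + 1)).
have e0 : 0 < e by rewrite divr_gt0.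
have cb0 := coef_bound_ge0 C M l N; have G2 := sqr_ge0 (growth_const C M).
have st0 : 0 <= stability_const N.
  by apply: addr_ge0; apply: mulr_ge0 => //; exact: mulr_ge0.
have ec0 : 0 <= euler_const T C M l N by exact: euler_const_ge0.
have st1 : 0 < 2 * (stability_const N + 1) by rewrite mulr_gt0// ltr_wpDl.
(* The order of choices matters: [lam] makes [lam * stability_const N] at most [e / 2]; only then is
   the fine step taken small, since [Q] contains [lam^-1]. *)
pose lam := e / (2 * (stability_const N + 1)).
have lam0 : 0 < lam by rewrite divr_gt0.
have lV : 0 <= lam^-1 by rewrite invr_ge0 ltW.
pose Q := (4 * C + lam^-1) * euler_const T C M l N + 2 * stability_const N.
have Q0 : 0 <= Q.
  by apply: addr_ge0; apply: mulr_ge0 => //; apply: addr_ge0 => //; exact: mulr_ge0.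
have Q1 : 0 < 2 * (Q + 1) by rewrite mulr_gt0// ltr_wpDl.
have q10 : 0 < e / (2 * (Q + 1)) by rewrite divr_gt0.
have [n0 Hn0] := dyadic_small h 0 q10.
exists n0 => n /Hn0; rewrite add0n => dn.
pose c := 15 * (consistency_const * h) + e.
have c_ge : 15 * (consistency_const * h)
    + ((4 * C + lam^-1) * (euler_const T C M l N * dy n)
       + (lam + 2 * dy n) * stability_const N) <= c.
  rewrite lerD2l.
  have -> : (4 * C + lam^-1) * (euler_const T C M l N * dy n)
       + (lam + 2 * dy n) * stability_const N = Q * dy n + lam * stability_const N.
    by rewrite /Q; ring.
  have half (x : R) : 0 <= x -> e / (2 * (x + 1)) * x <= e / 2.
    move=> x0; have x1 : 0 < x + 1 by rewrite ltr_wpDl.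
    have -> : e / (2 * (x + 1)) * x = e / 2 * (x / (x + 1)) by field; rewrite gt_eqF.
    rewrite ler_piMr//; first by rewrite divr_ge0// ltW.
    by rewrite ler_pdivrMr// mul1r lerDl.
  rewrite [e]splitr; apply: lerD; last exact: half.
  apply: le_trans (half Q Q0); rewrite [leRHS]mulrC; apply: ler_wpM2l => //; exact: ltW.
have := coarse_comparison lam0 c_ge kT; rewrite gridE; apply: Ele_le.
have eT : expR ((2 + 4 * C) * (k%:R * h)) <= expR ((2 + 4 * C) * T).
  by rewrite ler_expR ler_wpM2l.
have c0 : 0 <= c by apply: addr_ge0; [apply: mulr_ge0 => //; exact: mulr_ge0|exact: ltW].
have hpb : 0 <= 8 * h * pre_bound by apply: mulr_ge0 => //; exact: mulr_ge0.
apply: (@le_trans _ _ (expR ((2 + 4 * C) * T) * (4 * h * B + T * (c + 8 * h * pre_bound)))).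
  apply: ler_pM => //.
    apply: addr_ge0; first by apply: mulr_ge0 => //; exact: mulr_ge0.
    by apply: mulr_ge0 => //; exact: addr_ge0.
  by rewrite lerD2l; apply: ler_wpM2r => //; exact: addr_ge0.
have -> : expR ((2 + 4 * C) * T) * (4 * h * B + T * (c + 8 * h * pre_bound)) =
   rate_const * h + expR ((2 + 4 * C) * T) * T * e by rewrite /rate_const /c; ring.
rewrite lerD2l; have -> : eps = expR ((2 + 4 * C) * T) * (T + 1) * e.
  by rewrite /e mulrC divfK// gt_eqF.
apply: ler_wpM2r; first exact: ltW.
by apply: ler_wpM2l; [exact: expR_ge0|rewrite lerDl].
Qed.

End Comparison.

(** * Convergence rate *)

Lemma jap_moment (R : realType) (disp : measure_display)
    (Omega : measurableType disp) (P : probability Omega R) d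
    (Y : Omega -> 'cV[R]_d) (n p : nat) : (2 * n <= p)%N -> mx_measurable Y ->
  ('E_P[fun w => (hsnorm (Y w) ^+ p)%R] < +oo)%E ->
  exists2 B : R, 0 <= B & Ele P (fun w => jap (Y w) ^+ n) B.
Proof.
move=> np mY; rewrite unlock => fin.
have mp : measurable_fun setT (fun w => hsnorm (Y w) ^+ p).
  by apply: measurable_funX; exact: measurable_hsnorm.
have p0 w : 0 <= hsnorm (Y w) ^+ p by rewrite exprn_ge0// hsnorm_ge0.
have I0 : (0 <= \int[P]_w (hsnorm (Y w) ^+ p)%:E)%E.
  by apply: integral_ge0 => w _; rewrite lee_fin.
have E : (\int[P]_w (hsnorm (Y w) ^+ p)%:E)%E \is a fin_num by rewrite ge0_fin_numE.
have m2 : measurable_fun setT (fun w => 2 + hsnorm (Y w) ^+ p).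
  by apply: measurable_funD => //; exact: measurable_cst.
exists (2 ^+ n * (2 + fine (\int[P]_w (hsnorm (Y w) ^+ p)%:E)%E)).
  by rewrite mulr_ge0 ?exprn_ge0// addr_ge0// fine_ge0.
apply: (@Ele_mono _ _ _ _ _ (fun w => 2 ^+ n * (2 + hsnorm (Y w) ^+ p))).
- apply: measurable_funX; apply: measurable_funD; first exact: measurable_cst.
  exact: measurable_hsnorm2.
- by apply: measurable_funM => //; exact: measurable_cst.
- by move=> w; exact: japX_ge0.
- move=> w; apply: (le_trans (exprD_le2 n ler01 (sqr_ge0 (hsnorm (Y w))))).
  rewrite expr1n -exprM; apply: ler_wpM2l; first exact: exprn_ge0.
  have := ler_expr_1D (hsnorm_ge0 (Y w)) np; lra.
apply: EleZ => //; first by move=> w; rewrite addr_ge0.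
apply: EleD => //; first exact: Ele_cst.
by rewrite /Ele fineK.
Qed.

Lemma rate_root (R : realType) (disp : measure_display)
    (Omega : measurableType disp) (P : probability Omega R) (f : Omega -> R) (K h : R) :
  (forall w, 0 <= f w) -> 0 <= K -> 0 <= h -> Ele P f (K * h) ->
  (('E_P[f]) `^ (1 / 2)%R <= (K `^ (1 / 2) * h `^ (1 / 2))%:E)%E.
Proof.
move=> f0 K0 h0 fK; rewrite -powRM// -poweR_EFin unlock.
have I0 : (0 <= \int[P]_w (f w)%:E)%E by apply: integral_ge0 => w _; rewrite lee_fin.
apply: gt0_ler_poweR => //.
- by rewrite in_itv/= I0 leey.
- by rewrite in_itv/= lee_fin mulr_ge0// leey.
Qed.

Theorem proposition2p2 (R : realType) (r : R) (hr : 0 < r) :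
  exists pmin : nat, forall p0 : nat,
  (2 < p0)%N -> ~~ odd p0 -> (pmin <= p0)%N ->
  forall (T : R) (disp : measure_display) (Omega : measurableType disp)
    (P : probability Omega R) (F : R -> set (set Omega)) (d m : nat)
    (W : R -> Omega -> 'cV[R]_m)
    (b : R -> 'cV[R]_d -> 'cV[R]_d) (sigma : R -> 'cV[R]_d -> 'M[R]_(d, m))
    (X : R -> Omega -> 'cV[R]_d) (Pi : R -> 'cV[R]_d -> 'cV[R]_d)
    (C kappa : R),
  0 < T ->
  measure_is_complete P ->
  right_continuous_filtration T F ->
  wiener_process T P F W ->
  locally_lipschitz T b ->
  locally_lipschitz T sigma ->
  sde_solution T P F b sigma W X ->
  0 < C ->
  (* (i) *)
  (forall (t : R) (x y : 'cV[R]_d), 0 <= t <= T ->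
    dotp (x - y) (b t x - b t y)
      + (p0%:R - 1) / 2 * hsnorm (sigma t x - sigma t y) ^+ 2
    <= C * hsnorm (x - y) ^+ 2) ->
  (* (ii) *)
  (exists M : R, forall t : R, 0 <= t <= T ->
    Num.max (hsnorm (b t 0)) (hsnorm (sigma t 0)) <= M) ->
  ('E_P[fun w => (hsnorm (X 0%R w) ^+ p0)%R] < +oo)%E ->
  (* (iii) *)
  1 <= kappa ->
  (forall (t : R) (x y : 'cV[R]_d), 0 <= t <= T ->
    hsnorm (b t x - b t y)
    <= C * (1 + hsnorm x `^ (kappa - 1) + hsnorm y `^ (kappa - 1))
         * hsnorm (x - y)) ->
  (forall (t : R) (x y : 'cV[R]_d), 0 <= t <= T ->
    hsnorm (sigma t x - sigma t y)
    <= C * (1 + hsnorm x `^ ((kappa - 1) / 2) + hsnorm y `^ ((kappa - 1) / 2))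
         * hsnorm (x - y)) ->
  (* (iv) *)
  (forall (t s : R) (x : 'cV[R]_d), 0 <= t <= T -> 0 <= s <= T ->
    hsnorm (b t x - b s x)
    <= C * (1 + hsnorm x `^ kappa) * `|t - s|) ->
  (forall (t s : R) (x : 'cV[R]_d), 0 <= t <= T -> 0 <= s <= T ->
    hsnorm (sigma t x - sigma s x)
    <= C * (1 + hsnorm x `^ ((kappa + 1) / 2)) * `|t - s|) ->
  (1 < kappa -> r < 1 / (2 * (kappa - 1))) ->
  (forall h : R, 0 < h <= 1 -> ball_projection (h `^ (- r)) (Pi h)) ->
  exists K : R, forall (h : R) (k : nat), 0 < h <= 1 -> k%:R * h <= T ->
    (('E_P[fun w => (hsnorm (projected_scheme b sigma W (X 0) r h (Pi h) k w
                             - X (k%:R * h) w) ^+ 2)%R]) `^ (1 / 2)%R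
     <= (K * h `^ (1 / 2))%:E)%E.
Proof.
(* The condition on [r] bounds [kappa - 1] by [1 / (2 r)], so this [l] serves every admissible
   [kappa]. *)
pose l := (Num.truncn (1 / (2 * r))).+1.
(* The first summand covers the polynomial growth in the consistency errors, the second ensures
   [3 <= 2 r q] for the projections. *)
pose q := (4 * l.+1 + (Num.truncn (3 / (2 * r))).+1)%N.
(* In order: the moment of order [2 * q.+1] of the initial value, [2 * power_c1 R q <= p0 - 1] for
   the moments of the scheme, and [12 <= p0 - 1] for the comparison. *)
exists (maxn (2 * q.+1) (maxn (Num.truncn (2 * power_c1 R q)).+2 14)).
move=> p0 _ _; rewrite !geq_max => /and3P[p0q p0c p014].
move=> T disp Omega P F d m W b sigma X Pi C kappa T0 _ rcF wW lb ls sol C0 mono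
  [M bs0] EX k1 bx sx bt st rkap PiP.
have r20 : 0 < 2 * r by rewrite mulr_gt0.
have rk : r * (kappa - 1) <= 1 / 2.
  (* For [kappa = 1] the product vanishes, whatever [r] is. *)
  move: k1; rewrite le_eqVlt => /predU1P[<-|k1]; first by rewrite subrr mulr0 divr_ge0.
  have k10 : 0 < kappa - 1 by rewrite subr_gt0.
  have := rkap k1; rewrite ltr_pdivlMr ?mulr_gt0// => ?.
  by rewrite ler_pdivlMr//; lra.
have kl : kappa - 1 <= l%:R.
  apply: (@le_trans _ _ (1 / (2 * r))); last exact/ltW/Num.Theory.truncnS_gt.
  by rewrite ler_pdivlMr//; lra.
have ql : (4 * l.+1 <= q.+1)%N by rewrite /q -addnS leq_addr.
have rq : 3 <= 2 * r * q%:R.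
  rewrite mulrC -ler_pdivrMr//; apply: (@le_trans _ _ (Num.truncn (3 / (2 * r))).+1%:R).
    exact/ltW/Num.Theory.truncnS_gt.
  by rewrite ler_nat leq_addl.
have p0S (n : nat) : (n.+1 <= p0)%N -> n%:R <= p0%:R - 1 :> R.
  by move=> np; rewrite lerBrDr natr1 ler_nat.
have ppq : 2 * power_c1 R q <= p0%:R - 1.
  apply: le_trans (p0S _ p0c); exact/ltW/Num.Theory.truncnS_gt.
have pp12 : 12 <= p0%:R - 1 :> R by apply: p0S; exact: leq_trans p014.
have H : sde_coefficients T C (Num.max M 0) kappa (p0%:R - 1) l b sigma.
  split => //; first by rewrite le_max lexx orbT.
  - by move=> t /bs0; rewrite ge_max le_max => /andP[-> _].
  - by move=> t /bs0; rewrite ge_max le_max => /andP[_ ->].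
have T00 := ltW T0.
have mX0 : mx_measurable (X 0).
  exact: (Fmx_measurable rcF (lexx 0) T00 (solution_Fmx rcF sol (lexx 0) T00)).
have [B B0 EB] := jap_moment p0q mX0 EX.
exists (rate_const T m C (Num.max M 0) q B `^ (1 / 2)) => h k h01 kT.
have h0 : 0 <= h by case/andP: h01 => /ltW.
have RK := scheme_convergence rcF wW H lb ls sol rk ql rq h01 (PiP h h01) T00 ppq pp12 B0 EB kT.
apply: rate_root => //; first by move=> w; exact: sqr_ge0.
exact: (rate_const_ge0 H).
Qed.
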